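(* The quantum $SU(2)$ representations $\rho_k$ of the mapping class group of the closed torus, which is isomorphic to $SL(2,\mathbb Z)$, converge in the Fell topology, as the level $k\to\infty$, to the irreducible component $\mu'$, on the space $L^2_{\rm odd}(\mathbb R)$ of odd functions, of the metaplectic representation $\mu$ of $SL(2,\mathbb Z)$ on $L^2(\mathbb R)$. Explicitly: the phases of $\rho_k(S),\rho_k(T)$ (for all $k$) and of $\mu'(S),\mu'(T)$ can be chosen so that all of these become linear unitary representations of $SL(2,\mathbb Z)$, so that the phase factors used for $\rho_k$ have a limit as $k\to\infty$, and so that the resulting linear representations satisfy the following: for every unit vector $f\in L^2_{\rm odd}(\mathbb R)$, every finite subset $F\subset SL(2,\mathbb Z)$ and every $\epsilon>0$, for all sufficiently large $k$ there is a unit vector $v_k$ in the space of $\rho_k$ with $$|(f,\mu'(g)f)-(v_k,\rho_k(g)v_k)|<\epsilon\quad\text{for all } g\in F.$$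
   Context: Let $S=\begin{pmatrix}0&1\\-1&0\end{pmatrix}$ and $T=\begin{pmatrix}1&1\\0&1\end{pmatrix}$ be the standard generators of $SL(2,\mathbb Z)=\langle S,T\mid S^4=1,\ S^2=(ST)^3\rangle$. Quantum $SU(2)$ representations of the torus. For level $k\ge1$ put $r=k+2$. The level $k$ quantum $SU(2)$ representation $\rho_k$ of $\mathcal M_{1,0}\cong SL(2,\mathbb Z)$ is the projective unitary representation on the Hilbert space with orthonormal basis $e_l$, $0\le l\le r-2$, given up to phases by $$\rho_k(T)e_l=e^{-\pi i l(l+2)/2r}e_l,\qquad \rho_k(S)e_l=\sum_{m=0}^{r-2}\sqrt{2/r}\,\sin\!\big(\pi(l+1)(m+1)/r\big)\,e_m .$$ ''Choosing phases'' means multiplying the operators assigned to $S$ and to $T$ by complex numbers of absolute value $1$. Metaplectic representation. The metaplectic representation restricted to $SL(2,\mathbb Z)$ is the projective unitary representation $\mu$ on $L^2(\mathbb R)$ given up to phases by $\mu(S)f(x)=\int_{\mathbb R}e^{2\pi i xy}f(y)\,dy$ and $\mu(T)f(x)=e^{-\pi i x^2}f(x)$. Its restriction $\mu'$ to the invariant subspace $L^2_{\rm odd}(\mathbb R)$ of odd functions is given up to phases by $\mu'(S)f(x)=\int_{\mathbb R}\sin(2\pi xy)f(y)\,dy$ and $\mu'(T)f(x)=e^{-\pi i x^2}f(x)$. Fell topology. On the set of unitary representations of a discrete group $G$, basic neighbourhoods of $(H,\rho)$ are determined by a finite $F\subset G$, $\epsilon>0$ and a unit vector $v\in H$; they consist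 of the representations $(H',\sigma)$ for which there is a unit vector $v'\in H'$ with $|(v,\rho(g)v)-(v',\sigma(g)v')|<\epsilon$ for all $g\in F$. *)

(* Defs.v *)
From HB Require Import structures.
From mathcomp Require Import all_boot all_order all_algebra.
From mathcomp Require Import complex ring.
From mathcomp Require Import all_classical all_reals all_analysis.

Set Implicit Arguments.
Unset Strict Implicit.
Unset Printing Implicit Defensive.

Import Order.TTheory GRing.Theory Num.Theory numFieldNormedType.Exports.

Local Open Scope classical_set_scope.
Local Open Scope complex_scope.
Local Open Scope ring_scope.

Record SL2Z := MkSL2Z { SL2Z_mx :> 'M[int]_2; SL2Z_det : \det SL2Z_mx == 1 }.

HB.instance Definition _ := [isSub for SL2Z_mx].
HB.instance Definition _ := [Choice of SL2Z by <:].

Section SL2Z_group.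

Fact SL2Z_one_subproof : \det (1%:M : 'M[int]_2) == 1.
Proof. by rewrite det1. Qed.

Fact SL2Z_mul_subproof (A B : SL2Z) : \det (SL2Z_mx A *m SL2Z_mx B) == 1.
Proof. by rewrite det_mulmx (eqP (SL2Z_det A)) (eqP (SL2Z_det B)) mulr1. Qed.

Lemma SL2Z_mulmx_adj (A : SL2Z) : SL2Z_mx A *m \adj (SL2Z_mx A) = 1%:M.
Proof. by rewrite mul_mx_adj (eqP (SL2Z_det A)). Qed.

Lemma SL2Z_adj_mulmx (A : SL2Z) : \adj (SL2Z_mx A) *m SL2Z_mx A = 1%:M.
Proof. by rewrite mul_adj_mx (eqP (SL2Z_det A)). Qed.

Fact SL2Z_inv_subproof (A : SL2Z) : \det (\adj (SL2Z_mx A)) == 1.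
Proof.
have := congr1 determinant (SL2Z_mulmx_adj A).
by rewrite det_mulmx (eqP (SL2Z_det A)) mul1r det1 => ->.
Qed.

Definition SL2Z_one := MkSL2Z SL2Z_one_subproof.
Definition SL2Z_mul (A B : SL2Z) := MkSL2Z (SL2Z_mul_subproof A B).
Definition SL2Z_inv (A : SL2Z) := MkSL2Z (SL2Z_inv_subproof A).

Fact SL2Z_mulA : associative SL2Z_mul.
Proof. by move=> A B C; apply: val_inj; rewrite /= mulmxA. Qed.
Fact SL2Z_mul1 : left_id SL2Z_one SL2Z_mul.
Proof. by move=> A; apply: val_inj; rewrite /= mul1mx. Qed.
Fact SL2Z_mulr1 : right_id SL2Z_one SL2Z_mul.
Proof. by move=> A; apply: val_inj; rewrite /= mulmx1. Qed.
Fact SL2Z_mulV : left_inverse SL2Z_one SL2Z_inv SL2Z_mul.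
Proof. by move=> A; apply: val_inj; rewrite /= SL2Z_adj_mulmx. Qed.
Fact SL2Z_mulrV : right_inverse SL2Z_one SL2Z_inv SL2Z_mul.
Proof. by move=> A; apply: val_inj; rewrite /= SL2Z_mulmx_adj. Qed.

HB.instance Definition _ := isGroup.Build SL2Z
  SL2Z_mulA SL2Z_mul1 SL2Z_mulr1 SL2Z_mulV SL2Z_mulrV.

Fact SL2Z_S_subproof :
  \det (\matrix_(i < 2, j < 2)
     nth 0 (nth [::] [:: [:: 0; 1]; [:: -1; 0]] i) j : 'M[int]_2) == 1.
Proof. by rewrite (expand_det_row _ ord0) !big_ord_recl big_ord0 /cofactor !det_mx11 !mxE. Qed.

Fact SL2Z_T_subproof :
  \det (\matrix_(i < 2, j < 2)
     nth 0 (nth [::] [:: [:: 1; 1]; [:: 0; 1]] i) j : 'M[int]_2) == 1.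
Proof. by rewrite (expand_det_row _ ord0) !big_ord_recl big_ord0 /cofactor !det_mx11 !mxE. Qed.

Definition SL2Z_S : SL2Z := MkSL2Z SL2Z_S_subproof.
Definition SL2Z_T : SL2Z := MkSL2Z SL2Z_T_subproof.

End SL2Z_group.

Section Representations.
Variable R : realType.
Local Notation C := R[i].

(* Each [rho g] is onto since [rho g^-1] is its inverse, so isometric and
   unitary are the same here. *)
Definition unitary_rep (G : groupType) (H : lmodType C)
    (dot : {dot H for Num.conj}) (rho : G -> {linear H -> H}) : Prop :=
  [/\ forall v, rho 1%g v = v,
      forall g h v, rho (g * h)%g v = rho g (rho h v) &
      forall g u v, dot (rho g u) (rho g v) = dot u v].

(* [(H', sigma)] lies in the basic Fell neighbourhood of [(H, rho)] given by
   [F], [eps] and [v].  The forms are linear on the left and conjugate-linear on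
   the right; the opposite convention conjugates both coefficients and so gives
   the same neighbourhood. *)
Definition fell_basic_nbhd (G : groupType)
    (H : lmodType C) (dot : {dot H for Num.conj}) (rho : G -> {linear H -> H})
    (F : set G) (eps : R) (v : H)
    (H' : lmodType C) (dot' : {dot H' for Num.conj})
    (sigma : G -> {linear H' -> H'}) : Prop :=
  exists2 v' : H', dot' v' v' = 1 &
    forall g, F g -> `|dot v (rho g v) - dot' v' (sigma g v')| < eps%:C.

End Representations.

Section L2fun.
Variable R : realType.
Local Notation C := R[i].
Local Notation mu := (@lebesgue_measure R : {measure set (measurableTypeR R) -> \bar R}).
Local Notation RM := (measurableTypeR R).
Local Notation Re := complex.Re.
Local Notation Im := complex.Im.

Definition Cintegral (D : set R) (f : R -> C) : C :=
  (\int[mu]_(x in D) Re (f x)) +i* (\int[mu]_(x in D) Im (f x)).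

(* f is measurable with |f|^2 integrable iff Re f and Im f both are. *)
Definition sqint : {pred R -> C} :=
  [pred f : R -> C | ((fun x => Re (f x)) \in @Lfun _ RM R mu 2%:E)
                  && ((fun x => Im (f x)) \in @Lfun _ RM R mu 2%:E)].

Fact sqint_submod_closed : submod_closed sqint.
Proof.
have [h0 h] := @Lfun_submod_closed _ RM R mu 2%:E (lee1n 2).
split; first by apply/andP; split.
move=> a f g /andP[f1 f2] /andP[g1 g2]; apply/andP; split.
  have -> : (fun x => Re ((a *: f + g) x)) =
    Re a *: (fun x => Re (f x)) + ((- Im a) *: (fun x => Im (f x)) +
    (fun x => Re (g x))) :> (RM -> R).
    apply/funext => x; rewrite !fctE; case: a (f x) (g x) => [? ?] [? ?] [? ?] /=.
    by rewrite [in RHS]addrA; congr (_ + _ + _); rewrite -mulNr.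
  by apply: (h) => //; apply: (h).
have -> : (fun x => Im ((a *: f + g) x)) =
  Re a *: (fun x => Im (f x)) + (Im a *: (fun x => Re (f x)) +
  (fun x => Im (g x))) :> (RM -> R).
  apply/funext => x; rewrite !fctE; case: a (f x) (g x) => [? ?] [? ?] [? ?] /=.
  by rewrite addrA.
by apply: (h) => //; apply: (h).
Qed.

HB.instance Definition _ := GRing.isSubmodClosed.Build _ _ sqint
  sqint_submod_closed.

Record L2fun := MkL2fun { L2fun_val :> R -> C; L2funP : L2fun_val \in sqint }.

HB.instance Definition _ := [isSub for L2fun_val].
HB.instance Definition _ := [Choice of L2fun by <:].
HB.instance Definition _ := [SubChoice_isSubLmodule of L2fun by <:].

Let ae_filter : Filter (almost_everywhere mu) := ae_filter_ringOfSetsType mu.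

Definition ae_null : {pred L2fun} :=
  [pred f : L2fun | `[< {ae mu, forall x, f x = 0} >]].

Lemma ae_nullP (f : L2fun) :
  reflect {ae mu, forall x, f x = 0} (f \in ae_null).
Proof. exact: asboolP. Qed.

Fact ae_null_scale (a : C) (f : L2fun) : f \in ae_null -> a *: f \in ae_null.
Proof.
have FF := ae_filter.
move=> /ae_nullP f0; apply/ae_nullP; move: f0; apply: filterS => x /= fx0.
by rewrite /= fctE /= fx0 scaler0.
Qed.

Fact ae_null_zmod_closed : zmod_closed ae_null.
Proof.
have FF := ae_filter.
split; first by apply/ae_nullP; exact: aeW.
move=> f g /ae_nullP f0 /ae_nullP g0; apply/ae_nullP.
by move: f0 g0; apply: filterS2 => x /= fx0 gx0; rewrite !fctE /= fx0 gx0 subrr.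
Qed.

HB.instance Definition _ := GRing.isZmodClosed.Build _ ae_null
  ae_null_zmod_closed.

End L2fun.

Section L2.
Variable R : realType.
Local Notation C := R[i].
Local Notation mu := (@lebesgue_measure R : {measure set (measurableTypeR R) -> \bar R}).
Local Open Scope quotient_scope.

(* Square-integrable functions modulo equality almost everywhere. *)
Definition L2 : Type := Quotient.quot (@ae_null R).
HB.instance Definition _ := GRing.Zmodule.on L2.
HB.instance Definition _ := EqQuotient.on L2.

Definition L2_class (f : L2fun R) : L2 := \pi f.

Definition L2_to_fun (u : L2) : L2fun R := repr u.
Coercion L2_to_fun : L2 >-> L2fun.

Lemma L2_to_funK : cancel L2_to_fun L2_class.
Proof. exact: reprK. Qed.

Lemma L2_classP (f g : L2fun R) :
  reflect (L2_class f = L2_class g) (f - g \in @ae_null R).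
Proof. by rewrite Quotient.idealrBE; exact: eqP. Qed.

Lemma L2_class_null (f : L2fun R) : L2_to_fun (L2_class f) - f \in @ae_null R.
Proof. by apply/L2_classP; rewrite L2_to_funK. Qed.

Lemma L2_classD (f g : L2fun R) : L2_class (f + g) = L2_class f + L2_class g.
Proof. exact: (@Quotient.pi_add _ (@ae_null R)). Qed.

Definition L2_scale (a : C) (u : L2) : L2 := L2_class (a *: L2_to_fun u).

Lemma L2_scale_class a (f : L2fun R) :
  L2_scale a (L2_class f) = L2_class (a *: f).
Proof. by apply/L2_classP; rewrite -scalerBr ae_null_scale// L2_class_null. Qed.

Fact L2_scalerA a b u : L2_scale a (L2_scale b u) = L2_scale (a * b) u.
Proof.
by rewrite -[u]L2_to_funK (L2_scale_class b) 2!L2_scale_class scalerA.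
Qed.

Fact L2_scale1r : left_id 1 L2_scale.
Proof. by move=> u; rewrite /L2_scale scale1r L2_to_funK. Qed.

Fact L2_scalerDr : right_distributive L2_scale +%R.
Proof.
move=> a u v; rewrite -[u]L2_to_funK -[v]L2_to_funK -L2_classD.
by rewrite !L2_scale_class scalerDr L2_classD.
Qed.

Fact L2_scalerDl u : {morph L2_scale^~ u : a b / a + b}.
Proof. by move=> a b; rewrite /L2_scale scalerDl L2_classD. Qed.

HB.instance Definition _ := GRing.Zmodule_isLmodule.Build C L2
  L2_scalerA L2_scale1r L2_scalerDr L2_scalerDl.

Lemma L2_classZ a (f : L2fun R) : L2_class (a *: f) = a *: L2_class f.
Proof. by rewrite -L2_scale_class. Qed.

Lemma L2_class0 : L2_class 0 = 0.
Proof. by rewrite -[X in L2_class X](scale0r 0) L2_classZ scale0r. Qed.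

End L2.

Section L2dot.
Variable R : realType.
Local Notation C := R[i].
Local Notation mu :=
  (@lebesgue_measure R : {measure set (measurableTypeR R) -> \bar R}).
Local Notation RM := (measurableTypeR R).
Local Notation Re := complex.Re.
Local Notation Im := complex.Im.
Implicit Types f g h : L2fun R.

Let ae_filter : Filter (almost_everywhere mu) := ae_filter_ringOfSetsType mu.

Let prodc (f g : R -> C) : R -> C := fun x => f x * (g x)^*%R.

Let Re_prodc (f g : R -> C) x :
  Re (prodc f g x) = Re (f x) * Re (g x) + Im (f x) * Im (g x).
Proof. by rewrite /prodc; case: (f x) (g x) => [? ?] [? ?] /=; ring. Qed.

Let Im_prodc (f g : R -> C) x :
  Im (prodc f g x) = Im (f x) * Re (g x) - Re (f x) * Im (g x).
Proof. by rewrite /prodc; case: (f x) (g x) => [? ?] [? ?] /=; ring. Qed.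

Let integrable_prod (u v : RM -> R) :
  u \in Lfun mu 2%:E -> v \in Lfun mu 2%:E ->
  mu.-integrable setT (EFin \o (fun x => u x * v x)).
Proof. by move=> u2 v2; apply/Lfun1_integrable; exact: Lfun2_mul_Lfun1. Qed.

Let intRe f g : mu.-integrable setT (EFin \o (fun x : RM => Re (prodc f g x))).
Proof.
case/andP: (L2funP f) => f1 f2; case/andP: (L2funP g) => g1 g2.
under eq_fun do rewrite /= Re_prodc.
have := integrableD measurableT (integrable_prod f1 g1) (integrable_prod f2 g2).
exact.
Qed.

Let intIm f g : mu.-integrable setT (EFin \o (fun x : RM => Im (prodc f g x))).
Proof.
case/andP: (L2funP f) => f1 f2; case/andP: (L2funP g) => g1 g2.
under eq_fun do rewrite /= Im_prodc.
have := integrableB measurableT (integrable_prod f2 g1) (integrable_prod f1 g2).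
exact.
Qed.

Definition L2fun_dot f g : C := Cintegral setT (fun x => f x * (g x)^*%R).

Lemma L2fun_dotD f g h : L2fun_dot (f + g) h = L2fun_dot f h + L2fun_dot g h.
Proof.
apply/eqP; rewrite eq_complex /=; apply/andP; split; apply/eqP.
  rewrite -(RintegralD measurableT (intRe f h) (intRe g h)).
  by apply: eq_Rintegral => x _; rewrite /prodc mulrDl raddfD.
rewrite -(RintegralD measurableT (intIm f h) (intIm g h)).
by apply: eq_Rintegral => x _; rewrite /prodc mulrDl raddfD.
Qed.

Lemma L2fun_dotZ (a : C) f h : L2fun_dot (a *: f) h = a * L2fun_dot f h.
Proof.
have ReM (z w : C) : Re (z * w) = Re z * Re w - Im z * Im w.
  by case: z w => [? ?] [? ?].
have ImM (z w : C) : Im (z * w) = Re z * Im w + Im z * Re w.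
  by case: z w => [? ?] [? ?].
have intZ (k : R) (u : RM -> R) : mu.-integrable setT (EFin \o u) ->
    mu.-integrable setT (EFin \o (fun x => k * u x)).
  by move=> iu; exact: (integrableZl measurableT k iu).
apply/eqP; rewrite eq_complex ReM ImM; apply/andP; split; apply/eqP.
  rewrite /= -(RintegralZl _ measurableT (intRe f h)).
  rewrite -(RintegralZl _ measurableT (intIm f h)).
  rewrite -(RintegralB measurableT (intZ _ _ (intRe f h)) (intZ _ _ (intIm f h))).
  by apply: eq_Rintegral => x _; rewrite -ReM /prodc mulrA.
rewrite /= -(RintegralZl _ measurableT (intRe f h)).
rewrite -(RintegralZl _ measurableT (intIm f h)).
rewrite -(RintegralD measurableT (intZ _ _ (intIm f h)) (intZ _ _ (intRe f h))).
by apply: eq_Rintegral => x _; rewrite -ImM /prodc mulrA.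
Qed.

Lemma L2fun_dotC f g : L2fun_dot f g = (L2fun_dot g f)^*%R.
Proof.
apply/eqP; rewrite eq_complex; apply/andP; split; apply/eqP => /=.
  by apply: eq_Rintegral => x _; rewrite !Re_prodc; ring.
rewrite -mulN1r -(RintegralZl _ measurableT (intIm g f)).
by apply: eq_Rintegral => x _; rewrite !Im_prodc; ring.
Qed.

Lemma L2fun_dot_null f g : f \in @ae_null R -> L2fun_dot f g = 0.
Proof.
have FF := ae_filter.
have int0 (u : RM -> R) : mu.-integrable setT (EFin \o u) ->
    {ae mu, forall x, u x = 0} -> \int[mu]_x u x = 0.
  move=> iu u0; rewrite /Rintegral.
  rewrite (ae_eq_integral (cst 0%E)) ?integral0//.
    exact: measurable_int iu.
  by move: u0; apply: filterS => x /= ux0 _; rewrite ux0.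
move=> /ae_nullP f0; apply/eqP; rewrite eq_complex; apply/andP.
split; apply/eqP; apply: int0; [exact: intRe| |exact: intIm|].
  by move: f0; apply: filterS => x /= fx0; rewrite fx0 mul0r.
by move: f0; apply: filterS => x /= fx0; rewrite fx0 mul0r.
Qed.

Lemma L2fun_dot_gt0 f : f \notin @ae_null R -> 0 < L2fun_dot f f.
Proof.
have FF := ae_filter.
move=> fN0; have ge0 (x : RM) : 0 <= Re (prodc f f x).
  by rewrite Re_prodc -!expr2 addr_ge0// sqr_ge0.
have -> : L2fun_dot f f = (\int[mu]_x Re (prodc f f x))%:C.
  apply/eqP; rewrite eq_complex eqxx /=; apply/eqP.
  under eq_Rintegral do rewrite Im_prodc [X in X - _]mulrC subrr.
  by rewrite Rintegral_cst// mul0r.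
rewrite ltcR lt0r Rintegral_ge0// andbT; apply: contra fN0 => /eqP i0.
apply/ae_nullP; have /integrableP[mF _] := intRe f f.
have : (\int[mu]_x `|(Re (prodc f f x))%:E| = 0)%E.
  under eq_integral do rewrite gee0_abs ?lee_fin//.
  by rewrite -(fineK (integrable_fin_num measurableT (intRe f f))) [fine _]i0.
move=> /(ae_eq_integral_abs mu measurableT mF); apply: filterS => x /= /(_ I)[].
rewrite Re_prodc => /eqP; rewrite -!expr2 paddr_eq0 ?sqr_ge0// !sqrf_eq0.
by rewrite -[_ && _](eq_complex (f x) 0) => /eqP.
Qed.

Definition L2_dot (u v : L2 R) : C := L2fun_dot u v.

Lemma L2_dot_class f g : L2_dot (L2_class f) (L2_class g) = L2fun_dot f g.
Proof.
have nl f1 f2 h : f1 - f2 \in @ae_null R -> L2fun_dot f1 h = L2fun_dot f2 h.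
  by move=> n; rewrite -[f1](subrK f2) L2fun_dotD L2fun_dot_null// add0r.
rewrite /L2_dot (nl _ _ _ (L2_class_null f)) L2fun_dotC.
by rewrite (nl _ _ _ (L2_class_null g)) -L2fun_dotC.
Qed.

Lemma L2_dotC u v : L2_dot u v = (-1) ^+ false * (L2_dot v u)^*%R.
Proof. by rewrite mul1r; exact: L2fun_dotC. Qed.

Fact L2_dotl v : linear_for *%R (L2_dot^~ v).
Proof.
move=> a u1 u2; rewrite -[u1]L2_to_funK -[u2]L2_to_funK -[v]L2_to_funK.
by rewrite -L2_classZ -L2_classD !L2_dot_class L2fun_dotD L2fun_dotZ.
Qed.

Fact L2_dotr u : linear_for (Num.conj \; *%R) (L2_dot u).
Proof.
move=> a v1 v2; rewrite L2_dotC mul1r L2_dotl rmorphD rmorphM /=.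
by rewrite -[X in _ * X]mul1r -L2_dotC -[X in _ + X]mul1r -L2_dotC.
Qed.

HB.instance Definition _ := bilinear_isBilinear.Build C (L2 R) (L2 R) C
  *%R (Num.conj \; *%R) L2_dot (L2_dotl, L2_dotr).
HB.instance Definition _ :=
  isHermitianSesquilinear.Build C (L2 R) false Num.conj L2_dot L2_dotC.

Fact L2_dot_gt0 u : u != 0 -> 0 < L2_dot u u.
Proof.
move=> uN0; apply: L2fun_dot_gt0; apply: contra uN0 => u0.
by rewrite -[u]L2_to_funK -L2_class0; apply/eqP/L2_classP; rewrite subr0.
Qed.

HB.instance Definition _ := isDotProduct.Build C (L2 R) L2_dot L2_dot_gt0.

End L2dot.

Section L2odd.
Variable R : realType.
Local Notation C := R[i].

(* Classes containing an odd function. *)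
Definition odd_class : {pred L2 R} := [pred u : L2 R |
  `[< exists2 f : L2fun R, (forall x, f (- x) = - f x) & u = L2_class f >]].

Fact odd_class_submod_closed : submod_closed odd_class.
Proof.
split.
  apply/asboolP; exists 0; last by rewrite L2_class0.
  by move=> x; rewrite /= oppr0.
move=> a _ _ /asboolP[f oddf ->] /asboolP[g oddg ->].
apply/asboolP; exists (a *: f + g); last by rewrite L2_classD L2_classZ.
by move=> x; rewrite /= !fctE /= oddf oddg scalerN opprD.
Qed.

HB.instance Definition _ := GRing.isSubmodClosed.Build _ _ odd_class
  odd_class_submod_closed.

Record L2odd :=
  MkL2odd { L2odd_val :> L2 R; L2oddP : L2odd_val \in odd_class }.

HB.instance Definition _ := [isSub for L2odd_val].
HB.instance Definition _ := [Choice of L2odd by <:].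
HB.instance Definition _ := [SubChoice_isSubLmodule of L2odd by <:].

Definition L2odd_dot (u v : L2odd) : C := L2_dot u v.

Fact L2odd_dotl v : linear_for *%R (L2odd_dot^~ v).
Proof. by move=> a u1 u2; exact: L2_dotl. Qed.

Fact L2odd_dotr u : linear_for (Num.conj \; *%R) (L2odd_dot u).
Proof. by move=> a v1 v2; exact: L2_dotr. Qed.

Fact L2odd_dotC u v : L2odd_dot u v = (-1) ^+ false * (L2odd_dot v u)^*%R.
Proof. exact: L2_dotC. Qed.

Fact L2odd_dot_gt0 u : u != 0 -> 0 < L2odd_dot u u.
Proof. by move=> u0; apply: L2_dot_gt0; rewrite (inj_eq val_inj u 0). Qed.

HB.instance Definition _ := bilinear_isBilinear.Build C L2odd L2odd C
  *%R (Num.conj \; *%R) L2odd_dot (L2odd_dotl, L2odd_dotr).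
HB.instance Definition _ :=
  isHermitianSesquilinear.Build C L2odd false Num.conj L2odd_dot L2odd_dotC.
HB.instance Definition _ := isDotProduct.Build C L2odd L2odd_dot L2odd_dot_gt0.

End L2odd.

Section Models.
Variable R : realType.
Local Notation C := R[i].
Local Notation mu :=
  (@lebesgue_measure R : {measure set (measurableTypeR R) -> \bar R}).

Definition expi (t : R) : C := cos t +i* sin t.

Definition metaplectic_T (f g : L2 R) : Prop :=
  {ae mu, forall x : R, g x = expi (- (pi * x ^+ 2)) * f x}.

(* g (x) = \int sin (2 pi x y) f (y) dy, as usual on L^2: the integral need not
   converge, and g is the L^2-limit of the integrals over [-n, n]. *)
Definition metaplectic_S_odd (f g : L2 R) : Prop :=
  (fun n : nat => \int[mu]_x
     (Normc.normc (g x - Cintegral `[- n%:R, n%:R]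
        (fun y => (sin (2 * pi * x * y))%:C * f y)) ^+ 2)%:E)%E @ \oo --> 0%E.

(* [mu'], with the operators given for S and T multiplied by the phases [a] and
   [b]. *)
Definition metaplectic_odd_rep (a b : C)
    (rho : SL2Z -> {linear L2odd R -> L2odd R}) : Prop :=
  [/\ `|a| = 1 /\ `|b| = 1,
      unitary_rep (@L2odd_dot R) rho,
      forall f : L2odd R, exists2 g : L2odd R,
        metaplectic_S_odd f g & rho SL2Z_S f = a *: g &
      forall f : L2odd R, exists2 g : L2odd R,
        metaplectic_T f g & rho SL2Z_T f = b *: g].

(* [rho_k] on C^(k+1), where r = k + 2, with the operators given for S and T
   multiplied by the phases [a] and [b]. *)
Definition quantum_SU2_rep (k : nat) (a b : C)
    (rho : SL2Z -> {linear 'rV[C]_k.+1 -> 'rV[C]_k.+1}) : Prop :=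
  let r : R := k.+2%:R in
  let e (l : 'I_k.+1) : 'rV[C]_k.+1 := delta_mx 0 l in
  [/\ `|a| = 1 /\ `|b| = 1,
      unitary_rep (@dotmx C k.+1) rho,
      forall l : 'I_k.+1, rho SL2Z_S (e l) = a *: \sum_(m < k.+1)
        (Num.sqrt (2 / r) * sin (pi * l.+1%:R * m.+1%:R / r))%:C *: e m &
      forall l : 'I_k.+1, rho SL2Z_T (e l) =
        b *: (expi (- (pi * l%:R * l.+2%:R / (2 * r))) *: e l)].

End Models.

(* Main.v *)
(** Write r = k + 2 and h = (2 r)^(-1/2).  The operators A_k, B_k given for S
    and T satisfy A_k^2 = 1, and (A_k B_k)^3 is a scalar by a Gauss sum
    computation; multiplying B_k by a cube root of the inverse scalar gives a
    representation of PSL(2, Z).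

    Sending e_l to the normalised odd indicator function of
    h (l + 1) <= |x| < h (l + 2) embeds C^(k+1) isometrically into
    L^2_odd(R).  The entries of A_k and B_k are then samples of
    2 h sin (2 pi x y) and, up to a phase tending to 1, of exp (- pi i x^2) at
    the points h (l + 1).  For the odd steps phi_b = sg 1_{|x| < b}, whose span is
    dense, the images under A_k and B_k of the sampled phi_b converge in L^2
    by dominated convergence.  As all operators are isometric, A_k and B_k
    converge strongly, along every sequence of vectors with a limit in
    L^2_odd(R), to isometries A and B, which inherit A^2 = 1 and (A B)^3 = c
    where c is the limit of the scalars (A_k B_k)^3.  Taking for the phase of
    B_k the cube root nearest to a fixed cube root of 1 / c makes the phases
    converge, and then every word in S and T converges strongly; this gives
    the convergence of coefficients.  Finally A and B are the sine transform
    and the multiplication by exp (- pi i x^2), because they are so on the odd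
    steps. *)

Require Import Defs.
From HB Require Import structures.
From mathcomp Require Import all_boot all_order all_algebra.
From mathcomp Require Import complex.
From mathcomp Require Import all_classical all_reals all_analysis.
From mathcomp Require Import measurable_realfun zify ring lra.

Set Implicit Arguments.
Unset Strict Implicit.
Unset Printing Implicit Defensive.

Import Order.TTheory GRing.Theory Num.Theory numFieldNormedType.Exports.

Local Open Scope classical_set_scope.
Local Open Scope complex_scope.
Local Open Scope ring_scope.

(** The weight 2 h, where a Riemann sum of mesh h would show h, comes from folding the integral of
    an even integrand onto y > 0; h^2 = 1 / (2 r) is the scale at which pi l m / r is 2 pi times a
    product of two nodes. The nodes become dense and still exhaust the half-line, since h (k + 1) is
    of order 1 / h. The limits A and B are constructed before they are identified, so isometry and
    relations come from finite dimension. The Gauss sum stays symbolic: isometry puts the scalar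
    (A_k B_k)^3 on the unit circle, and convergence of the words makes it converge. The sine
    transform of a general f is only an L^2 limit of truncated integrals. For fixed x the truncated
    kernel is itself a vector of L^2_odd(R), so the truncated transform is an inner product,
    continuous in f, and can be compared with A on odd steps. A representation must be a function of
    the matrix. Euclid's algorithm picks one word per matrix, and the relations s^2 = 1 and (s t)^3
    = 1 make this choice compatible with left multiplication by S and T. *)

Local Notation normc := Normc.normc.
Local Notation Re := complex.Re.
Local Notation Im := complex.Im.

(** * SL(2, Z) acts through words in S and T *)

Section ModularWord.
Implicit Types (a b c d : int).

(* Division with a remainder of the same sign as c, unlike [divz]. *)
Definition fdiv a c : int := if 0 <= c then (a %/ c)%Z else ((- a) %/ (- c))%Z.

Lemma fdivE a c q : c != 0 ->
  (0 <= a - q * c < c) || (c < a - q * c <= 0) -> fdiv a c = q.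
Proof.
move=> c0; rewrite /fdiv; have [c_ge0|c_lt0] := leP 0 c => h.
  have {}h : 0 <= a - q * c < c by lia.
  have := divz_eq a c; have := modz_ge0 a c0.
  have := ltz_pmod a (_ : 0 < c); nia.
have {}h : c < a - q * c <= 0 by lia.
have c0' : - c != 0 by lia.
have := divz_eq (- a) (- c); have := modz_ge0 (- a) c0'.
have := ltz_pmod (- a) (_ : 0 < - c); nia.
Qed.

Lemma fdivP a c : c != 0 ->
  (0 <= a - fdiv a c * c < c) || (c < a - fdiv a c * c <= 0).
Proof.
move=> c0; rewrite /fdiv; have [c_ge0|c_lt0] := leP 0 c.
  have := divz_eq a c; have := modz_ge0 a c0.
  have := ltz_pmod a (_ : 0 < c); lia.
have c0' : - c != 0 by lia.
have := divz_eq (- a) (- c); have := modz_ge0 (- a) c0'.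
have := ltz_pmod (- a) (_ : 0 < - c); lia.
Qed.

(** With x = a / c the two quotients are the floors of x and of -1/x. One of these numbers is
    positive; if its floor is not 0 it is at least 1, and then the other lies in [-1, 0). *)
Lemma fdiv_trichotomy a c : a != 0 -> c != 0 ->
  fdiv a c != 0 -> fdiv c (- a) != 0 -> fdiv a c = -1 \/ fdiv c (- a) = -1.
Proof.
move=> a0 c0 q1 q2; have a0' : - a != 0 by rewrite oppr_eq0.
have {}q1 : ~~ (0 <= a < c) /\ ~~ (c < a <= 0).
  by split; apply: contra q1 => h; apply/eqP/fdivE => //; rewrite mul0r subr0 h ?orbT.
have {}q2 : ~~ (0 <= c < - a) /\ ~~ (- a < c <= 0).
  by split; apply: contra q2 => h; apply/eqP/fdivE => //; rewrite mul0r subr0 h ?orbT.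
have [h|h] : (0 <= a + c < c) || (c < a + c <= 0) \/
    (0 <= c - a < - a) || (- a < c - a <= 0) by lia.
  by left; apply: fdivE => //; rewrite mulN1r opprK.
by right; apply: fdivE => //; rewrite mulN1r opprK.
Qed.

(* The letters [true] and [false] stand for S and T; the inverse of T is
   STSTS. *)
Definition Tpow (z : int) : seq bool :=
  match z with
  | Posz n => nseq n false
  | Negz n => flatten (nseq n.+1 [:: true; false; true; false; true])
  end.

(* Euclid's algorithm on the first column (a, c): up to sign the matrix is
   T^q S g' with q = a / c, and c = 0 forces it to be T^(a b). *)
Fixpoint euclid_word n a b c d : seq bool :=
  if n is n'.+1 then
    if c == 0 then Tpow (a * b)
    else let q := fdiv a c in
         Tpow q ++ true :: euclid_word n' c d (q * c - a) (q * d - b)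
  else [::].

Definition SL2Z_word (g : SL2Z) : seq bool :=
  let m := SL2Z_mx g in
  euclid_word (absz (m 1 0)).+1 (m 0 0) (m 0 1) (m 1 0) (m 1 1).

Lemma euclid_word_fuel n m a b c d : (absz c < n)%N -> (absz c < m)%N ->
  euclid_word n a b c d = euclid_word m a b c d.
Proof.
elim: n m a b c d => [|n IH] [|m] a b c d //= cn cm.
case: eqP => [//|/eqP c0]; congr (_ ++ _ :: _).
by have h := fdivP a c0; apply: IH; lia.
Qed.

Section Eval.
Variables (X : Type) (s t : X -> X).

Definition eval_word (w : seq bool) (x : X) : X :=
  foldr (fun l y => if l then s y else t y) x w.

Lemma eval_word_cat w1 w2 x :
  eval_word (w1 ++ w2) x = eval_word w1 (eval_word w2 x).
Proof. by rewrite /eval_word foldr_cat. Qed.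

Hypothesis ss : forall x, s (s x) = x.
Hypothesis stK : forall x, s (t (s (t (s (t x))))) = x.

Let tsK x : t (s (t (s (t (s x))))) = x.
Proof. by apply: (can_inj ss); exact: stK. Qed.

Let ti x := s (t (s (t (s x)))).
Let tiK x : ti (t x) = x. Proof. exact: stK. Qed.
Let tti x : t (ti x) = x. Proof. exact: tsK. Qed.

Lemma eval_TpowS z x : eval_word (Tpow (z + 1)) x = t (eval_word (Tpow z) x).
Proof.
case: z => n; first by rewrite -PoszD addn1.
have -> : Negz n + 1 = - n%:Z by lia.
have -> : eval_word (Tpow (Negz n)) x = ti (eval_word
  (flatten (nseq n [:: true; false; true; false; true])) x) by [].
by rewrite tti; case: n => [//|n]; rewrite -NegzE.
Qed.

Let R a b c d := eval_word (euclid_word (absz c).+1 a b c d).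

Let R0 a b d x : R a b 0 d x = eval_word (Tpow (a * b)) x.
Proof. by []. Qed.

Let R1 a b c d x : c != 0 -> let q := fdiv a c in
  R a b c d x = eval_word (Tpow q) (s (R c d (q * c - a) (q * d - b) x)).
Proof.
move=> c0 q; rewrite /R; have e n a' b' c' d' : (absz c' < n)%N ->
    euclid_word (absz c').+1 a' b' c' d' = euclid_word n a' b' c' d'.
  by move=> h; apply: euclid_word_fuel.
have h : (absz (q * c - a)%R < absz c)%N by have := fdivP a c0; lia.
by rewrite (e (absz c) c d) //= (negbTE c0) eval_word_cat.
Qed.

(** All quotients are unchanged when the matrix changes sign, so what is built here is an action of
    PSL(2, Z). *)
Let RN a b c d x : R (- a) (- b) (- c) (- d) x = R a b c d x.
Proof.
move cn : (absz c) => n; elim/ltn_ind: n c cn a b d => n IH c cn a b d.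
have [->|c0] := eqVneq c 0; first by rewrite oppr0 !R0 mulrNN.
have c0' : - c != 0 by lia.
have q_eq : fdiv (- a) (- c) = fdiv a c.
  by apply: fdivE => //; have := fdivP a c0; lia.
rewrite (R1 _ _ _ _ c0) (R1 _ _ _ _ c0') q_eq; congr (eval_word _ (s _)).
have -> : fdiv a c * - c - - a = - (fdiv a c * c - a) by lia.
have -> : fdiv a c * - d - - b = - (fdiv a c * d - b) by lia.
by have h := fdivP a c0; apply: (IH (absz (fdiv a c * c - a)%R) _ _ erefl); lia.
Qed.

(** Adding c to a raises the first quotient by one and leaves every remainder alone; for c = 0 the
    exponent a b grows by a d = 1. *)
Let RT a b c d x : a * d - b * c = 1 -> R (a + c) (b + d) c d x = t (R a b c d x).
Proof.
move=> det; have [c0|c0] := eqVneq c 0.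
  subst c; rewrite addr0 !R0 -eval_TpowS; congr (eval_word (Tpow _) _); lia.
have q_eq : fdiv (a + c) c = fdiv a c + 1.
  by apply: fdivE => //; have := fdivP a c0; lia.
rewrite [LHS]R1 // [R a b c d x]R1 // q_eq eval_TpowS.
have -> : (fdiv a c + 1) * c - (a + c) = fdiv a c * c - a by lia.
by have -> : (fdiv a c + 1) * d - (b + d) = fdiv a c * d - b by lia.
Qed.

Let RS0 a b c d x : c != 0 -> fdiv a c = 0 ->
  R a b c d x = s (R c d (- a) (- b) x).
Proof. by move=> c0 q0; rewrite R1 // q0 !mul0r !sub0r. Qed.

(** If the first quotient of (a, c) or of (c, -a) is 0, the two runs of Euclid's algorithm differ by
    one letter S and [ss] concludes. Otherwise [fdiv_trichotomy] makes one of these quotients -1. *)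
Let RS a b c d x : a * d - b * c = 1 -> R c d (- a) (- b) x = s (R a b c d x).
Proof.
move an : (absz a + absz c)%N => n.
elim/ltn_ind: n a c an b d => n IH a c an b d det.
have [/andP[c0 /eqP q0]|nq1] := boolP ((c != 0) && (fdiv a c == 0)).
  by rewrite (RS0 _ _ _ c0 q0) ss.
have [/andP[a0 /eqP q0]|nq2] := boolP ((a != 0) && (fdiv c (- a) == 0)).
  by rewrite RS0 ?RN // oppr_eq0.
have a0 : a != 0.
  apply: contra nq1 => /eqP a0; have c0 : c != 0 by nia.
  by rewrite c0 /=; apply/eqP/fdivE; lia.
have c0 : c != 0.
  apply: contra nq2 => /eqP c0; rewrite a0 /=; apply/eqP/fdivE; lia.
rewrite c0 /= in nq1; rewrite a0 /= in nq2.
(* Applying T brings the quotient -1 to 0. The relation T S T = S T^-1 S then reduces the claim to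
   the column (-a', -(a' + c')), which is smaller because a' + c' is the remainder of a' modulo
   c'. *)
have core a' b' c' d' : (absz a' + absz c')%N = n -> a' * d' - b' * c' = 1 ->
    a' != 0 -> c' != 0 -> fdiv a' c' = -1 -> 
    R c' d' (- a') (- b') x = s (R a' b' c' d' x).
  move=> an' det' a0' c0' q'; have qP := fdivP a' c0'.
  have eT : t (R a' b' c' d' x) = s (R c' d' (- (a' + c')) (- (b' + d')) x).
    by rewrite -RT // RS0 //; apply: fdivE => //; lia.
  rewrite -[R a' b' c' d' x]tiK eT -RN opprK opprK.
  have -> : - c' = - (a' + c') + a' by lia.
  have -> : - d' = - (b' + d') + b' by lia.
  rewrite RT; last lia.
  have := IH (absz (- a')%R + absz (- (a' + c'))%R)%N _ (- a') (- (a' + c')) erefl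
    (- b') (- (b' + d')).
  rewrite !opprK => -> //; [|lia|lia].
  have -> : - a' = c' + - (a' + c') by lia.
  have -> : - b' = d' + - (b' + d') by lia.
  by rewrite RT /ti ?ss //; lia.
have [q1|q1] := fdiv_trichotomy a0 c0 nq1 nq2.
- exact: core.
by rewrite -[LHS]ss -(core c d (- a) (- b)) ?RN ?oppr_eq0 //; lia.
Qed.

Definition eval_euclidT := RT.
Definition eval_euclidS := RS.
End Eval.
End ModularWord.

Lemma SL2Z_mulE (g h : SL2Z) i j :
  SL2Z_mx (g * h)%g i j =
  SL2Z_mx g i 0 * SL2Z_mx h 0 j + SL2Z_mx g i 1 * SL2Z_mx h 1 j.
Proof.
have -> : SL2Z_mx (g * h)%g = SL2Z_mx g *m SL2Z_mx h by [].
rewrite mxE big_ord_recl big_ord_recl big_ord0 addr0.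
by have -> : lift ord0 ord0 = 1 :> 'I_2 by apply: val_inj.
Qed.

Lemma SL2Z_mulS (g : SL2Z) (m := SL2Z_mx g) (m' := SL2Z_mx (SL2Z_S * g)%g) :
  [/\ m' 0 0 = m 1 0, m' 0 1 = m 1 1, m' 1 0 = - m 0 0 & m' 1 1 = - m 0 1].
Proof.
by rewrite /m' !SL2Z_mulE !mxE /= !mul0r !mul1r !mulN1r !add0r !addr0.
Qed.

Lemma SL2Z_mulT (g : SL2Z) (m := SL2Z_mx g) (m' := SL2Z_mx (SL2Z_T * g)%g) :
  [/\ m' 0 0 = m 0 0 + m 1 0, m' 0 1 = m 0 1 + m 1 1, m' 1 0 = m 1 0 &
      m' 1 1 = m 1 1].
Proof. by rewrite /m' !SL2Z_mulE !mxE /= !mul0r !mul1r !add0r. Qed.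

Lemma SL2Z_eqP (g h : SL2Z) (m := SL2Z_mx g) (n := SL2Z_mx h) :
  m 0 0 = n 0 0 -> m 0 1 = n 0 1 -> m 1 0 = n 1 0 -> m 1 1 = n 1 1 -> g = h.
Proof.
move=> e00 e01 e10 e11; apply: val_inj; apply/matrixP => i j /=.
have ord2 (k : 'I_2) : k = 0 \/ k = 1.
  by case: k => -[|[|//]] lt_k2; [left|right]; apply: val_inj.
by case: (ord2 i) => ->; case: (ord2 j) => ->.
Qed.

Lemma SL2Z_S4 : (SL2Z_S * (SL2Z_S * (SL2Z_S * SL2Z_S)) = 1)%g.
Proof. by apply: SL2Z_eqP; rewrite !SL2Z_mulE !mxE. Qed.

Lemma SL2Z_ST3 :
  (SL2Z_S * (SL2Z_T * (SL2Z_S * (SL2Z_T * (SL2Z_S * SL2Z_T)))) = 1)%g.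
Proof. by apply: SL2Z_eqP; rewrite !SL2Z_mulE !mxE. Qed.

Lemma SL2Z_detE (g : SL2Z) : g 0 0 * g 1 1 - g 0 1 * g 1 0 = 1.
Proof.
have := mul_mx_adj g; rewrite (eqP (SL2Z_det g)) => /matrixP /(_ 0 0).
rewrite !mxE !big_ord_recl big_ord0 !mxE /cofactor !det_mx11 !mxE /=.
have -> : lift 0 0 = 1 :> 'I_2 by apply: val_inj.
have -> : lift 1 0 = 0 :> 'I_2 by apply: val_inj.
by rewrite expr0 expr1 mul1r mulN1r mulrN addr0.
Qed.

(** S and T generate as a monoid, because [SL2Z_S4] and [SL2Z_ST3] write their inverses as positive
    words; this is [PSi] and [PTi]. The descent is on |a| + |c| for the first column (a, c), and on
    |b| once c = 0, where the matrix is a power of T up to sign. *)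
Lemma SL2Z_ST_ind (P : SL2Z -> Prop) :
  P 1%g -> (forall g, P g -> P (SL2Z_S * g)%g) ->
  (forall g, P g -> P (SL2Z_T * g)%g) -> forall g, P g.
Proof.
move=> P1 PS PT.
have PSi (g : SL2Z) : P (SL2Z_S * g)%g -> P g.
  move=> /PS /PS /PS; apply: contraPP.
  by rewrite -[in X in X -> _](mul1g g) -SL2Z_S4 -!mulgA.
have PTi (g : SL2Z) : P (SL2Z_T * g)%g -> P g.
  move=> /PS /PT /PS /PT /PS; apply: contraPP.
  by rewrite -[in X in X -> _](mul1g g) -SL2Z_ST3 -!mulgA.
have P0 (g : SL2Z) : g 1 0 = 0 -> P g.
  move bn : (absz (g 0 1)%R) => n.
  elim: n g bn => [|n IH] g bn c0; have det := SL2Z_detE g;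
    rewrite c0 mulr0 subr0 in det;
    have a_d : g 0 0 = 1 /\ g 1 1 = 1 \/ g 0 0 = -1 /\ g 1 1 = -1
      by have /eqP := congr1 absz det; rewrite abszM muln_eq1; lia.
    have [[a1 d1]|[a1 d1]] := a_d.
    - have <- : 1%g = g by apply: SL2Z_eqP; rewrite !mxE /=; lia.
      exact: P1.
    - have <- : (SL2Z_S * SL2Z_S)%g = g.
      by apply: SL2Z_eqP; rewrite !SL2Z_mulE !mxE /=; lia.
      by rewrite -[X in P X]mulg1 -mulgA; apply/PS/PS.
  have [b_d|b_d] : (g 0 1 < 0) != (g 1 1 < 0) \/ (g 0 1 < 0) = (g 1 1 < 0) by lia.
    by apply/PTi/IH; have [_ e1 e2 _] := SL2Z_mulT g; lia.
  have [h gE] : exists h, g = (SL2Z_T * h)%g.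
    by exists ((SL2Z_T^-1)%g * g)%g; rewrite mulVKg.
  by rewrite gE; apply/PT/IH; have [] := SL2Z_mulT h; rewrite -gE => e1 e2 e3 e4; lia.
move=> g; move acn : (absz (g 0 0)%R + absz (g 1 0)%R)%N => n.
elim/ltn_ind: n g acn => n IH g acn.
have [/P0//|c0] := eqVneq (g 1 0) 0.
have [a0|a0] := eqVneq (g 0 0) 0.
  by apply/PSi/P0; have [_ _ e _] := SL2Z_mulS g; rewrite e a0 oppr0.
have opp (f : SL2Z) : (absz (f 0 0)%R + absz (f 1 0)%R)%N = n -> (0 < absz (f 1 0)%R)%N ->
    (absz (f 1 0)%R <= absz (f 0 0)%R)%N -> P f.
  move=> fn f10 f_le; have [neg|pos] := leP (f 0 0 * f 1 0) 0.
    by apply/PTi/(IH _ _ _ erefl); have [e1 _ e2 _] := SL2Z_mulT f; nia.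
  have [h fE] : exists h, f = (SL2Z_T * h)%g.
    by exists ((SL2Z_T^-1)%g * f)%g; rewrite mulVKg.
  rewrite fE; apply/PT/(IH _ _ _ erefl).
  by have [] := SL2Z_mulT h; rewrite -fE => e1 e2 e3 e4; nia.
have [le_ca|lt_ac] := leqP (absz (g 1 0)%R) (absz (g 0 0)%R); first by apply: opp; lia.
by apply/PSi/opp; have [e1 _ e2 _] := SL2Z_mulS g; lia.
Qed.

(** * The action of SL(2, Z) defined by two operators with the modular relations *)

Section Representation.
Variables (X : Type) (s t : X -> X).
Hypothesis ss : forall x, s (s x) = x.
Hypothesis stK : forall x, s (t (s (t (s (t x))))) = x.

(** Defined on the matrix itself through its Euclidean word. The equations for S and T on the left,
    together with generation by S and T, then give multiplicativity. *)
Definition SL2Z_act (g : SL2Z) : X -> X := eval_word s t (SL2Z_word g).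

Lemma SL2Z_act1 x : SL2Z_act 1%g x = x.
Proof. by rewrite /SL2Z_act /SL2Z_word !mxE. Qed.

Lemma SL2Z_actS g x : SL2Z_act (SL2Z_S * g)%g x = s (SL2Z_act g x).
Proof.
rewrite /SL2Z_act /SL2Z_word; have [-> -> -> ->] := SL2Z_mulS g.
by rewrite abszN -abszN; apply: eval_euclidS => //; exact: SL2Z_detE.
Qed.

Lemma SL2Z_actT g x : SL2Z_act (SL2Z_T * g)%g x = t (SL2Z_act g x).
Proof.
rewrite /SL2Z_act /SL2Z_word; have [-> -> -> ->] := SL2Z_mulT g.
by apply: eval_euclidT => //; exact: SL2Z_detE.
Qed.

Lemma SL2Z_actM g h x : SL2Z_act (g * h)%g x = SL2Z_act g (SL2Z_act h x).
Proof.
elim/SL2Z_ST_ind: g => [|g IH|g IH]; first by rewrite mul1g SL2Z_act1.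
  by rewrite -mulgA !SL2Z_actS IH.
by rewrite -mulgA !SL2Z_actT IH.
Qed.

Lemma SL2Z_act_S x : SL2Z_act SL2Z_S x = s x.
Proof. by rewrite -[SL2Z_S]mulg1 SL2Z_actS SL2Z_act1. Qed.

Lemma SL2Z_act_T x : SL2Z_act SL2Z_T x = t x.
Proof. by rewrite -[SL2Z_T]mulg1 SL2Z_actT SL2Z_act1. Qed.

End Representation.

(** * Null sequences and inner products *)

Section InnerProduct.
Variable R : realType.
Local Notation C := R[i].
Variables (H : lmodType C) (dot : {dot H for Num.conj}).
Implicit Types (u v w : H) (a : C).

Lemma normrcE (z : C) : `|z| = (normc z)%:C. Proof. by []. Qed.

Lemma normc_ge0 (z : C) : 0 <= normc z.
Proof. by rewrite -lecR -normrcE normr_ge0. Qed.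

Lemma normcD (z w : C) : normc (z + w) <= normc z + normc w.
Proof. by rewrite -lecR raddfD /= -!normrcE ler_normD. Qed.

Lemma normcBC (z w : C) : normc (z - w) = normc (w - z).
Proof. by apply: (@complexI R); rewrite -!normrcE distrC. Qed.

Lemma Re_le_normc (z : C) : complex.Re z <= normc z.
Proof.
case: z => x y /=; apply: le_trans (ler_norm x) _.
by rewrite -sqrtr_sqr ler_sqrt ?addr_ge0 ?sqr_ge0// lerDl sqr_ge0.
Qed.

Definition hnorm u : R := Num.sqrt (complex.Re (dot u u)).

Lemma hnorm_ge0 u : 0 <= hnorm u. Proof. exact: sqrtr_ge0. Qed.

Lemma Re_dot_ge0 u : 0 <= complex.Re (dot u u).
Proof. by have := dnorm_ge0 dot u; rewrite lecE => /andP[]. Qed.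

Lemma sqr_hnorm u : hnorm u ^+ 2 = complex.Re (dot u u).
Proof. by rewrite sqr_sqrtr // Re_dot_ge0. Qed.

Lemma dot_hnorm u : dot u u = (hnorm u ^+ 2)%:C.
Proof.
rewrite sqr_hnorm; have := dnorm_ge0 dot u.
rewrite lecE => /andP[/eqP /= e _].
by move: e; case: (dot u u) => x y /= ->.
Qed.

Lemma hnorm_eq0 u : (hnorm u == 0) = (u == 0).
Proof.
rewrite -(dnorm_eq0 dot) dot_hnorm -(inj_eq (@complexI R)) -[(0:R)%:C]/(0:C).
by rewrite rmorphXn /= expf_eq0.
Qed.

Lemma hnorm0 : hnorm 0 = 0. Proof. by apply/eqP; rewrite hnorm_eq0. Qed.

Lemma hnormZ a u : hnorm (a *: u) = normc a * hnorm u.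
Proof.
apply/eqP; rewrite -(@eqrXn2 _ 2) ?mulr_ge0 ?hnorm_ge0 ?normc_ge0//.
rewrite -(inj_eq (@complexI R)) -dot_hnorm dnormZ dot_hnorm normrcE.
by rewrite -rmorphXn -rmorphM /= exprMn.
Qed.

Lemma hnorm_opp u : hnorm (- u) = hnorm u.
Proof. by rewrite /hnorm linearNl linearNr opprK. Qed.

Lemma hnormBC u v : hnorm (u - v) = hnorm (v - u).
Proof. by rewrite -hnorm_opp opprB. Qed.

Lemma cauchy_schwarz u v : normc (dot u v) <= hnorm u * hnorm v.
Proof.
have [->|v0] := eqVneq v 0; first by rewrite linear0 Normc.normc0 hnorm0 mulr0.
pose a := dot u v / dot v v; pose u1 := u - a *: v.
have ou : dot u1 v = 0.
  by rewrite linearBl/= linearZl_LR/= divfK ?dnorm_eq0 ?subrr.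
have uE : u = u1 + a *: v by rewrite subrK.
have nE : dot u u = dot u1 u1 + dot (a *: v) (a *: v).
  by rewrite uE hnormDd// linearZr_LR/= ou mulr0.
have vE : dot u v = a * dot v v by rewrite /a divfK ?dnorm_eq0.
rewrite -(@ler_pXn2r _ 2) ?nnegrE ?mulr_ge0 ?hnorm_ge0 ?normc_ge0// -lecR.
have -> : ((hnorm u * hnorm v) ^+ 2)%:C = dot u u * dot v v.
  by rewrite !dot_hnorm -rmorphM exprMn.
have -> : (normc (dot u v) ^+ 2)%:C = `|dot u v| ^+ 2.
  by rewrite normrcE -rmorphXn.
rewrite vE normrM exprMn.
rewrite [X in _ <= X * _]nE dnormZ mulrDl.
rewrite [X in _ * X ^+ 2]ger0_norm ?dnorm_ge0// expr2 mulrA.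
by rewrite lerDr mulr_ge0 ?dnorm_ge0.
Qed.

Lemma hnorm_leD u v : hnorm (u + v) <= hnorm u + hnorm v.
Proof.
rewrite -(@ler_pXn2r _ 2) ?nnegrE ?addr_ge0 ?hnorm_ge0//.
rewrite [X in X <= _]sqr_hnorm dnormD.
have -> : complex.Re (dot u u + dot v v + (dot u v + (dot u v)^*%R)) =
    hnorm u ^+ 2 + hnorm v ^+ 2 + complex.Re (dot u v) *+ 2.
  by rewrite !dot_hnorm; case: (dot u v) => a b /=; ring.
have := le_trans (Re_le_normc (dot u v)) (cauchy_schwarz u v).
by lra.
Qed.

Lemma hnorm_triangle w u v : hnorm (u - v) <= hnorm (u - w) + hnorm (w - v).
Proof. by rewrite -[u - v](subrKA w) hnorm_leD. Qed.

Lemma hnorm_dist u v : `|hnorm u - hnorm v| <= hnorm (u - v).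
Proof.
rewrite ler_norml; have := hnorm_leD (u - v) v; rewrite subrK.
by have := hnorm_leD (v - u) u; rewrite subrK hnormBC; lra.
Qed.

End InnerProduct.

Section NullSequences.
Variable R : realType.
Implicit Types x y : nat -> R.

Lemma nearS (P Q : nat -> Prop) : (forall k, P k -> Q k) ->
  (\forall k \near \oo, P k) -> \forall k \near \oo, Q k.
Proof.
by move=> PQ Pk; near=> k; apply: PQ; near: k.
Unshelve. all: by end_near. Qed.

Lemma nearS2 (P Q S : nat -> Prop) : (forall k, P k -> Q k -> S k) ->
  (\forall k \near \oo, P k) -> (\forall k \near \oo, Q k) ->
  \forall k \near \oo, S k.
Proof.
by move=> PQ Pk Qk; near=> k; apply: PQ; near: k.
Unshelve. all: by end_near. Qed.

Lemma nearI (P Q : nat -> Prop) : (\forall k \near \oo, P k) ->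
  (\forall k \near \oo, Q k) -> \forall k \near \oo, P k /\ Q k.
Proof. by apply: nearS2. Qed.

Lemma le_cvg0 x y : (forall k, 0 <= x k <= y k) -> y @ \oo --> (0 : R) ->
  x @ \oo --> (0 : R).
Proof.
move=> xy y0; have c0 : (fun _ : nat => 0 : R) @ \oo --> (0 : R) by exact: cvg_cst.
by apply: (squeeze_cvgr _ c0 y0); near=> k; exact: xy.
Unshelve. all: by end_near. Qed.

Lemma cvg0_lt x (e : R) : x @ \oo --> (0 : R) -> 0 < e ->
  \forall k \near \oo, x k < e.
Proof.
move=> x0 e0; have xe : \forall k \near \oo, `|x k| < e by move/cvgr0Pnorm_lt: x0; exact.
by apply: (nearS _ xe) => k; apply: le_lt_trans; exact: ler_norm.
Qed.

Lemma cvg0P x : (forall k, 0 <= x k) ->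
  (forall e : R, 0 < e -> \forall k \near \oo, x k < e) -> x @ \oo --> (0 : R).
Proof.
move=> x0 h; apply/cvgr0Pnorm_lt => e /h xe; apply: (nearS _ xe) => k.
by rewrite ger0_norm.
Qed.

Lemma cvg0D x y : x @ \oo --> (0 : R) -> y @ \oo --> (0 : R) ->
  (fun k => x k + y k) @ \oo --> (0 : R).
Proof. by move=> x0 y0; rewrite -[X in _ --> X]addr0; exact: cvgD. Qed.

Lemma cvg0Z (c : R) x : x @ \oo --> (0 : R) -> (fun k => c * x k) @ \oo --> (0 : R).
Proof. by move=> x0; rewrite -[X in _ --> X](mulr0 c); exact: cvgZr. Qed.

Lemma cvg_distP x (l : R) : x @ \oo --> l <-> (fun k => `|x k - l|) @ \oo --> (0 : R).
Proof.
split => [xl|xl].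
  apply: cvg0P => // e e0; have xe : \forall k \near \oo, `|l - x k| < e by move/cvgrPdist_lt: xl; exact.
  by apply: (nearS _ xe) => k; rewrite distrC.
by apply/cvgrPdist_lt => e e0; apply: (nearS _ (cvg0_lt xl e0)) => k; rewrite distrC.
Qed.

Lemma cvg0_cst (c : R) : 0 <= c -> (fun _ : nat => c) @ \oo --> (0 : R) -> c = 0.
Proof.
move=> c0 h; apply/eqP; rewrite eq_le c0 andbT leNgt; apply/negP => cp.
by have [N _ /(_ N (leqnn N))] := cvg0_lt h cp; rewrite /= ltxx.
Qed.
End NullSequences.

(** * Strong convergence of vectors in varying spaces *)

Section StrongLimits.
Variable R : realType.
Local Notation C := R[i].
Variables (H : lmodType C) (dot : {dot H for Num.conj}).
Variables (E : nat -> lmodType C) (dotE : forall k, {dot E k for Num.conj}).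
Variable J : forall k, {linear E k -> H}.
Hypothesis dotJ : forall k u v, dot (J k u) (J k v) = dotE k u v.
Local Notation N := (hnorm dot).
Implicit Types (v w : forall k, E k) (f g : H).

(** The vectors [v k] live in different spaces and are compared with [f] only after the isometric
    embeddings [J k]. *)
Definition scvg v f := (fun k => N (J k (v k) - f)) @ \oo --> (0 : R).

Lemma hnormJ k (u : E k) : N (J k u) = hnorm (dotE k) u.
Proof. by rewrite /hnorm dotJ. Qed.

Lemma scvg_lin a v w f g : scvg v f -> scvg w g ->
  scvg (fun k => a *: v k + w k) (a *: f + g).
Proof.
move=> vf wg; apply: le_cvg0 (cvg0D (cvg0Z (Normc.normc a) vf) wg) => k.
rewrite hnorm_ge0 /= linearP -hnormZ scalerBr.
by apply: le_trans (hnorm_leD _ _ _); rewrite addrACA -opprD.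
Qed.

Lemma scvg_norm v f : scvg v f ->
  (fun k => hnorm (dotE k) (v k)) @ \oo --> N f.
Proof.
move=> vf; apply/cvg_distP; apply: le_cvg0 vf => k.
by rewrite normr_ge0 -hnormJ hnorm_dist.
Qed.

Lemma scvg_dot v w f g : scvg v f -> scvg w g ->
  (fun k => Normc.normc (dotE k (v k) (w k) - dot f g)) @ \oo --> (0 : R).
Proof.
move=> vf wg.
have h : (fun k => N (J k (v k) - f) * hnorm (dotE k) (w k)
     + N f * N (J k (w k) - g)) @ \oo --> (0 : R).
  apply: cvg0D; last exact: cvg0Z.
  by rewrite -[X in _ --> X](mul0r (N g)); apply: cvgM => //; exact: scvg_norm.
apply: le_cvg0 h => k; rewrite normc_ge0 /= -dotJ.
have -> : dot (J k (v k)) (J k (w k)) - dot f g =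
    dot (J k (v k) - f) (J k (w k)) + dot f (J k (w k) - g).
  by rewrite linearBl linearBr/= addrA subrK.
apply: le_trans (normcD _ _) _; rewrite -hnormJ.
by apply: lerD; exact: cauchy_schwarz.
Qed.

Lemma scvg_unique v f g : scvg v f -> scvg v g -> f = g.
Proof.
move=> vf vg; apply/eqP; rewrite -subr_eq0 -(hnorm_eq0 dot); apply/eqP.
apply: cvg0_cst; first exact: hnorm_ge0.
apply: le_cvg0 (cvg0D vf vg) => k; rewrite hnorm_ge0 /= (hnormBC _ (J k (v k)) f).
exact: hnorm_triangle.
Qed.

End StrongLimits.

(** * Limits of operators along asymptotic embeddings *)

Section LinWord.
Variables (K : pzRingType) (V : lmodType K) (s t : {linear V -> V}).

Fixpoint lin_word (w : seq bool) : {linear V -> V} :=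
  if w is l :: w' then ((if l then s else t) : {linear V -> V}) \o lin_word w'
  else idfun.

Lemma lin_wordE w v : lin_word w v = eval_word s t w v.
Proof. by elim: w => //= l w <-; case: l. Qed.

End LinWord.

Section StrongOperatorLimits.
Variable R : realType.
Local Notation C := R[i].
Variables (H : lmodType C) (dot : {dot H for Num.conj}).
Variables (E : nat -> lmodType C) (dotE : forall k, {dot E k for Num.conj}).
Variable J : forall k, {linear E k -> H}.
Hypothesis dotJ : forall k u v, dot (J k u) (J k v) = dotE k u v.
Local Notation N := (hnorm dot).
Local Notation scvg := (scvg dot J).
Implicit Types (v w : forall k, E k) (f g : H).

Hypothesis complete : forall u : nat -> H,
  (forall e : R, 0 < e -> exists n0, forall m n, (n0 <= m)%N -> (n0 <= n)%N ->
     N (u m - u n) < e) ->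
  exists l, (fun n => N (u n - l)) @ \oo --> (0 : R).

(** [v k] is chosen within 1 / (k + 1) of the best approximation of [f] from the image of [J k].
    Hence it is eventually as good, up to a null term, as any sequence that converges to a vector
    near [f], and no diagonal choice is made. *)
Lemma scvg_exists f :
  (forall e : R, 0 < e -> exists2 phi, (exists u, scvg u phi) & N (f - phi) < e) ->
  exists v, scvg v f.
Proof.
move=> dense.
have [d d_gt0 d0] : exists2 d : nat -> R, forall k, 0 < d k & d @ \oo --> (0 : R).
  by exists (@harmonic R) => [k|]; [rewrite invr_gt0|exact: cvg_harmonic].
have best k : exists v : E k, forall w : E k, N (J k v - f) <= N (J k w - f) + d k.
  pose A := [set N (J k w - f) | w in [set: E k]].
  have Ainf : has_inf A.
    split; first by exists (N (J k 0 - f)), 0.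
    by exists 0 => _ [w _ <-]; exact: hnorm_ge0.
  have [_ [v _ <-] vA] := inf_adherent (d_gt0 k) Ainf.
  exists v => w; apply/ltW/(lt_le_trans vA).
  by rewrite lerD2r; apply: ge_inf; [exact: Ainf.2|exists w].
pose v k := projT1 (cid (best k)); exists v.
apply: cvg0P => [k|e e0]; first exact: hnorm_ge0.
have e2 : 0 < e / 3 by rewrite divr_gt0.
have [phi [u uphi] fphi] := dense _ e2.
have h1 := cvg0_lt uphi e2.
have h2 := cvg0_lt d0 e2.
apply: (nearS2 _ h1 h2) => k /= uk kk.
have := projT2 (cid (best k)) (u k); rewrite -/(v k) => vk.
have := hnorm_triangle dot phi (J k (u k)) f; rewrite (hnormBC _ phi f); lra.
Qed.

Variable A : forall k, {linear E k -> E k}.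
Hypothesis dotA : forall k x y, dotE k (A k x) (A k y) = dotE k x y.
Hypothesis dense : forall f (e : R), 0 < e -> exists2 phi,
  (exists u g, scvg u phi /\ scvg (fun k => A k (u k)) g) & N (f - phi) < e.

Let hnormA k (x y : E k) : N (J k (A k x) - J k (A k y)) = N (J k x - J k y).
Proof. by rewrite -!raddfB /hnorm !dotJ dotA. Qed.

Lemma scvg_dense_exists f : exists v, scvg v f.
Proof.
apply: scvg_exists => e /(dense f)[phi [u [g [uphi _]]] fphi].
by exists phi => //; exists u.
Qed.

(** Isometry of [A k] keeps the images of [v k] as close to the images of [u k] as [v k] is to
    [u k]. The latter images converge, so the former are Cauchy; two sequences with the same limit
    have images that differ by a null sequence, so one [g] serves all of them. *)
Lemma scvg_op_exists f :
  exists g, forall v, scvg v f -> scvg (fun k => A k (v k)) g.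
Proof.
have [v vf] := scvg_dense_exists f.
have [|g vg] := complete (u := fun k => J k (A k (v k))).
  move=> e e0; have e8 : 0 < e / 8 by rewrite divr_gt0.
  have [phi [u [g [uphi ug]]] fphi] := dense f e8.
  have h := nearI (cvg0_lt vf e8) (cvg0_lt uphi e8).
  have [n0 _ hn0] := nearI h (cvg0_lt ug e8).
  have bound k : (n0 <= k)%N -> N (J k (A k (v k)) - g) < e / 2.
    move=> /hn0 /= [[vk uk] gk].
    have := hnorm_triangle dot (J k (A k (u k))) (J k (A k (v k))) g.
    rewrite hnormA; have := hnorm_triangle dot f (J k (v k)) (J k (u k)).
    have := hnorm_triangle dot phi f (J k (u k)).
    by rewrite (hnormBC _ phi); lra.
  exists n0 => m n /bound mb /bound nb.
  have := hnorm_triangle dot g (J m (A m (v m))) (J n (A n (v n))).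
  by rewrite (hnormBC _ g); lra.
exists g => w wf; apply: le_cvg0 (cvg0D (cvg0D wf vf) vg) => k.
rewrite hnorm_ge0 /=; have := hnorm_triangle dot (J k (A k (v k))) (J k (A k (w k))) g.
rewrite hnormA; have := hnorm_triangle dot f (J k (w k)) (J k (v k)).
by rewrite (hnormBC _ f); lra.
Qed.

Lemma limit_operator : exists A0 : {linear H -> H},
  (forall f g, dot (A0 f) (A0 g) = dot f g) /\
  (forall v f, scvg v f -> scvg (fun k => A k (v k)) (A0 f)).
Proof.
pose A0 f := projT1 (cid (scvg_op_exists f)).
have A0P v f : scvg v f -> scvg (fun k => A k (v k)) (A0 f).
  exact: projT2 (cid (scvg_op_exists f)) v.
have lin : linear A0.
  move=> a f g; have [v vf] := scvg_dense_exists f.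
  have [w wg] := scvg_dense_exists g.
  apply: (scvg_unique (A0P _ _ (scvg_lin a vf wg))).
  apply: le_cvg0 (scvg_lin a (A0P _ _ vf) (A0P _ _ wg)) => k.
  by rewrite hnorm_ge0 /= [A k _]linearP.
pose L := GRing.isLinear.Build C H H *:%R A0 lin.
pose A0L : {linear H -> H} := HB.pack A0 L.
exists A0L; split=> // f g.
have [v vf] := scvg_dense_exists f; have [w wg] := scvg_dense_exists g.
have h1 := scvg_dot dotJ (A0P _ _ vf) (A0P _ _ wg); have h2 := scvg_dot dotJ vf wg.
apply/eqP; rewrite -subr_eq0; apply/eqP/Normc.eq0_normc/cvg0_cst.
  exact: normc_ge0.
apply: le_cvg0 (cvg0D h1 h2) => k; rewrite normc_ge0 /= dotA.
rewrite -(subrKA (dotE k (v k) (w k))) (le_trans (normcD _ _))//.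
by rewrite [X in X + _ <= _]normcBC.
Qed.

End StrongOperatorLimits.

Section Words.
Variable R : realType.
Local Notation C := R[i].
Variables (H : lmodType C) (dot : {dot H for Num.conj}).
Variables (E : nat -> lmodType C) (dotE : forall k, {dot E k for Num.conj}).
Variable J : forall k, {linear E k -> H}.
Hypothesis dotJ : forall k u v, dot (J k u) (J k v) = dotE k u v.
Local Notation N := (hnorm dot).
Local Notation scvg := (scvg dot J).

Lemma eval_word_isometry (V : lmodType C) (dotV : {dot V for Num.conj}) (s t : V -> V)
    (w : seq bool) :
  (forall u v, dotV (s u) (s v) = dotV u v) ->
  (forall u v, dotV (t u) (t v) = dotV u v) ->
  forall u v, dotV (eval_word s t w u) (eval_word s t w v) = dotV u v.
Proof. by move=> sI tI; elim: w => //= -[] w IH u v; rewrite ?sI ?tI. Qed.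

(** Convergence along every strongly convergent sequence, and not only along one fixed sequence, is
    what composes letter by letter. *)
Lemma scvg_eval_word (s t : forall k, E k -> E k) (s0 t0 : H -> H) (w : seq bool) :
  (forall v f, scvg v f -> scvg (fun k => s k (v k)) (s0 f)) ->
  (forall v f, scvg v f -> scvg (fun k => t k (v k)) (t0 f)) ->
  forall v f, scvg v f ->
    scvg (fun k => eval_word (s k) (t k) w (v k)) (eval_word s0 t0 w f).
Proof.
move=> hs ht v f vf; elim: w => //= -[] w IH; [exact: hs IH|exact: ht IH].
Qed.

Lemma scvg_scale (a : nat -> C) (a0 : C) v f : (forall k, normc (a k) = 1) ->
  (fun k => normc (a k - a0)) @ \oo --> (0 : R) -> scvg v f ->
  scvg (fun k => a k *: v k) (a0 *: f).
Proof.
move=> a1 aa0 vf; apply: le_cvg0 (cvg0D vf (cvg0Z (N f) aa0)) => k.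
rewrite hnorm_ge0 /= linearZ /=.
have := hnorm_triangle dot (a k *: f) (a k *: J k (v k)) (a0 *: f).
by rewrite -scalerBr -scalerBl !hnormZ a1 mul1r mulrC.
Qed.

(** Pairing with [v k] isolates the scalar: c_k (v_k, v_k) = (K v_k, v_k) tends to (K0 f, f), while
    (v_k, v_k) tends to (f, f), which is not 0. *)
Lemma scalar_limit (K : forall k, E k -> E k) (K0 : H -> H) (c : nat -> C) (f : H) :
  (forall k, normc (c k) = 1) -> (forall k x, K k x = c k *: x) ->
  (forall v f, scvg v f -> scvg (fun k => K k (v k)) (K0 f)) ->
  (forall f, exists v, scvg v f) -> f != 0 -> 
  exists c0 : C, (fun k => normc (c k - c0)) @ \oo --> (0 : R) /\
    forall f, K0 f = c0 *: f.
Proof.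
move=> c1 KE KK0 ex f0; have [v vf] := ex f.
pose c0 := dot (K0 f) f / dot f f.
have Nf : 0 < N f ^+ 2 by rewrite exprn_gt0// lt_def hnorm_eq0 f0 hnorm_ge0.
have cc0 : (fun k => normc (c k - c0)) @ \oo --> (0 : R).
  have h1 := scvg_dot dotJ (KK0 _ _ vf) vf; have h2 := scvg_dot dotJ vf vf.
  apply: le_cvg0 (cvg0Z (N f ^- 2) (cvg0D h1 h2)) => k.
  apply/andP; split; first exact: normc_ge0.
  suff : N f ^+ 2 * normc (c k - c0) <= normc (dotE k (K k (v k)) (v k) - dot (K0 f) f)
      + normc (dotE k (v k) (v k) - dot f f).
    by rewrite -ler_pdivlMl.
  rewrite KE [dotE k (_ *: _) _]linearZl_LR.
  have -> : N f ^+ 2 = normc (dot f f).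
    apply: (@complexI R); rewrite -normrcE ger0_norm ?dnorm_ge0//.
    by rewrite dot_hnorm.
  rewrite -Normc.normcM mulrBr /c0 mulrCA divff ?dnorm_eq0// mulr1.
  set p := dotE _ _ _; set q := dot (K0 f) f; set d := dot f f.
  rewrite -[X in _ <= _ + X]mul1r -(c1 k) -Normc.normcM.
  have -> : d * c k - q = c k * p - q - c k * (p - d) by ring.
  apply: le_trans (normcD _ _) _; rewrite lerD2l -mulrN opprB.
  by rewrite !Normc.normcM normcBC.
exists c0; split=> // g; have [w wg] := ex g.
apply: (scvg_unique (KK0 _ _ wg)); apply: le_cvg0 (scvg_scale c1 cc0 wg) => k.
by rewrite KE hnorm_ge0 lexx.
Qed.

End Words.

(** * The matrices of the quantum representation *)

Section Expi.
Variable R : realType.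
Local Notation C := R[i].
Implicit Types x y : R.

Lemma expi0 : expi 0 = 1 :> C. Proof. by rewrite /expi cos0 sin0. Qed.

Lemma expiD x y : expi (x + y) = expi x * expi y :> C.
Proof. by rewrite /expi cosD sinD; congr (_ +i* _); ring. Qed.

Lemma normc_expi x : normc (expi x) = 1.
Proof. by rewrite /= cos2Dsin2 sqrtr1. Qed.

Lemma expiN_mul x : expi x * expi (- x) = 1 :> C.
Proof. by rewrite -expiD subrr expi0. Qed.

Lemma conj_expi x : (expi x)^*%R = expi (- x) :> C.
Proof. by rewrite /expi cosN sinN. Qed.

Lemma sin_expi x : (sin x)%:C = (expi x - expi (- x)) / (2 * 'i) :> C.
Proof.
have i2 : 2 * 'i != 0 :> C by rewrite mulf_neq0 ?pnatr_eq0// neq0Ci.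
apply: (mulIf i2); rewrite divfK// /expi cosN sinN.
have -> : 'i = 'i%C :> C by [].
by apply/eqP; rewrite eq_complex /=; apply/andP; split; apply/eqP; ring.
Qed.

Lemma expi2pi : expi (pi *+ 2) = 1 :> C.
Proof. by rewrite /expi cos2pi sin2pi. Qed.

Lemma expi2pi_int (n : int) : expi (pi *+ 2 * n%:~R) = 1 :> C.
Proof.
elim/int_rec: n => [|n IH|n IH]; first by rewrite mulr0 expi0.
  by rewrite intS intrD mulrDr mulr1 expiD IH expi2pi mulr1.
rewrite intS opprD intrD mulrDr expiD IH mulr1 mulrN1.
by rewrite -[LHS]mul1r -{1}expi2pi expiN_mul.
Qed.

Lemma expi_neq1 x : 0 < x < pi *+ 2 -> expi x != 1 :> C.
Proof.
move=> /andP[x0 x2]; rewrite eq_complex /= negb_and; apply/orP; left.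
have -> : x = (x / 2) *+ 2 by rewrite -mulr_natr; field.
rewrite cos_mulr2n; have : 0 < sin (x / 2).
  by apply: sin_gt0_pi; move: x2; rewrite -mulr_natr; lra.
move=> s0; apply/eqP => /= e; have := cos2Dsin2 (x / 2).
have : 0 < sin (x / 2) ^+ 2 by rewrite exprn_gt0.
by move: e; rewrite -mulr_natr; lra.
Qed.
End Expi.

Lemma sum_shift_periodic (V : nmodType) (N : nat) (F : int -> V) (q : int) :
  (forall j, F (j + N%:Z) = F j) ->
  \sum_(m < N) F (m%:Z + q) = \sum_(m < N) F m%:Z.
Proof.
move=> per.
have step (G : int -> V) : (forall j : int, G (j + N%:Z) = G j) ->
    \sum_(m < N) G (m%:Z + 1) = \sum_(m < N) G m%:Z :> V.
  move=> perG; case: N {per} perG => [|n] perG; first by rewrite !big_ord0.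
  rewrite big_ord_recr [RHS]big_ord_recl [LHS]addrC /=; congr (_ + _).
    by rewrite -[RHS]perG; congr (G _); lia.
  by apply: eq_bigr => i _; congr (G _); rewrite /bump; lia.
elim/int_rec: q => [|n IH|n IH].
- by apply: eq_bigr => m _; rewrite addr0.
- rewrite -IH -(step (fun j => F (j + n%:Z))).
    by apply: eq_bigr => m _ /=; congr (F _); lia.
  by move=> j; rewrite -[RHS]per; congr (F _); lia.
- rewrite -IH -(step (fun j => F (j - n.+1%:Z))).
    by apply: eq_bigr => m _ /=; congr (F _); lia.
  by move=> j; rewrite -[RHS]per; congr (F _); lia.
Qed.

(** The sine matrices sum over 0 < m < r. A summand that is symmetric about r and vanishes at 0 and
    r extends this to a full period 2 r, where characters and Gauss sums live. *)
Lemma sum_even_half (V : zmodType) (r : nat) (G : nat -> V) :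
  G 0%N = 0 -> G r = 0 ->
  (forall m, (m <= r.*2)%N -> G (r.*2 - m)%N = G m) ->
  \sum_(m < r.*2) G m = (\sum_(m < r.-1) G m.+1) *+ 2.
Proof.
case: r => [|r] G0 Gr even; first by rewrite !big_ord0 mul0rn.
rewrite -addnn -!(big_mkord xpredT G) (@big_cat_nat _ _ _ r.+1)//=; last by rewrite leq_addr.
rewrite mulr2n; congr (_ + _); first by rewrite big_ltn// G0 add0r big_add1 /= big_mkord.
rewrite big_ltn; last by lia.
rewrite Gr add0r -(big_mkord xpredT (fun m => G m.+1)) big_nat_rev /=.
rewrite -{1}[r.+2]add0n -[r.+2]/(1 + r.+1)%N.
have -> : (r.+1 + r.+1 = r + r.+2)%N by lia.
rewrite -[in LHS](add0n r.+2) big_addn addnK.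
apply: eq_big_nat => m; rewrite add0n => /= m_r; rewrite -[RHS]even -?addnn; last lia.
by congr (G _); lia.
Qed.

Section SineMatrix.
Variable R : realType.
Local Notation C := R[i].
Variable k : nat.
Let r := k.+2.
Let r0 : (r%:R : R) != 0. Proof. by rewrite pnatr_eq0. Qed.

Definition sine_mx : 'M[C]_k.+1 := \matrix_(l, m)
  (Num.sqrt (2 / r%:R) * sin (pi * l.+1%:R * m.+1%:R / r%:R))%:C.

Definition theta_mx : 'M[C]_k.+1 :=
  diag_mx (\row_l expi (- (pi * l%:R * l.+2%:R / (2 * r%:R)))).

Let e (q : int) : C := expi (pi * q%:~R / r%:R).

Let eD p q : e (p + q) = e p * e q.
Proof. by rewrite /e -expiD; congr expi; rewrite intrD; field. Qed.

Let e0 : e 0 = 1. Proof. by rewrite /e mulr0 mul0r expi0. Qed.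

Let ePer (q n : int) : e (q + n * (2 * r%:Z)) = e q.
Proof.
rewrite eD /e; have -> : pi * (n * (2 * r%:Z))%:~R / r%:R = pi *+ 2 * n%:~R :> R.
  by rewrite -mulr_natr !intrM -pmulrn; field.
by rewrite expi2pi_int mulr1.
Qed.

(** Orthogonality of the characters modulo 2 r; the range of q leaves q = 0 as the only trivial
    one. *)
Let sum_e (q : int) : (- (2 * r%:Z) < q < 2 * r%:Z)%R ->
  \sum_(m < r.*2) e (m%:Z * q) = if q == 0 then (2 * r)%:R else 0.
Proof.
move=> q_lt; have [->|q0] := eqVneq q 0.
  under eq_bigr do rewrite mulr0 e0.
  by rewrite sumr_const card_ord -muln2 mulnC.
have eX (m : nat) : e (m%:Z * q) = e q ^+ m.
  elim: m => [|m IH]; first by rewrite mul0r e0.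
  by rewrite exprS -IH -eD; congr e; lia.
under eq_bigr do rewrite eX.
have piE : pi *+ 2 * r%:R = pi * (2 * r%:Z)%:~R :> R by rewrite intrM -pmulrn; ring.
have z1 : e q != 1.
  have [q_gt0|q_lt0|/eqP] := ltrgt0P q; last by rewrite (negbTE q0).
    rewrite /e; apply: expi_neq1; rewrite divr_gt0 ?mulr_gt0 ?pi_gt0 ?ltr0z//=.
    rewrite ltr_pdivrMr// piE ltr_pM2l ?pi_gt0// ltr_int.
    by case/andP: q_lt.
  have : e (- q) != 1.
    rewrite /e; apply: expi_neq1; rewrite divr_gt0 ?mulr_gt0 ?pi_gt0 ?ltr0z ?oppr_gt0//=.
    by rewrite ltr_pdivrMr// piE ltr_pM2l ?pi_gt0// ltr_int; lia.
  apply: contra => /eqP e1; have := eD q (- q).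
  by rewrite subrr e0 e1 mul1r => <-.
have z1' : e q - 1 != 0 by rewrite subr_eq0.
apply: (mulfI z1'); rewrite -subrX1 mulr0 -eX -muln2 mulnC.
have -> : (2 * r)%:Z * q = 0 + q * (2 * r%:Z) by lia.
by rewrite ePer e0 subrr.
Qed.

Let sine (n m : nat) : C := (sin (pi * n%:R * m%:R / r%:R))%:C.

Let sineE n m : sine n m = (e (m%:Z * n%:Z) - e (- (m%:Z * n%:Z))) / (2 * 'i).
Proof.
rewrite /sine sin_expi; congr ((expi _ - expi _) / _).
  by rewrite intrM -!pmulrn; field.
by rewrite mulrNz intrM -!pmulrn; field.
Qed.

Let sine0 n : sine n 0 = 0.
Proof. by rewrite sineE mul0r oppr0 subrr mul0r. Qed.

Let sine_r n : sine n r = 0.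
Proof.
rewrite sineE; have -> : e (r%:Z * n%:Z) = e (- (r%:Z * n%:Z)).
  by rewrite -[RHS](ePer _ n%:Z); congr e; lia.
by rewrite subrr mul0r.
Qed.

Let sine_rev n m : (m <= r.*2)%N -> sine n (r.*2 - m) = - sine n m.
Proof.
move=> m_le; rewrite !sineE -[RHS]mulNr opprB; congr ((_ - _) / _).
  by rewrite -[RHS](ePer _ n%:Z); congr e; rewrite -subzn// -muln2 PoszM; ring.
by rewrite -[RHS](ePer _ (- n%:Z)); congr e; rewrite -subzn// -muln2 PoszM; ring.
Qed.

Let sineC n m : sine n m = sine m n.
Proof. by rewrite /sine; congr ((sin (_ / _))%:C); rewrite mulrAC. Qed.

Let sqrt_sqr : (Num.sqrt (2 / r%:R))%:C * (Num.sqrt (2 / r%:R))%:C = 2 / r%:R :> C.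
Proof.
rewrite -rmorphM -expr2 sqr_sqrtr; last by rewrite divr_ge0.
by rewrite fmorph_div /= !rmorph_nat.
Qed.

Lemma sine_mxE l m : sine_mx l m = (Num.sqrt (2 / r%:R))%:C * sine l.+1 m.+1.
Proof. by rewrite mxE rmorphM. Qed.

Lemma sine_mx_sym : sine_mx^T = sine_mx.
Proof. by apply/matrixP => l m; rewrite mxE !sine_mxE sineC. Qed.

Let sine_prod n p m : sine n m * sine p m =
  - 4^-1 * (e (m%:Z * (n%:Z + p%:Z)) + e (m%:Z * - (n%:Z + p%:Z))
            - e (m%:Z * (n%:Z - p%:Z)) - e (m%:Z * - (n%:Z - p%:Z))).
Proof.
have i2 : (2 * 'i : C) * (2 * 'i) = - 4 by rewrite mulrACA -[X in _ * X]expr2 sqrCi mulrN1 -natrM.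
rewrite !sineE mulf_div i2.
have -> : m%:Z * (n%:Z + p%:Z) = m%:Z * n%:Z + m%:Z * p%:Z by ring.
have -> : m%:Z * - (n%:Z + p%:Z) = - (m%:Z * n%:Z) - m%:Z * p%:Z by ring.
have -> : m%:Z * (n%:Z - p%:Z) = m%:Z * n%:Z - m%:Z * p%:Z by ring.
have -> : m%:Z * - (n%:Z - p%:Z) = - (m%:Z * n%:Z) + m%:Z * p%:Z by ring.
by rewrite !eD; field.
Qed.

Let half_sum n p (phi : nat -> C) :
  (forall m, (m <= r.*2)%N -> phi (r.*2 - m)%N = phi m) ->
  \sum_(m < k.+1) sine n m.+1 * sine p m.+1 * phi m.+1 =
  2^-1 * \sum_(m < r.*2) sine n m * sine p m * phi m.
Proof.
move=> even; rewrite (@sum_even_half C r (fun m => sine n m * sine p m * phi m)).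
- by rewrite -[X in _ = _ * X]mulr_natl mulKf ?pnatr_eq0.
- by rewrite sine0 !mul0r.
- by rewrite sine_r !mul0r.
- by move=> m m_le; rewrite !sine_rev// mulrNN even.
Qed.

(** A product of two sines has the frequencies n + p and n - p up to sign, with 1 <= n, p <= r - 1
    in shifted indices. Modulo 2 r only n - p can vanish, and only for n = p. *)
Lemma sine_mx_sqr : sine_mx *m sine_mx = 1%:M.
Proof.
apply/matrixP => n p; rewrite !mxE.
under eq_bigr => m _ do rewrite !sine_mxE mulrACA sqrt_sqr (sineC m.+1)
  -[X in _ * X]mulr1.
rewrite -mulr_sumr (half_sum _ _ (phi := fun=> 1))//.
under eq_bigr do rewrite mulr1 sine_prod.
rewrite -mulr_sumr !(sumrB, big_split) /= !sum_e.
- have := ltn_ord n; have := ltn_ord p => lp ln.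
  have -> : (n.+1%:Z + p.+1%:Z == 0) = false by lia.
  have -> : (- (n.+1%:Z + p.+1%:Z) == 0) = false by lia.
  rewrite oppr_eq0; have -> : (n.+1%:Z - p.+1%:Z == 0) = (n == p).
    by rewrite -(inj_eq val_inj) /=; lia.
  have rC : (r%:R : C) != 0 by rewrite pnatr_eq0.
  case: eqP => _; last by rewrite addr0 !subr0 !mulr0.
  by rewrite natrM mulr1n; field.
all: by rewrite /r; have := ltn_ord n; have := ltn_ord p; lia.
Qed.

Let chirp (j : int) : C := expi (- (pi * j%:~R ^+ 2 / (2 * r%:R))).

Let chirp_per j : chirp (j + r.*2%:Z) = chirp j.
Proof.
rewrite /chirp -muln2 PoszM.
have -> : - (pi * (j + r%:Z * 2)%:~R ^+ 2 / (2 * r%:R)) =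
    - (pi * j%:~R ^+ 2 / (2 * r%:R)) + pi *+ 2 * (- (j + r%:Z))%:~R :> R.
  by rewrite !(intrD, intrM, mulrNz) -!pmulrn; field.
by rewrite expiD expi2pi_int mulr1.
Qed.

Let gauss : C := \sum_(m < r.*2) chirp m%:Z.

(** Completing the square in m^2 - 2 m q. *)
Let chirp_shift (m : nat) (q : int) :
  e (m%:Z * q) * chirp m%:Z = expi (pi * q%:~R ^+ 2 / (2 * r%:R)) * chirp (m%:Z - q).
Proof.
rewrite /e /chirp -!expiD; congr expi.
by rewrite !(intrD, intrM, mulrNz) -!pmulrn; field.
Qed.

Let sum_chirp (q : int) :
  \sum_(m < r.*2) e (m%:Z * q) * chirp m%:Z =
  expi (pi * q%:~R ^+ 2 / (2 * r%:R)) * gauss.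
Proof.
under eq_bigr do rewrite chirp_shift.
by rewrite -mulr_sumr (sum_shift_periodic _ chirp_per).
Qed.

Let theta (n : nat) : C := expi (- (pi * (n%:R ^+ 2 - 1) / (2 * r%:R))).

Let theta_chirp n : theta n = expi (pi / (2 * r%:R)) * chirp n%:Z.
Proof. by rewrite /theta /chirp -expiD; congr expi; rewrite -pmulrn; field. Qed.

(** Summing over m turns a frequency q into the Gauss sum times exp (pi i q^2 / (2 r)), for q = n +
    p and q = n - p. The outer factors [theta n] and [theta p] cancel n^2 and p^2, so that only the
    cross terms, which form [sine n p], survive. Each of the three factors [theta] contributes exp
    (pi i / (2 r)), whence the 3. *)
Let sine_chirp n p : theta n * theta p * \sum_(m < k.+1) sine n m.+1 * sine p m.+1 * theta m.+1
  = expi (3 * pi / (2 * r%:R)) * gauss / (2 * 'i) * sine n p.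
Proof.
rewrite (half_sum _ _ (phi := theta)); last first.
  move=> m m_le; rewrite !theta_chirp; congr (_ * _).
  rewrite -[RHS]mulr1 -subzn//.
  have -> : r.*2%:Z - m%:Z = - m%:Z + r.*2%:Z by lia.
  by rewrite chirp_per mulr1 /chirp mulrNz sqrrN.
have [c cE] : exists c : C, c = expi (pi / (2 * r%:R)) by eexists.
under eq_bigr do rewrite theta_chirp -cE mulrCA sine_prod -!mulrA !(mulrBl, mulrDl).
rewrite -!mulr_sumr !(sumrB, big_split) /= !sum_chirp.
have plus : theta n * theta p * c * expi (pi * (n%:Z + p%:Z)%:~R ^+ 2 / (2 * r%:R)) =
    expi (3 * pi / (2 * r%:R)) * e (p%:Z * n%:Z).
  rewrite cE /theta /e -!expiD; congr expi.
  by rewrite !(intrD, intrM) -!pmulrn; field.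
have minus : theta n * theta p * c * expi (pi * (n%:Z - p%:Z)%:~R ^+ 2 / (2 * r%:R)) =
    expi (3 * pi / (2 * r%:R)) * e (- (p%:Z * n%:Z)).
  rewrite cE /theta /e -!expiD; congr expi.
  by rewrite !(intrD, intrM, mulrNz) -!pmulrn; field.
have i2 : (2 * 'i : C) * (2 * 'i) = - 4 by rewrite mulrACA -[X in _ * X]expr2 sqrCi mulrN1 -natrM.
rewrite sineE mulf_div i2.
have -> : (- (n%:Z + p%:Z))%:~R ^+ 2 = (n%:Z + p%:Z)%:~R ^+ 2 :> R by rewrite mulrNz sqrrN.
have -> : (- (n%:Z - p%:Z))%:~R ^+ 2 = (n%:Z - p%:Z)%:~R ^+ 2 :> R by rewrite mulrNz sqrrN.
transitivity (- 4^-1 * gauss *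
    (theta n * theta p * c * expi (pi * (n%:Z + p%:Z)%:~R ^+ 2 / (2 * r%:R)) -
     theta n * theta p * c * expi (pi * (n%:Z - p%:Z)%:~R ^+ 2 / (2 * r%:R)))).
  by move: (expi (pi * (n%:Z + p%:Z)%:~R ^+ 2 / (2 * r%:R)))
    (expi (pi * (n%:Z - p%:Z)%:~R ^+ 2 / (2 * r%:R))) => E1 E2; field.
by rewrite plus minus; field.
Qed.

Lemma theta_mxE l m : theta_mx l m = theta l.+1 *+ (l == m).
Proof.
rewrite !mxE; congr (_ *+ _); rewrite /theta; congr (expi (- (_ / _))).
by rewrite -mulrA -natrM -[l.+2]addn1 -[in RHS]addn1 !natrD natrM !natrD; ring.
Qed.

(** Row vectors are acted on from the right, so the matrix of S T S T S T begins with [theta_mx].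
    Removing the last factor by [sine_mx_sqr] leaves B A B A B = c A, which is [sine_chirp]
    entrywise. *)
Lemma theta_sine_cube : exists c : C, theta_mx *m sine_mx *m
  (theta_mx *m sine_mx *m (theta_mx *m sine_mx)) = c%:M.
Proof.
exists ((Num.sqrt (2 / r%:R))%:C * (expi (3 * pi / (2 * r%:R)) * gauss / (2 * 'i))).
rewrite -[RHS]mulmx1 -sine_mx_sqr !mulmxA; congr (_ *m _).
apply/matrixP => n p; rewrite mul_scalar_mx.
have thetaM (B : 'M[C]_k.+1) i j : (theta_mx *m B) i j = theta i.+1 * B i j.
  rewrite mxE (bigD1 i)//= theta_mxE eqxx big1 ?addr0// => m /negbTE m_i.
  by rewrite theta_mxE eq_sym m_i mul0r.
have Mtheta (B : 'M[C]_k.+1) i j : (B *m theta_mx) i j = B i j * theta j.+1.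
  rewrite mxE (bigD1 j)//= theta_mxE eqxx big1 ?addr0// => m /negbTE m_j.
  by rewrite theta_mxE m_j mulr0.
rewrite Mtheta -!mulmxA thetaM mxE [RHS]mxE sine_mxE mulrACA -mulrA; rewrite -sine_chirp.
rewrite [RHS]mulrCA mulr_sumr mulrA [LHS]mulrAC; congr (_ * _).
by apply: eq_bigr => m _; rewrite thetaM !sine_mxE (sineC m.+1); ring.
Qed.

Lemma sine_mx_isometry u v : dotmx (u *m sine_mx) (v *m sine_mx) = dotmx u v.
Proof.
rewrite !dotmxE trmx_mul map_mxM sine_mx_sym; congr (_ 0 0).
have -> : map_mx Num.conj sine_mx = sine_mx.
  by apply/matrixP => i j; rewrite mxE sine_mxE rmorphM /=; congr (_ * _); apply: conjc_real.
by rewrite -mulmxA (mulmxA sine_mx) sine_mx_sqr mul1mx.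
Qed.

Lemma theta_mx_isometry u v : dotmx (u *m theta_mx) (v *m theta_mx) = dotmx u v.
Proof.
rewrite !dotmxE trmx_mul map_mxM; congr (_ 0 0).
rewrite -mulmxA (mulmxA theta_mx).
have -> : theta_mx *m map_mx Num.conj theta_mx^T = 1%:M.
  apply/matrixP => i j; rewrite mxE (bigD1 i)//= !mxE big1; last first.
    by move=> m /negbTE m_i; rewrite !mxE eq_sym m_i mul0r.
  rewrite addr0 eqxx mulr1n eq_sym; case: eqP => [->|_].
    by rewrite mulr1n conj_expi expiN_mul.
  by rewrite !mulr0n rmorph0 mulr0.
by rewrite mul1mx.
Qed.

End SineMatrix.

(** * Square-integrable functions *)

Section SquareIntegrals.
Variable R : realType.
Local Notation C := R[i].
Local Notation RM := (measurableTypeR R).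
Local Notation mu := (@lebesgue_measure R : {measure set RM -> \bar R}).
Implicit Types (F G : R -> C).

Definition cmeas F := measurable_fun setT (fun x : RM => Re (F x)) /\
  measurable_fun setT (fun x : RM => Im (F x)).

(** The squared L^2 norm of a function rather than of a class, with values in the extended reals, so
    that Fatou's lemma and monotonicity apply before square-integrability is known. *)
Definition nint F : \bar R := (\int[mu]_x (normc (F x) ^+ 2)%:E)%E.

Lemma normc2E (z : C) : normc z ^+ 2 = Re z ^+ 2 + Im z ^+ 2.
Proof. by case: z => a b /=; rewrite sqr_sqrtr // addr_ge0 ?sqr_ge0. Qed.

Lemma normc2D (z w : C) : normc (z + w) ^+ 2 <= 2 * normc z ^+ 2 + 2 * normc w ^+ 2.
Proof.
rewrite !normc2E; case: z w => [a b] [c d] /=.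
by have := sqr_ge0 (a - c); have := sqr_ge0 (b - d); rewrite !expr2; nra.
Qed.

Lemma cmeas_normc2 F : cmeas F -> measurable_fun setT (fun x : RM => normc (F x) ^+ 2).
Proof.
move=> [mF1 mF2]; under eq_fun do rewrite normc2E.
by apply: measurable_funD; exact: measurable_funX.
Qed.

Lemma cmeasD F G : cmeas F -> cmeas G -> cmeas (fun x => F x + G x).
Proof.
move=> [F1 F2] [G1 G2]; split.
  have -> : (fun x : RM => Re (F x + G x)) = (fun x => Re (F x) + Re (G x)).
    by apply/funext => x; case: (F x) (G x) => [? ?] [? ?].
  exact: measurable_funD.
have -> : (fun x : RM => Im (F x + G x)) = (fun x => Im (F x) + Im (G x)).
  by apply/funext => x; case: (F x) (G x) => [? ?] [? ?].
exact: measurable_funD.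
Qed.

Lemma cmeasM F G : cmeas F -> cmeas G -> cmeas (fun x => F x * G x).
Proof.
move=> [F1 F2] [G1 G2]; split.
  have -> : (fun x : RM => Re (F x * G x)) =
      (fun x => Re (F x) * Re (G x) - Im (F x) * Im (G x)).
    by apply/funext => x; case: (F x) (G x) => [? ?] [? ?].
  by apply: measurable_funB; exact: measurable_funM.
have -> : (fun x : RM => Im (F x * G x)) =
    (fun x => Re (F x) * Im (G x) + Im (F x) * Re (G x)).
  by apply/funext => x; case: (F x) (G x) => [? ?] [? ?].
by apply: measurable_funD; exact: measurable_funM.
Qed.

Lemma cmeas_real (f : RM -> R) : measurable_fun setT f -> cmeas (fun x => (f x)%:C).
Proof. by move=> mf; split. Qed.

Lemma cmeas_cst (a : C) : cmeas (fun=> a). Proof. by split. Qed.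

Lemma cmeasZ (a : C) F : cmeas F -> cmeas (fun x => a * F x).
Proof. by apply: cmeasM; exact: cmeas_cst. Qed.

Lemma cmeasB F G : cmeas F -> cmeas G -> cmeas (fun x => F x - G x).
Proof.
move=> mF mG; apply: cmeasD => //.
by have := cmeasZ (-1) mG; under eq_fun do rewrite mulN1r.
Qed.

Lemma Lfun2P (f : RM -> R) : f \in Lfun mu 2%:E <->
  measurable_fun setT f /\ (\int[mu]_x (f x ^+ 2)%:E < +oo)%E.
Proof.
split=> [f2|[mf fi]].
  have mf : measurable_fun setT f by move: f2; rewrite inE => /andP[/[!inE]].
  split=> //; have /integrableP[_] := Lfun2_integrable_sqr f2.
  by under eq_integral do rewrite /= ger0_norm ?sqr_ge0//.
rewrite inE; apply/andP; split; rewrite inE//= /finite_norm unlock /Lnorm.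
rewrite poweR_lty//; apply: le_lt_trans fi.
by under eq_integral do rewrite /= powR_mulrn ?normr_ge0// real_normK ?num_real//.
Qed.

Lemma nint_ge0 F : (0 <= nint F)%E.
Proof. by apply: integral_ge0 => x _; rewrite lee_fin sqr_ge0. Qed.

Lemma nint_le (F : R -> C) (g : RM -> R) : cmeas F -> measurable_fun setT g ->
  (forall x, normc (F x) ^+ 2 <= g x) -> (nint F <= \int[mu]_x (g x)%:E)%E.
Proof.
move=> mF mg Fg; apply: ge0_le_integral => //.
- by move=> x _; rewrite lee_fin sqr_ge0.
- by apply/measurable_EFinP; exact: cmeas_normc2.
- exact/measurable_EFinP.
- by move=> x _; rewrite lee_fin.
Qed.

Lemma nintD F G : cmeas F -> cmeas G ->
  (nint (fun x => F x + G x)%R <= 2%:E * nint F + 2%:E * nint G)%E.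
Proof.
move=> mF mG; have m1 := cmeas_normc2 mF; have m2 := cmeas_normc2 mG.
apply: le_trans (nint_le (cmeasD mF mG) _ (fun x => normc2D (F x) (G x))) _.
  by apply: measurable_funD; apply: measurable_funM.
under eq_integral do rewrite EFinD (EFinM 2) (EFinM 2 (normc (G _) ^+ 2)).
have sq0 (z : C) : (0%R <= (normc z ^+ 2)%:E)%E by rewrite lee_fin sqr_ge0.
have /measurable_EFinP e1 := m1; have /measurable_EFinP e2 := m2.
rewrite ge0_integralD//; try by move=> x _; rewrite mule_ge0.
- by rewrite !ge0_integralZl.
- by apply: emeasurable_funM.
- by apply: emeasurable_funM.
Qed.

Lemma sqintP F : F \in @sqint R <-> cmeas F /\ (nint F < +oo)%E.
Proof.
split=> [/andP[/Lfun2P[m1 i1] /Lfun2P[m2 i2]]|[[m1 m2] i]].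
  split; first by split.
  rewrite /nint; under eq_integral do rewrite normc2E EFinD.
  rewrite ge0_integralD//; first by rewrite lte_add_pinfty.
  - by move=> x _; rewrite lee_fin sqr_ge0.
  - by apply/measurable_EFinP; exact: measurable_funX.
  - by move=> x _; rewrite lee_fin sqr_ge0.
  - by apply/measurable_EFinP; exact: measurable_funX.
have mF := @cmeas_normc2 F (conj m1 m2).
apply/andP; split; apply/Lfun2P; split=> //; apply: le_lt_trans i.
  apply: ge0_le_integral => //.
  - by move=> x _; rewrite lee_fin sqr_ge0.
  - by apply/measurable_EFinP; exact: measurable_funX.
  - exact/measurable_EFinP.
  - by move=> x _; rewrite lee_fin normc2E lerDl sqr_ge0.
apply: ge0_le_integral => //.
- by move=> x _; rewrite lee_fin sqr_ge0.
- by apply/measurable_EFinP; exact: measurable_funX.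
- exact/measurable_EFinP.
- by move=> x _; rewrite lee_fin normc2E lerDr sqr_ge0.
Qed.

End SquareIntegrals.

(** * Classes in L^2_odd(R) and the functions that represent them *)

Section Representatives.
Variable R : realType.
Local Notation C := R[i].
Local Notation RM := (measurableTypeR R).
Local Notation mu := (@lebesgue_measure R : {measure set RM -> \bar R}).
Implicit Types (F G : R -> C) (u v : L2odd R).
Local Notation N := (hnorm (@L2odd_dot R)).

Let ae_filter : Filter (almost_everywhere mu) := ae_filter_ringOfSetsType mu.

(** A class coerces to an arbitrarily chosen representative; this predicate allows any explicit
    formula that agrees with it almost everywhere. *)
Definition rep u F := F \in @sqint R /\ {ae mu, forall x, (u : R -> C) x = F x}.

Lemma rep_self u : rep u (u : R -> C).
Proof. by split; [exact: L2funP|exact: aeW]. Qed.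

Lemma rep_class u (F : L2fun R) : L2odd_val u = L2_class F -> rep u F.
Proof.
have FF := ae_filter.
move=> uF; split; first exact: L2funP.
have := L2_class_null F; rewrite -uF => /ae_nullP; apply: filterS => x /=.
by move/eqP; rewrite subr_eq0 => /eqP.
Qed.

Lemma rep_odd u : exists2 F, rep u F & forall x, F (- x) = - F x.
Proof.
have /asboolP[F oddF uF] := L2oddP u.
by exists F => //; exact: rep_class.
Qed.

Lemma rep_exists F : F \in @sqint R -> (forall x, F (- x) = - F x) ->
  exists u, rep u F.
Proof.
move=> F2 oddF; pose f := MkL2fun F2.
have fo : L2_class f \in @odd_class R by apply/asboolP; exists f.
by exists (MkL2odd fo); exact: (@rep_class _ f).
Qed.

Lemma rep_lin (a : C) u v F G : rep u F -> rep v G ->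
  rep (a *: u + v) (fun x => a * F x + G x).
Proof.
have FF := ae_filter.
move=> [F2 uF] [G2 vG]; split.
  have [_ h] := sqint_submod_closed R; exact: h.
have h : L2odd_val (a *: u + v) = L2_class (a *: (u : L2fun R) + (v : L2fun R)).
  by rewrite L2_classD L2_classZ !L2_to_funK.
have [_] := rep_class h; move: uF vG; apply: filterS3 => x /= uF vG ->.
by rewrite -uF -vG.
Qed.

Lemma nint_ae_eq F G : cmeas F -> cmeas G -> {ae mu, forall x, F x = G x} ->
  nint F = nint G.
Proof.
have FF := ae_filter.
move=> mF mG FG; apply: ae_eq_integral => //.
- by apply/measurable_EFinP; exact: cmeas_normc2.
- by apply/measurable_EFinP; exact: cmeas_normc2.
- by move: FG; apply: filterS => x /= ->.
Qed.

Lemma rep_hnorm u F : rep u F -> (N u ^+ 2)%:E = nint F.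
Proof.
have FF := ae_filter.
move=> [/sqintP[mF iF] uF].
have [/sqintP[mu' iu] _] := rep_self u.
have <- : nint (u : R -> C) = nint F by exact: nint_ae_eq.
rewrite sqr_hnorm.
have -> : Re (L2odd_dot u u) = fine (nint (u : R -> C)).
  rewrite /L2odd_dot /L2_dot /L2fun_dot /Cintegral /= /Rintegral /nint.
  congr fine; apply: eq_integral => x _; rewrite normc2E.
  by case: ((u : R -> C) x) => a b /=; congr EFin; ring.
by rewrite fineK// ge0_fin_numE// nint_ge0.
Qed.

Lemma rep_hnormB u v F G : rep u F -> rep v G ->
  (N (u - v) ^+ 2)%:E = nint (fun x => F x - G x).
Proof.
move=> uF vG; apply: rep_hnorm; have := rep_lin (-1) vG uF.
by rewrite scaleN1r addrC; congr (rep _ _); apply/funext => x; rewrite mulN1r addrC.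
Qed.

Lemma rep_inj u v F : rep u F -> rep v F -> u = v.
Proof.
move=> uF vF; apply/eqP; rewrite -subr_eq0 -(hnorm_eq0 (@L2odd_dot R)).
rewrite -sqrf_eq0 -(inj_eq (@EFin_inj R)) (rep_hnormB uF vF) /nint.
under eq_integral do rewrite subrr Normc.normc0 expr0n.
by rewrite integral0.
Qed.

End Representatives.

Section NintLimits.
Variable R : realType.
Local Notation C := R[i].
Local Notation RM := (measurableTypeR R).
Local Notation mu := (@lebesgue_measure R : {measure set RM -> \bar R}).
Implicit Types (F G : R -> C).

Let ae_filter : Filter (almost_everywhere mu) := ae_filter_ringOfSetsType mu.

Definition ccvg (z : nat -> C) (l : C) := (fun n => normc (z n - l)) @ \oo --> (0 : R).

Lemma ccvg_normc2 z l : ccvg z l ->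
  (fun n => (normc (z n) ^+ 2)%:E) @ \oo --> (normc l ^+ 2)%:E.
Proof.
move=> zl; apply: cvg_EFin; first exact: nearW.
suff h : (fun n => normc (z n)) @ \oo --> normc l.
  by have := cvgM h h; exact.
apply/cvg_distP; apply: le_cvg0 zl => n; rewrite normr_ge0 /= ler_norml.
have := normcD (z n - l) l; rewrite subrK.
by have := normcD (l - z n) (z n); rewrite subrK normcBC; lra.
Qed.

Lemma ccvg_ReIm z l : ccvg z l ->
  (fun n => Re (z n)) @ \oo --> Re l /\ (fun n => Im (z n)) @ \oo --> Im l.
Proof.
have ImB (a b : C) : Im (a - b) = Im a - Im b by case: a b => [? ?] [? ?].
have ReB (a b : C) : Re (a - b) = Re a - Re b by case: a b => [? ?] [? ?].
move=> zl; split; apply/cvg_distP; apply: le_cvg0 zl => n;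
  rewrite normr_ge0 /= -?ReB -?ImB; case: (z n - l) => a b /=;
  by rewrite -sqrtr_sqr ler_sqrt ?addr_ge0 ?sqr_ge0// ?lerDl ?lerDr sqr_ge0.
Qed.

Lemma cmeas_limit (F_ : nat -> R -> C) F : (forall n, cmeas (F_ n)) ->
  (forall x, ccvg (F_ ^~ x) (F x)) -> cmeas F.
Proof.
move=> mF_ FF; split.
  apply: (@measurable_fun_cvg _ RM R setT (fun n x => Re (F_ n x))) => [n|x _].
    by have [] := mF_ n.
  by have [] := ccvg_ReIm (FF x).
apply: (@measurable_fun_cvg _ RM R setT (fun n x => Im (F_ n x))) => [n|x _].
  by have [] := mF_ n.
by have [] := ccvg_ReIm (FF x).
Qed.

Lemma nint_fatou (F_ : nat -> R -> C) F (c : \bar R) : (forall n, cmeas (F_ n)) ->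
  (forall x, ccvg (F_ ^~ x) (F x)) -> (forall n, (nint (F_ n) <= c)%E) ->
  (nint F <= c)%E.
Proof.
move=> mF_ FF Fc.
have -> : nint F = (\int[mu]_x limn_einf (fun n => (normc (F_ n x) ^+ 2)%:E))%E.
  by apply: eq_integral => x _; have [-> _] := cvg_limn_einf_sup (ccvg_normc2 (FF x)).
apply: le_trans (fatou _ _ _ _) _ => //.
- by move=> n; apply/measurable_EFinP; exact: cmeas_normc2.
- by move=> n x _; rewrite lee_fin sqr_ge0.
rewrite limn_einf_lim; apply: lime_le; first exact: is_cvg_einfs.
apply: nearW => n; apply: le_trans (Fc n).
by apply: ereal_inf_lbound; exists n => /=.
Qed.

Lemma ccvgB0 z l : ccvg z l -> ccvg (fun n => z n - l) 0.
Proof. by move=> zl; apply: le_cvg0 zl => n; rewrite subr0 normc_ge0 /=. Qed.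

Lemma nint_dominated (F_ : nat -> R -> C) F (g : RM -> R) :
  (forall n, cmeas (F_ n)) -> cmeas F -> measurable_fun setT g ->
  (\int[mu]_x (g x)%:E < +oo)%E ->
  (forall n x, normc (F_ n x) ^+ 2 <= g x) ->
  {ae mu, forall x, ccvg (F_ ^~ x) (F x)} ->
  (nint F < +oo)%E /\ (fun n => nint (fun x => F_ n x - F x)) @ \oo --> 0%E.
Proof.
have FF := ae_filter.
move=> mF_ mF mg ig Fg FF_.
have g0 x : 0 <= g x by apply: le_trans (Fg 0%N x); exact: sqr_ge0.
have Fle : {ae mu, forall x, normc (F x) ^+ 2 <= 4 * g x}.
  move: FF_; apply: filterS => x /= Fx; apply/ler_addgt0Pr => e e0.
  (* For d = |F_n - F|, the bounds d < 1 and d < e / 2 give 2 d^2 < e. *)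
  have e1 : 0 < Num.min 1 (e / 2) by rewrite lt_min ltr01 divr_gt0.
  have [n _ /(_ n (leqnn n))] := cvg0_lt Fx e1; rewrite /= lt_min => /andP[d1 d2].
  have := normc2D (F x - F_ n x) (F_ n x); rewrite subrK normcBC.
  have := Fg n x; have := normc_ge0 (F_ n x - F x); have := g0 x.
  move: (normc _) d1 d2 => d; nra.
split.
  apply: le_lt_trans (_ : (\int[mu]_x (4 * g x)%:E < +oo)%E).
    apply: ae_ge0_le_integral => //.
    - by move=> x _; rewrite lee_fin sqr_ge0.
    - by apply/measurable_EFinP; exact: cmeas_normc2.
    - by move=> x _; rewrite lee_fin mulr_ge0.
    - by apply/measurable_EFinP; exact: measurable_funM.
    - by move: Fle; apply: filterS => x /= h _; rewrite lee_fin.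
  under eq_integral do rewrite EFinM.
  rewrite ge0_integralZl//; first by rewrite lte_mul_pinfty.
    exact/measurable_EFinP.
  by move=> x _; rewrite lee_fin.
(* [normc2D] with |F_n|^2 <= g and |F|^2 <= 4 g gives the majorant 2 g + 8 g. *)
have gint : mu.-integrable setT (EFin \o (fun x => 10 * g x)).
  have gi : mu.-integrable setT (EFin \o g).
    apply/integrableP; split; first exact/measurable_EFinP.
    by under eq_integral do rewrite /= ger0_norm//.
  exact: (integrableZl measurableT 10 gi).
have [||||] := @dominated_convergence _ _ _ mu setT measurableT
    (fun n x => (normc (F_ n x - F x) ^+ 2)%:E) (cst 0%E) _ _ _ _ gint.
- by move=> n; apply/measurable_EFinP; apply: cmeas_normc2; exact: cmeasB.
- exact: measurable_cst.
- move: FF_; apply: filterS => x /= Fx _.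
  by have := ccvg_normc2 (ccvgB0 Fx); rewrite Normc.normc0 expr0n.
- move: Fle; apply: filterS => x /= h n _; rewrite lee_fin ger0_norm ?sqr_ge0//.
  have := normc2D (F_ n x) (- F x); have -> : normc (- F x) = normc (F x) by rewrite -sub0r normcBC subr0.
  have := Fg n x; lra.
- by move=> _ _; rewrite integral0.
Qed.

End NintLimits.

(** * Completeness of L^2_odd(R) (Riesz-Fischer) *)

Section Completeness.
Variable R : realType.
Local Notation C := R[i].
Local Notation RM := (measurableTypeR R).
Local Notation mu := (@lebesgue_measure R : {measure set RM -> \bar R}).
Local Notation N := (hnorm (@L2odd_dot R)).

Let ae_filter : Filter (almost_everywhere mu) := ae_filter_ringOfSetsType mu.

Lemma bounded_variation_cvg (a : nat -> R) (B : R) :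
  (forall n, \sum_(0 <= j < n) `|a j.+1 - a j| <= B) -> cvgn a.
Proof.
move=> aB; have : cvgn (series (telescope a)).
  apply: normed_cvg; apply: nondecreasing_is_cvgn.
    by apply: nondecreasing_series => n _ _; exact: normr_ge0.
  by exists B => _ [n _ <-]; exact: aB.
rewrite telescopeK => h.
have -> : a = (fun n => a 0%N + (a n - a 0%N)) by apply/funext => n; rewrite addrC subrK.
by apply: is_cvgD => //; exact: is_cvg_cst.
Qed.

Lemma normcN (z : C) : normc (- z) = normc z.
Proof. by apply: (@complexI R); rewrite -!normrcE normrN. Qed.

Lemma normc_le_ReIm (z : C) : normc z <= `|Re z| + `|Im z|.
Proof.
rewrite -(@ler_pXn2r _ 2) ?nnegrE ?addr_ge0 ?normc_ge0// normc2E sqrrD !real_normK ?num_real//.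
by rewrite addrAC lerDl mulrn_wge0// mulr_ge0.
Qed.

Lemma ccvg_unique (z : nat -> C) (l l' : C) : ccvg z l -> ccvg z l' -> l = l'.
Proof.
move=> zl zl'; apply/eqP; rewrite -subr_eq0; apply/eqP/Normc.eq0_normc/cvg0_cst.
  exact: normc_ge0.
apply: le_cvg0 (cvg0D zl zl') => n; rewrite normc_ge0 /= [X in _ <= X + _]normcBC.
by apply: le_trans (normcD _ _); rewrite addrA subrK.
Qed.

Lemma ccvg_cauchy_exists (z : nat -> C) (B : R) :
  (forall n, \sum_(0 <= j < n) normc (z j.+1 - z j) <= B) -> exists l, ccvg z l.
Proof.
move=> zB.
have ImB (a b : C) : Im (a - b) = Im a - Im b by case: a b => [? ?] [? ?].
have ReB (a b : C) : Re (a - b) = Re a - Re b by case: a b => [? ?] [? ?].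
have [h1 h2] : cvgn (fun n => Re (z n)) /\ cvgn (fun n => Im (z n)).
  split; apply: (@bounded_variation_cvg _ B) => n; apply: le_trans (zB n);
    apply: ler_sum => j _; rewrite -?ReB -?ImB; case: (z j.+1 - z j) => a b /=;
    by rewrite -sqrtr_sqr ler_sqrt ?addr_ge0 ?sqr_ge0// ?lerDl ?lerDr sqr_ge0.
exists (limn (fun n => Re (z n)) +i* limn (fun n => Im (z n))).
move: h1 h2 => /cvg_distP h1 /cvg_distP h2.
apply: le_cvg0 (cvg0D h1 h2) => n; rewrite normc_ge0 /=.
by apply: le_trans (normc_le_ReIm _) _; rewrite ReB ImB.
Qed.

Let t (j : nat) : R := (2 ^+ j.+1)^-1.

Let t_gt0 j : 0 < t j. Proof. by rewrite invr_gt0 exprn_gt0. Qed.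

Let t_cvg0 : t @ \oo --> (0 : R).
Proof.
have -> : t = (fun n => 2^-1 * 2^-1 ^+ n).
  by apply/funext => n; rewrite /t exprVn -invfM -exprS.
by apply: cvg0Z; apply: cvg_expr; rewrite ger0_norm ?invr_ge0// invf_lt1// ltr1n.
Qed.

(** The increments d_j have squared norm at most 4^-(j+1), so the series of 2^j |d_j|^2 is
    integrable and thus finite almost everywhere. There a <= 2^j a^2 + 2^-j makes the increments
    absolutely summable, and Fatou's lemma carries the bounds to the pointwise limit. *)
Lemma fast_cauchy_limit (G : nat -> R -> C) :
  (forall j, G j \in @sqint R) -> (forall j x, G j (- x) = - G j x) ->
  (forall i j, (i <= j)%N -> (nint (fun x => G j x - G i x)%R <= (t i ^+ 2)%:E)%E) ->
  exists F, [/\ F \in @sqint R, forall x, F (- x) = - F x &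
    forall j, (nint (fun x => G j x - F x)%R <= (t j ^+ 2)%:E)%E].
Proof.
have FF := ae_filter.
move=> G2 Godd Gt; have Gm j : cmeas (G j) by have /sqintP[] := G2 j.
pose d j x := G j.+1 x - G j x.
pose f j (x : RM) := (2 ^+ j * normc (d j x) ^+ 2)%:E.
have dm j : cmeas (d j) by exact: cmeasB.
have f0 j x : (0 <= f j x)%E.
  by rewrite lee_fin; apply: mulr_ge0; [exact: exprn_ge0|exact: sqr_ge0].
have fm j : measurable_fun setT (f j).
  by apply/measurable_EFinP; apply: measurable_funM => //; exact: cmeas_normc2.
pose S x : \bar R := (\sum_(j <oo) f j x)%E.
have Sm : measurable_fun setT S by apply: ge0_emeasurable_sum => //.
have S0 x : (0 <= S x)%E by apply: nneseries_ge0.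
have Sint : (\int[mu]_x S x < +oo)%E.
  rewrite integral_nneseries//.
  apply: le_lt_trans (ltry (1:R)); apply: le_trans (@epsilon_trick0 R 1 xpredT ler01).
  apply: lee_nneseries => [j _ _|j _]; first exact: integral_ge0.
  under eq_integral do rewrite /f EFinM.
  rewrite ge0_integralZl//; last first.
  - by move=> x _; rewrite lee_fin sqr_ge0.
  - by apply/measurable_EFinP; exact: cmeas_normc2.
  apply: le_trans (lee_pmul _ _ (lexx _) (Gt j j.+1 (leqnSn j))) _ => //.
    exact: nint_ge0.
  rewrite -EFinM lee_fin /t natrX -exprVn -exprM mulnC exprM.
  rewrite [in X in _ * X]exprS mulrCA -exprMn [2 * _]mulrC.
  have -> : (2^-1 ^+ 2 * 2 : R) = 2^-1 by field.
  rewrite mul1r [X in _ <= X]exprS ler_pM2r ?exprn_gt0 ?invr_gt0//.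
  by rewrite expr2; lra.
have Sfin : {ae mu, forall x, S x \is a fin_num}.
  have Si : mu.-integrable setT S.
    apply/integrableP; split=> //; apply: le_lt_trans Sint.
    by under eq_integral do rewrite gee0_abs//.
  by have := integrable_ae measurableT Si; apply: filterS => x /(_ I).
(* Cutting to the set where the series is finite makes the functions converge everywhere. This set
   has full measure, and it is symmetric because the G_j are odd, so the limit is odd at every
   point. *)
pose A : set RM := [set x | (S x < +oo)%E].
have mA : measurable A by rewrite -[A]setTI; exact: measurable_lte.
pose G' j x := (\1_A x)%:C * G j x.
have G'm j : cmeas (G' j).
  by apply: cmeasM => //; apply: cmeas_real; exact: measurable_indic.
have SN x : S (- x) = S x.
  rewrite /S; apply: eq_eseriesr => j _; rewrite /f /d !Godd -opprD.
  by rewrite normcN.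
have AN x : \1_A (- x) = \1_A x :> R.
  by rewrite !indicE; congr (_ %:R); congr nat_of_bool; apply/idP/idP;
    rewrite !inE /A /= SN.
have /choice[F G'F] x : exists l, ccvg (G' ^~ x) l.
  have [Ax|Ax] := boolP (x \in A); last first.
    exists 0; rewrite /ccvg /G' indicE (negbTE Ax).
    under eq_fun do rewrite mul0r subrr Normc.normc0; exact: cvg_cst.
  have Sx : (S x < +oo)%E by move: Ax; rewrite inE.
  have Sxfin : S x \is a fin_num by rewrite ge0_fin_numE.
  apply: (@ccvg_cauchy_exists _ (fine (S x) + 2)) => n.
  have h1 : \sum_(0 <= j < n) (2 ^+ j * normc (d j x) ^+ 2) <= fine (S x).
    rewrite -lee_fin fineK// -sumEFin.
    by apply: (@nneseries_lim_ge _ (f ^~ x) xpredT 0 n).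
  have h2 : \sum_(0 <= j < n) (2^-1 ^+ j : R) <= 2.
    have -> : \sum_(0 <= j < n) (2^-1 ^+ j : R) = 2 - 2 * 2^-1 ^+ n.
      elim: n {h1} => [|n IH]; first by rewrite big_geq// expr0 mulr1 subrr.
      by rewrite big_nat_recr//= IH exprS; field.
    by rewrite gerBl mulr_ge0// exprn_ge0// invr_ge0.
  apply: le_trans (lerD h1 h2); rewrite -big_split /=; apply: ler_sum => j _.
  rewrite /G' -mulrBr indicE Ax mul1r -/(d j x).
  have p0 : 0 < 2 ^+ j :> R by rewrite exprn_gt0.
  (* With p = 2^j this square gives p a <= (p a)^2 + 1; dividing by p bounds a by p a^2 + 1 / p, and
     the terms 1 / p add up to at most 2. *)
  have := sqr_ge0 (2 ^+ j * normc (d j x) - 1).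
  move: (normc_ge0 (d j x)); rewrite exprVn; move: (normc _) (2 ^+ j) p0 => a p p0 a0 h.
  rewrite -(ler_pM2l p0) mulrDr divff ?gt_eqF//.
  by move: h; rewrite !expr2; nra.
have Fm : cmeas F by exact: cmeas_limit G'F.
have GG' i j : (nint (fun x => G' j x - G' i x)%R <= nint (fun x => G j x - G i x)%R)%E.
  apply: nint_le; [exact: cmeasB|by apply: cmeas_normc2; exact: cmeasB|move=> x].
  rewrite /G' -mulrBr Normc.normcM exprMn ler_piMl ?sqr_ge0//.
  by rewrite indicE; case: (x \in A); rewrite ?Normc.normc1 ?Normc.normc0 ?expr1n ?expr0n.
have G'G j : {ae mu, forall x, G' j x = G j x}.
  move: Sfin; apply: filterS => x Sx; rewrite /G' indicE mem_set ?mul1r//.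
  by rewrite /A /= -ge0_fin_numE.
have FG' j : (nint (fun x => F x - G' j x)%R <= (t j ^+ 2)%:E)%E.
  apply: (@nint_fatou _ (fun i x => G' (i + j)%N x - G' j x)).
  - by move=> i; exact: cmeasB.
  - move=> x; rewrite /ccvg.
    have h : (fun i => normc (G' (i + j)%N x - F x)) @ \oo --> (0 : R).
      exact: (cvg_comp _ _ (cvg_addnr j) (G'F x)).
    by apply: le_cvg0 h => n; rewrite normc_ge0 /= opprB addrA subrK.
  - move=> i; apply: le_trans (GG' _ _) _; apply: Gt; exact: leq_addl.
exists F; split.
- apply/sqintP; split=> //.
  apply: le_lt_trans (_ : (nint (fun x => (F x - G' 0%N x) + G' 0%N x)%R < +oo)%E).
    by rewrite /nint; under [leRHS]eq_integral do rewrite subrK.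
  apply: le_lt_trans (nintD _ _) _ => //; first exact: cmeasB.
  apply: lte_add_pinfty; apply: lte_mul_pinfty => //.
    by apply: le_lt_trans (FG' 0%N) (ltry _).
  rewrite (nint_ae_eq (G'm 0%N) (Gm 0%N) (G'G 0%N)).
  by have /sqintP[_] := G2 0%N.
- move=> x; apply: (@ccvg_unique (G' ^~ (- x))) => //.
  apply: le_cvg0 (G'F x) => n; rewrite normc_ge0 /= /G' AN Godd mulrN -opprD.
  by rewrite normcN.
- move=> j; apply: le_trans (FG' j).
  have <- : nint (fun x => G' j x - F x) = nint (fun x => F x - G' j x).
    by apply: eq_integral => x _; rewrite normcBC.
  rewrite (@nint_ae_eq _ _ (fun x => G j x - F x)) //; [exact: cmeasB|exact: cmeasB|].
  by move: (G'G j); apply: filterS => x /= ->.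
Qed.

Lemma L2odd_complete (u : nat -> L2odd R) :
  (forall e : R, 0 < e -> exists n0, forall m n, (n0 <= m)%N -> (n0 <= n)%N ->
     N (u m - u n) < e) ->
  exists l, (fun n => N (u n - l)) @ \oo --> (0 : R).
Proof.
move=> ucauchy; have /choice[n0 n0P] j := ucauchy (t j) (t_gt0 j).
(* A sum plays the part of a running maximum: the index p j exceeds every threshold n0 i with i <=
   j. *)
pose p j := (\sum_(i < j.+1) n0 i)%N.
have n0p i j : (i <= j)%N -> (n0 i <= p j)%N.
  by move=> ij; rewrite /p (bigD1 (Ordinal (ij : (i < j.+1)%N)))//= leq_addr.
have /choice[G GP] j : exists F, rep (u (p j)) F /\ forall x, F (- x) = - F x.
  by have [F uF Fodd] := rep_odd (u (p j)); exists F.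
have [||i j ij|F [F2 Fodd GF]] := @fast_cauchy_limit G.
- by move=> j; have [[]] := GP j.
- by move=> j x; have [_] := GP j.
- rewrite -(rep_hnormB (GP j).1 (GP i).1) lee_fin.
  by rewrite ler_pXn2r ?nnegrE ?hnorm_ge0 ?(ltW (t_gt0 _))//; apply/ltW/n0P; exact: n0p.
have [l lF] := rep_exists F2 Fodd; exists l.
have ulp j : N (u (p j) - l) <= t j.
  have := GF j; rewrite -(rep_hnormB (GP j).1 lF) lee_fin.
  by rewrite ler_pXn2r ?nnegrE ?hnorm_ge0 ?(ltW (t_gt0 _)).
apply: cvg0P => [n|e e0]; first exact: hnorm_ge0.
have e2 : 0 < e / 2 by rewrite divr_gt0.
have [j _ /(_ j (leqnn j)) /= tj] := cvg0_lt t_cvg0 e2.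
exists (p j) => // n /= pn.
apply: le_lt_trans (hnorm_triangle _ (u (p j)) _ _) _; rewrite (splitr e).
apply: ltrD; last exact: le_lt_trans (ulp j) tj.
by apply: lt_trans tj; apply: n0P; [exact: leq_trans (n0p j j _) pn|exact: n0p].
Qed.

End Completeness.

(** * Odd step functions and the embeddings *)

Section OddSteps.
Variable R : realType.
Local Notation C := R[i].
Local Notation RM := (measurableTypeR R).
Local Notation mu := (@lebesgue_measure R : {measure set RM -> \bar R}).
Local Notation N := (hnorm (@L2odd_dot R)).
Implicit Types (b c x : R).

Let ae_filter : Filter (almost_everywhere mu) := ae_filter_ringOfSetsType mu.

Lemma ge0_integralN (f : RM -> \bar R) : measurable_fun setT f ->
  (forall x, (0 <= f x)%E) -> (\int[mu]_x f (- x)%R = \int[mu]_x f x)%E.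
Proof.
move=> mf f0.
transitivity (\int[pushforward mu (-%R : RM -> RM)]_x f x)%E.
  by rewrite ge0_integral_pushforward// preimage_setT.
by apply: eq_measure_integral => //= A mA _; first [exact: lebesgue_measureN|exact/esym/lebesgue_measureN].
Qed.

Definition odd_step b x : R := Num.sg x * (`|x| < b)%R%:R.

Lemma odd_stepN b x : odd_step b (- x) = - odd_step b x.
Proof. by rewrite /odd_step sgrN normrN mulNr. Qed.

Lemma measurable_sg : measurable_fun setT (@Num.sg R : RM -> RM).
Proof.
have -> : (@Num.sg R : RM -> RM) = (\1_(`]0, +oo[%classic : set R) \- \1_(`]-oo, 0[%classic : set R)).
  apply/funext => x /=; rewrite !indicE.
  have -> : (x \in (`]0, +oo[%classic : set R)) = (0 < x) by apply/idP/idP; rewrite inE /= in_itv /= andbT.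
  have -> : (x \in (`]-oo, 0[%classic : set R)) = (x < 0) by apply/idP/idP; rewrite inE /= in_itv /=.
  by case: sgrP => _; rewrite ?subr0 ?subrr ?sub0r.
by apply: measurable_funB; exact: measurable_indic.
Qed.

Lemma measurable_odd_step b : measurable_fun setT (odd_step b : RM -> RM).
Proof.
apply: measurable_funM; first exact: measurable_sg.
have -> : (fun x : RM => (`|x| < b)%R%:R : R) = \1_(`]- b, b[%classic : set R).
  by apply/funext => x; rewrite indicE; congr (_%:R); congr nat_of_bool;
    apply/idP/idP; rewrite inE /= in_itv /= ltr_norml.
exact: measurable_indic.
Qed.

Lemma sg_sqr_ae : {ae mu, forall x, Num.sg x ^+ 2 = 1}.
Proof.
have FF := ae_filter.
exists [set 0]; split; [exact: measurable_set1|exact: lebesgue_measure_set1|].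
by move=> x /=; apply: contra_notP => /eqP x0; rewrite sqr_sg x0.
Qed.

Lemma integral_odd_stepM b c : 0 <= b -> 0 <= c ->
  \int[mu]_x (odd_step b x * odd_step c x) = 2 * Num.min b c.
Proof.
move=> b0 c0; set m := Num.min b c.
have FF := ae_filter.
rewrite /Rintegral.
have -> : (\int[mu]_x (odd_step b x * odd_step c x)%:E =
    \int[mu]_x (\1_(`]- m, m[%classic : set R) x)%:E)%E.
  apply: ae_eq_integral => //.
  - apply/measurable_EFinP; apply: measurable_funM; exact: measurable_odd_step.
  - apply/measurable_EFinP; exact: measurable_indic.
  - move: sg_sqr_ae; apply: filterS => x /= sx _; congr EFin.
    rewrite /odd_step mulrACA -expr2 sx mul1r indicE -natrM mulnb; congr (_%:R).
    by congr nat_of_bool; apply/idP/idP; rewrite inE /= in_itv /= -ltr_norml lt_min.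
rewrite integral_indic// setIT; rewrite /= lebesgue_measure_itv /= lte_fin.
have m0 : 0 <= m by rewrite le_min b0.
case: ifPn => [_|] /=; first by rewrite opprK; lra.
by rewrite -leNgt => mm; have -> : m = 0; [lra|rewrite mulr0].
Qed.

Lemma odd_step_sqint b : (fun x => (odd_step b x)%:C) \in @sqint R.
Proof.
have m : cmeas (fun x => (odd_step b x)%:C) by apply: cmeas_real; exact: measurable_odd_step.
apply/sqintP; split=> //.
apply: le_lt_trans (nint_le m (g := \1_(`]- b, b[%classic : set R)) _ _) _.
- exact: measurable_indic.
- move=> x; rewrite normc2E /= expr0n addr0 /odd_step exprMn indicE.
  have -> : (x \in (`]- b, b[%classic : set R)) = (`|x| < b).
    by apply/idP/idP; rewrite inE /= in_itv /= ltr_norml.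
  by rewrite sqr_sg; case: (_ != _); case: (_ < _); rewrite ?mul1r ?mul0r ?expr1n ?expr0n.
- rewrite integral_indic// setIT /= lebesgue_measure_itv /=; case: ifP => // _.
  by rewrite -EFinB ltry.
Qed.

Definition odd_step_L2 b : L2fun R := MkL2fun (odd_step_sqint b).

Fact odd_step_class b : L2_class (odd_step_L2 b) \in @odd_class R.
Proof.
by apply/asboolP; exists (odd_step_L2 b) => // x; rewrite /= odd_stepN rmorphN.
Qed.

Definition phi b : L2odd R := MkL2odd (odd_step_class b).

Lemma rep_phi b : rep (phi b) (fun x => (odd_step b x)%:C).
Proof. exact: (@rep_class _ _ (odd_step_L2 b)). Qed.

Lemma dot_phi b c : 0 <= b -> 0 <= c ->
  L2odd_dot (phi b) (phi c) = (2 * Num.min b c)%:C.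
Proof.
move=> b0 c0; rewrite /L2odd_dot [L2_dot _ _]L2_dot_class -integral_odd_stepM//.
rewrite /L2fun_dot /Cintegral; congr (_ +i* _).
  by apply: eq_Rintegral => x _ /=; ring.
under eq_Rintegral do rewrite /= oppr0 mulr0 mul0r addr0.
by rewrite Rintegral_cst// mul0r.
Qed.

Section Embedding.
Variable k : nat.

(* This is (2 r)^(-1/2) for r = k + 2, so that
   2 pi (l mesh) (m mesh) = pi l m / r. *)
Definition mesh : R := Num.sqrt (2 / k.+2%:R) / 2.

Lemma mesh_gt0 : 0 < mesh.
Proof. by rewrite divr_gt0// sqrtr_gt0 divr_gt0. Qed.

Definition cell (l : 'I_k.+1) : L2odd R :=
  phi (l.+2%:R * mesh) - phi (l.+1%:R * mesh).

Lemma dot_cell l m :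
  L2odd_dot (cell l) (cell m) = (2 * mesh)%:C *+ (l == m).
Proof.
have h0 := mesh_gt0.
have natM n : 0 <= n%:R * mesh by rewrite mulr_ge0// ltW.
have minM (n p : nat) : Num.min (n%:R * mesh) (p%:R * mesh) = (minn n p)%:R * mesh.
  by rewrite -minr_pMl ?ltW// -natr_min.
rewrite /cell linearBl !linearBr /= !dot_phi// !minM.
rewrite -!rmorphB -rmorphMn; congr (_%:C).
have [->|lm] := eqVneq l m.
  rewrite !minnn (minn_idPr (leqnSn _)) (minn_idPl (leqnSn _)).
  by rewrite -(natr1 m.+1) mulrb; ring.
rewrite mulr0n; have [lt_lm|lt_ml|/val_inj eq_lm] := ltngtP l m.
- have -> : minn l.+2 m.+2 = l.+2 by lia.
  have -> : minn l.+2 m.+1 = l.+2 by lia.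
  have -> : minn l.+1 m.+2 = l.+1 by lia.
  have -> : minn l.+1 m.+1 = l.+1 by lia.
  by ring.
- have -> : minn l.+2 m.+2 = m.+2 by lia.
  have -> : minn l.+2 m.+1 = m.+1 by lia.
  have -> : minn l.+1 m.+2 = m.+2 by lia.
  have -> : minn l.+1 m.+1 = m.+1 by lia.
  by ring.
- by rewrite eq_lm eqxx in lm.
Qed.

(** The norm of every cell, by [dot_cell]; dividing by it makes the cells orthonormal. *)
Let w : R := Num.sqrt (2 * mesh).

Let w_gt0 : 0 < w. Proof. by rewrite sqrtr_gt0 mulr_gt0// mesh_gt0. Qed.

Definition embed (v : 'rV[C]_k.+1) : L2odd R :=
  \sum_l (v 0 l / w%:C) *: cell l.

Fact embed_linear : linear embed.
Proof.
move=> a u v; rewrite /embed scaler_sumr -big_split /=; apply: eq_bigr => l _.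
by rewrite !mxE mulrDl scalerDl -mulrA scalerA.
Qed.

HB.instance Definition _ := GRing.isLinear.Build C 'rV[C]_k.+1 (L2odd R) *:%R
  embed embed_linear.

Lemma dot_embed u v : L2odd_dot (embed u) (embed v) = dotmx u v.
Proof.
rewrite {1}/embed linear_sumlz /= dotmxE mxE; apply: eq_bigr => l _.
rewrite linearZl_LR /= /embed linear_sumr /= (bigD1 l)//= big1 => [|m m_l]; last first.
  by rewrite linearZr_LR /= dot_cell eq_sym (negbTE m_l) mulr0.
rewrite addr0 linearZr_LR /= dot_cell eqxx mulr1n !mxE.
have -> : (v 0 l / w%:C)^*%R = (v 0 l)^*%R / w%:C.
  by rewrite rmorphM fmorphV; congr (_ / _); exact: conjc_real.
have wE : (2 * mesh)%:C = w%:C * w%:C.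
  by rewrite -rmorphM -expr2 sqr_sqrtr// mulr_ge0// ltW// mesh_gt0.
have w0 : w%:C != 0 by rewrite (inj_eq (@complexI R) _ 0) gt_eqF.
by rewrite wE; field.
Qed.

Definition embed_fun (v : 'rV[C]_k.+1) x : C :=
  \sum_l (v 0 l / w%:C) * (odd_step (l.+2%:R * mesh) x - odd_step (l.+1%:R * mesh) x)%:C.

Lemma rep0 : rep (0 : L2odd R) (fun=> 0).
Proof.
have := rep_lin (-1) (rep_phi 0) (rep_phi 0).
rewrite scaleN1r addNr; congr (rep _ _).
by apply/funext => x; rewrite mulN1r addNr.
Qed.

Lemma rep_embed v : rep (embed v) (embed_fun v).
Proof.
rewrite /embed /embed_fun; elim: (index_enum _) => [|l s IH].
  by rewrite big_nil; have := rep0; congr rep; apply/funext => x; rewrite big_nil.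
rewrite big_cons; set F := (fun x => _).
have -> : F = (fun x => (v 0 l / w%:C) *
    (odd_step (l.+2%:R * mesh) x - odd_step (l.+1%:R * mesh) x)%:C +
    \sum_(l <- s) (v 0 l / w%:C) *
      (odd_step (l.+2%:R * mesh) x - odd_step (l.+1%:R * mesh) x)%:C).
  by apply/funext => x; rewrite /F big_cons.
apply: rep_lin IH; rewrite /cell addrC.
have := rep_lin (-1) (rep_phi (l.+1%:R * mesh)) (rep_phi (l.+2%:R * mesh)).
rewrite scaleN1r; congr rep; apply/funext => x.
by rewrite mulN1r -rmorphN -rmorphD addrC.
Qed.

(** The factor w undoes the normalisation in [embed], so the embedded vector takes the value psi n
    itself on the n-th cell; coordinate l belongs to the node number l + 1. *)
Definition sample (psi : nat -> C) : 'rV[C]_k.+1 := \row_l (w%:C * psi l.+1).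

(** The odd step function equal to psi n for n mesh <= x < (n + 1) mesh. It vanishes for |x| < mesh
    and beyond the last cell. *)
Definition step_interp (psi : nat -> C) x : C :=
  let n := Num.truncn (`|x| / mesh) in
  if (0 < n <= k.+1)%N then (Num.sg x)%:C * psi n else 0.

Lemma embed_fun_sample psi x : embed_fun (sample psi) x = step_interp psi x.
Proof.
have h0 := mesh_gt0; have w0 : w%:C != 0 by rewrite (inj_eq (@complexI R) _ 0) gt_eqF.
have stepE m : odd_step (m%:R * mesh) x =
    Num.sg x * (Num.truncn (`|x| / mesh) < m)%N%:R.
  rewrite /odd_step truncn_lt_nat; last by rewrite divr_ge0// ltW.
  by rewrite ltr_pdivrMr.
rewrite /embed_fun /step_interp; move: (Num.truncn _) stepE => n stepE.
have termE (l : 'I_k.+1) : (sample psi 0 l / w%:C) *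
    (odd_step (l.+2%:R * mesh) x - odd_step (l.+1%:R * mesh) x)%:C =
    if (n == l.+1)%N then (Num.sg x)%:C * psi n else 0.
  have -> : sample psi 0 l / w%:C = psi l.+1 by rewrite mxE mulrAC divff// mul1r.
  rewrite !stepE -mulrBr [(n < l.+2)%N]ltnS.
  case: (ltngtP n l.+1) => [nl|nl|nl]; rewrite ?subrr ?mulr0//= subr0 mulr1 nl.
  exact: mulrC.
rewrite (eq_bigr _ (fun l _ => termE l)).
case: n {stepE termE} => [|n] /=; first by rewrite big1.
rewrite ltnS; case: leqP => n_k; last first.
  by rewrite big1// => l _; case: eqP => // nl; have := ltn_ord l; lia.
rewrite (bigD1 (Ordinal (n_k : (n < k.+1)%N)))//= eqxx big1 ?addr0// => l /eqP nl.
by case: eqP => // -[e]; case: nl; apply: val_inj.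
Qed.

End Embedding.
End OddSteps.

(** * Vectors sampled on the mesh and their limits *)

Section StepLimits.
Variable R : realType.
Local Notation C := R[i].
Local Notation RM := (measurableTypeR R).
Local Notation mu := (@lebesgue_measure R : {measure set RM -> \bar R}).
Local Notation N := (hnorm (@L2odd_dot R)).
Local Notation scvg := (scvg (@L2odd_dot R) (@embed R)).
Local Notation mesh := (mesh R).
Implicit Types (b c x : R).

Let ae_filter : Filter (almost_everywhere mu) := ae_filter_ringOfSetsType mu.

Lemma sqr_mesh k : mesh k ^+ 2 = (2 * k.+2%:R)^-1.
Proof.
rewrite /mesh exprMn sqr_sqrtr; last by rewrite divr_ge0.
by have : k.+2%:R != 0 :> R by []; move: k.+2%:R => q q0; field.
Qed.

Lemma mesh_le1 k : mesh k <= 1.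
Proof.
rewrite -(@ler_pXn2r _ 2) ?nnegrE ?(ltW (mesh_gt0 _ _))// sqr_mesh expr1n.
by rewrite invf_le1 ?mulr_gt0// -natrM ler1n.
Qed.

Lemma mesh_cvg0 : (fun k => mesh k) @ \oo --> (0 : R).
Proof.
apply: cvg0P => [k|e e0]; first exact/ltW/mesh_gt0.
have e2 : 0 < e ^+ 2 by rewrite exprn_gt0.
apply: (nearS _ (cvg0_lt (@cvg_harmonic R) e2)) => k /= ke.
rewrite -(@ltr_pXn2r _ 2) ?nnegrE ?(ltW (mesh_gt0 _ _))// ?(ltW e0)// sqr_mesh; apply: le_lt_trans ke.
by rewrite lef_pV2 ?posrE ?mulr_gt0// -natrM ler_nat; lia.
Qed.

Lemma mesh_range (A : R) : \forall k \near \oo, A < k.+1%:R * mesh k.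
Proof.
have [A0|A0] := leP A 0.
  by apply: nearW => k; apply: le_lt_trans A0 _; rewrite mulr_gt0// mesh_gt0.
(* Since k + 2 <= 2 (k + 1) and (k + 2) mesh^2 = 1/2, the product (k + 1) mesh is at least 1 / (4
   mesh). *)
have e0 : 0 < (4 * A)^-1 by rewrite invr_gt0 mulr_gt0.
apply: (nearS _ (cvg0_lt mesh_cvg0 e0)) => k /= mk.
have m0 := mesh_gt0 R k; have := sqr_mesh k; set m := mesh k in mk m0 *.
have k2 : 0 < k.+2%:R :> R by [].
have k12 : k.+2%:R <= 2 * k.+1%:R :> R by rewrite -natrM ler_nat; lia.
move: k.+2%:R k2 k12 => q q0 q1 mq; have mq2 : m ^+ 2 * q = 2^-1.
  by rewrite mq; field; rewrite gt_eqF.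
have mA : m * (4 * A) < 1 by rewrite -ltr_pdivlMr ?mulr_gt0// mul1r.
rewrite -(ltr_pM2r m0); move: mA mq2 q1; rewrite expr2; move: (k.+1%:R : R) => p; nra.
Qed.

Lemma sqr_EFin_cvg0 (x : nat -> R) : (forall k, 0 <= x k) ->
  (fun k => (x k ^+ 2)%:E) @ \oo --> 0%E -> x @ \oo --> (0 : R).
Proof.
move=> x0 /fine_cvgP[_ h]; apply: cvg0P => // e e0.
have e2 : 0 < e ^+ 2 by rewrite exprn_gt0.
apply: (nearS _ (cvg0_lt h e2)) => k /=.
by rewrite ltr_pXn2r ?nnegrE ?(ltW e0).
Qed.

(** Dominated convergence of the squares: strong convergence of sampled vectors is reduced to
    pointwise convergence of their step functions under one integrable majorant. *)
Lemma scvg_sample (psi : nat -> nat -> C) (F : R -> C) (g : RM -> R) :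
  cmeas F -> (forall x, F (- x) = - F x) -> measurable_fun setT g ->
  (\int[mu]_x (g x)%:E < +oo)%E ->
  (forall k x, normc (step_interp k (psi k) x) ^+ 2 <= g x) ->
  {ae mu, forall x, ccvg (fun k => step_interp k (psi k) x) (F x)} ->
  exists2 f, rep f F & scvg (fun k => sample k (psi k)) f.
Proof.
move=> mF oddF mg ig bound lim.
have rk k := rep_embed (sample k (psi k)).
have stepE k : embed_fun (sample k (psi k)) = step_interp k (psi k).
  by apply/funext => x; exact: embed_fun_sample.
have mk k : cmeas (step_interp k (psi k)).
  by have [/sqintP[]] := rk k; rewrite stepE.
have [Ffin cvgF] := nint_dominated mk mF mg ig bound lim.
have F2 : F \in @sqint R by apply/sqintP.
have [f fF] := rep_exists F2 oddF; exists f => //.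
apply: sqr_EFin_cvg0 => [k|]; first exact: hnorm_ge0.
apply: cvg_trans cvgF; apply: near_eq_cvg; apply: nearW => k /=.
by rewrite (rep_hnormB (rk k) fF) stepE.
Qed.

Definition node k x : nat := Num.truncn (`|x| / mesh k).

Lemma node_le k x : (node k x)%:R * mesh k <= `|x| < (node k x).+1%:R * mesh k.
Proof.
have m0 := mesh_gt0 R k; rewrite -ler_pdivlMr// -ltr_pdivrMr//.
by apply: truncn_itv; rewrite divr_ge0// ltW.
Qed.

Lemma node_cvg x : (fun k => (node k x)%:R * mesh k) @ \oo --> `|x|.
Proof.
apply/cvg_distP; apply: le_cvg0 mesh_cvg0 => k; rewrite normr_ge0 /=.
have /andP[h1 h2] := node_le k x; rewrite ler0_norm; last by rewrite subr_le0.
by move: h2; rewrite -natr1 mulrDl mul1r; lra.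
Qed.

Lemma node_range x : x != 0 -> \forall k \near \oo, (0 < node k x <= k.+1)%N.
Proof.
move=> x0; have ax : 0 < `|x| by rewrite normr_gt0.
apply: (nearS2 _ (cvg0_lt mesh_cvg0 ax) (mesh_range `|x|)) => k /= h1 h2.
have m0 := mesh_gt0 R k; rewrite /node truncn_gt0 ler_pdivlMr// mul1r ltW//=.
by rewrite -ltnS truncn_lt_nat ?divr_ge0 ?(ltW m0)// ltr_pdivrMr// (lt_trans h2)// ltr_pM2r// ltr_nat.
Qed.

(** Values of c Psi at the nodes up to b. The separate constant c allows for a phase that depends on
    k, as the diagonal matrix produces. *)
Definition window k b (c : C) (Psi : R -> C) (n : nat) : C :=
  if n%:R * mesh k <= b then c * Psi (n%:R * mesh k) else 0.

Lemma ae_neq_pair (a b : R) : {ae mu, forall x, x != a /\ x != b}.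
Proof.
exists ([set a] `|` [set b]); split.
- by apply: measurableU; exact: measurable_set1.
- apply: null_set_setU; [exact: measurable_set1|exact: measurable_set1| |];
    exact: lebesgue_measure_set1.
- move=> x /= /not_andP[]/negP; rewrite negbK => /eqP ->; [by left|by right].
Qed.

Lemma ccvgM (z w : nat -> C) (l m : C) : ccvg z l -> ccvg w m ->
  ccvg (fun k => z k * w k) (l * m).
Proof.
move=> zl wm.
have h : (fun k => normc (z k - l) * normc (w k - m) + (normc m * normc (z k - l)
    + normc l * normc (w k - m))) @ \oo --> (0 : R).
  apply: cvg0D; last by apply: cvg0D; exact: cvg0Z.
  by rewrite -[X in _ --> X](mul0r (0:R)); exact: cvgM.
apply: le_cvg0 h => k; rewrite normc_ge0 /= -!Normc.normcM.
have -> : z k * w k - l * m = (z k - l) * (w k - m) + (m * (z k - l) + l * (w k - m)) by ring.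
by apply: le_trans (normcD _ _) _; rewrite lerD2l normcD.
Qed.

Lemma ccvg_near (z w : nat -> C) (l : C) : (\forall k \near \oo, z k = w k) ->
  ccvg w l -> ccvg z l.
Proof.
move=> zw wl; apply: cvg0P => [k|e e0]; first exact: normc_ge0.
by apply: (nearS2 _ zw (cvg0_lt wl e0)) => k ->.
Qed.

Lemma ccvg_cst (l : C) : ccvg (fun=> l) l.
Proof. by rewrite /ccvg subrr Normc.normc0; exact: cvg_cst. Qed.

Lemma scvg_window b (c : nat -> C) (Psi : R -> C) (M : R) : 0 <= b ->
  (forall k, normc (c k) <= 1) -> ccvg c 1 -> cmeas Psi ->
  (forall x, 0 <= x -> normc (Psi x) <= M) ->
  (forall (y : nat -> R) x, y @ \oo --> x -> ccvg (fun k => Psi (y k)) (Psi x)) ->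
  exists2 f, rep f (fun x => (odd_step b x)%:C * Psi `|x|) &
    scvg (fun k => sample k (window k b (c k) Psi)) f.
Proof.
move=> b0 c1 cc mPsi PsiM Psic.
have FF := ae_filter.
have M0 : 0 <= M by apply: le_trans (PsiM 0 _); rewrite ?normc_ge0.
(* A cell carries a nonzero value only if its left end is at most b, and its width is at most 1;
   hence the interval of half-length b + 1. *)
apply: (@scvg_sample _ _ (fun x => M ^+ 2 * \1_(`]- (b + 1), b + 1[%classic : set R) x)).
- apply: cmeasM; first by apply: cmeas_real; exact: measurable_odd_step.
  have [m1 m2] := mPsi; have mn : measurable_fun setT (fun x : RM => `|x| : RM) by exact: normr_measurable.
  by split; [apply: (measurableT_comp m1)|apply: (measurableT_comp m2)].
- by move=> x; rewrite odd_stepN normrN rmorphN mulNr.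
- by apply: measurable_funM => //; exact: measurable_indic.
- under eq_integral do rewrite EFinM.
  rewrite ge0_integralZl//; first last.
  - by rewrite lee_fin sqr_ge0.
  - by apply/measurable_EFinP; exact: measurable_indic.
  rewrite integral_indic// setIT /= lebesgue_measure_itv /=.
  by case: ifP => _; rewrite ?mule0 ?ltry// -EFinB -EFinM ltry.
- move=> k x; rewrite /step_interp -/(node k x).
  have gx0 : 0 <= M ^+ 2 * (\1_(`](- (b + 1))%R, (b + 1)%R[%classic : set R) x : R).
    by rewrite mulr_ge0// ?sqr_ge0.
  case: ifP => _; last by rewrite Normc.normc0 expr0n.
  rewrite /window; case: ifP => nb; last by rewrite mulr0 Normc.normc0 expr0n.
  rewrite indicE mem_set; last first.
    rewrite /= in_itv /= -ltr_norml; have /andP[_] := node_le k x.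
    by have := mesh_le1 k; rewrite -natr1 mulrDl mul1r; lra.
  rewrite mulr1 ler_pXn2r ?nnegrE ?normc_ge0// !Normc.normcM.
  have s1 : normc (Num.sg x)%:C <= 1.
    by rewrite /= expr0n addr0 sqrtr_sqr; case: sgrP; rewrite ?normrN1 ?normr1 ?normr0.
  rewrite -[M]mul1r ler_pM ?normc_ge0 ?mulr_ge0 ?normc_ge0// -[M]mul1r.
  by rewrite ler_pM ?normc_ge0// PsiM// mulr_ge0// ltW// mesh_gt0.
(* At |x| = b the node to the left never exceeds b, so the samples do not vanish there although
   [odd_step b] does; and 0 lies in no cell. These points form a null set. *)
- have := ae_neq_pair b (- b); have := ae_neq_pair 0 0.
  apply: filterS2 => x [x0 _] [xb xNb].
  have axb : `|x| != b.
    by apply: contra xb => /eqP e; move: xNb; rewrite -e; case: (ger0P x); rewrite ?eqxx// opprK eqxx.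
  have -> : (odd_step b x)%:C * Psi `|x| =
      (Num.sg x)%:C * (1 * ((`|x| < b)%R%:R * Psi `|x|)).
    by rewrite mul1r /odd_step rmorphM rmorph_nat mulrA.
  pose z k := (Num.sg x)%:C * (c k * ((`|x| < b)%R%:R * Psi ((node k x)%:R * mesh k))).
  apply: (@ccvg_near _ z); last first.
    apply: ccvgM; first exact: ccvg_cst.
    apply: ccvgM => //; apply: ccvgM; first exact: ccvg_cst.
    by apply: Psic; exact: node_cvg.
  have d0 : 0 < `| `|x| - b| by rewrite normr_gt0 subr_eq0.
  apply: (nearS2 _ (node_range x0) (cvg0_lt mesh_cvg0 d0)) => k /= nk mk.
  rewrite /step_interp -/(node k x) nk /z; congr (_ * _); rewrite /window.
  have -> : ((node k x)%:R * mesh k <= b) = (`|x| < b).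
    have /andP[h1 h2] := node_le k x; apply/idP/idP => h; last by lra.
    rewrite lt_neqAle axb /= leNgt; apply/negP => bx; move: mk h2.
    by rewrite ger0_norm ?subr_ge0 ?ltW// -natr1 mulrDl mul1r; lra.
  by case: ifP; rewrite ?mul1r ?mul0r ?mulr0.
Qed.

End StepLimits.

(** * Estimates for the sine and for sums of sines *)

Section SineBounds.
Variable R : realType.
Implicit Types (x y z : R).

Lemma sin_mvt z : 0 <= z -> exists2 c, 0 <= c <= z & sin z = cos c * z.
Proof.
move=> z0; have [|c] := @MVT_segment R sin cos 0 z z0 (fun x _ => is_derive_sin x).
  by apply: continuous_subspaceT => x; exact: continuous_sin.
by rewrite in_itv /= sin0 !subr0 => cz ->; exists c.
Qed.

Lemma cos_le x y : 0 <= x -> x <= y -> y <= pi -> cos y <= cos x.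
Proof.
move=> x0 xy ypi; rewrite leNgt; apply/negP.
have xI : x \in `[0, pi] by rewrite in_itv /= x0 (le_trans xy).
have yI : y \in `[0, pi] by rewrite in_itv /= ypi (le_trans x0).
by rewrite (ltr_cos yI xI) ltNge xy.
Qed.

Lemma sin_ge_cos z : 0 <= z -> z <= pi -> z * cos z <= sin z.
Proof.
move=> z0 zpi; have [c /andP[c0 cz] ->] := sin_mvt z0.
by rewrite mulrC ler_wpM2r// cos_le.
Qed.

Lemma sin_le_id z : 0 <= z -> sin z <= z.
Proof.
move=> z0; have [c _ ->] := sin_mvt z0.
by rewrite -[X in _ <= X]mul1r ler_wpM2r// cos_le1.
Qed.

(** With y = 2 z, the condition cos y >= 0 says 2 cos^2 z >= 1, so sin y = 2 sin z cos z >= 2 z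
    cos^2 z >= z. *)
Lemma sin_ge_half y : 0 <= y -> y <= pi / 2 -> y / 2 <= sin y.
Proof.
move=> y0 ypi; have pi0 := pi_gt0 R.
have cy : 0 <= cos y by apply: cos_ge0_pihalf; lra.
set z := y / 2; have zE : y = z *+ 2 by rewrite /z -mulr_natr; field.
have zs : z * cos z <= sin z by apply: sin_ge_cos; rewrite /z; lra.
have c0 : 0 <= cos z by apply: cos_ge0_pihalf; rewrite /z; lra.
have z0 : 0 <= z by rewrite /z; lra.
rewrite zE cos_mulr2n subr_ge0 in cy; rewrite zE sin_mulr2n.
have h1 : z * 1 <= z * (cos z ^+ 2 *+ 2) by rewrite ler_wpM2l.
have h2 : cos z * (z * cos z) <= cos z * sin z by rewrite ler_wpM2l.
move: h1 h2; rewrite !mulr2n expr2; lra.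
Qed.

Lemma sinc_cvg (z : nat -> R) : (forall k, 0 <= z k) -> (\forall k \near \oo, 0 < z k) ->
  z @ \oo --> (0 : R) -> (fun k => z k / sin (z k)) @ \oo --> (1 : R).
Proof.
move=> z_ge0 zpos z0.
have h : (fun k => sin (z k) / z k) @ \oo --> (1 : R).
  have c1 : (fun k => cos (z k)) @ \oo --> (1 : R).
    by rewrite -cos0; exact: (cvg_comp _ _ z0 (@continuous_cos R 0)).
  have cst1 : (fun _ : nat => (1 : R)) @ \oo --> (1 : R) by exact: cvg_cst.
  apply: (squeeze_cvgr _ c1 cst1); apply: (nearS2 _ zpos (cvg0_lt z0 (pi_gt0 R))) => k /= zk zpi.
  by rewrite ler_pdivlMr// ler_pdivrMr// mul1r mulrC sin_ge_cos ?sin_le_id// ltW.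
have -> : (fun k => z k / sin (z k)) = (fun k => (sin (z k) / z k)^-1).
  by apply/funext => k; rewrite invf_div.
by rewrite -[X in _ --> X]invr1; apply: cvgV h; exact: oner_neq0.
Qed.

Lemma cvg_near_eq (u v : nat -> R) (l : R) : (\forall k \near \oo, u k = v k) ->
  v @ \oo --> l -> u @ \oo --> l.
Proof.
move=> uv /cvg_distP vl; apply/cvg_distP; apply: cvg0P => // e e0.
by apply: (nearS2 _ uv (cvg0_lt vl e0)) => k ->.
Qed.

(** Telescoping of 2 sin (t/2) sin (j t) = cos ((j - 1/2) t) - cos ((j + 1/2) t). *)
Lemma sine_sum_closed (t : R) (m : nat) :
  2 * sin (t / 2) * \sum_(j < m) sin (j.+1%:R * t) = cos (t / 2) - cos ((m%:R + 2^-1) * t).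
Proof.
elim: m => [|m IH]; first by rewrite big_ord0 mulr0 add0r mulrC subrr.
rewrite big_ord_recr /= mulrDr IH.
have -> : (m%:R + 2^-1) * t = m.+1%:R * t - t / 2 by rewrite -natr1; field.
have -> : (m.+1%:R + 2^-1) * t = m.+1%:R * t + t / 2 by field.
by rewrite cosB cosD; ring.
Qed.

Lemma integral_oneDsqr_fin : (\int[@lebesgue_measure R]_x ((1 + x ^+ 2)^-1)%:E < +oo)%E.
Proof.
rewrite (ge0_symfun_integralT (f := fun x : R => (1 + x ^+ 2)^-1)).
- have -> : [set x : R | 0 <= x] = `[0, +oo[%classic.
    by apply/seteqP; split => x /=; rewrite in_itv /= andbT.
  by rewrite [X in (_ * X)%E]integral0y_oneDsqr -EFinM ltry.
- by move=> x; rewrite invr_ge0 addr_ge0// sqr_ge0.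
- exact: continuous_oneDsqrV.
- by move=> x /=; rewrite sqrrN.
Qed.

End SineBounds.

(** * Images of the sampled odd steps under the two matrices *)

Section SineLimit.
Variable R : realType.
Local Notation C := R[i].
Local Notation RM := (measurableTypeR R).
Local Notation mu := (@lebesgue_measure R : {measure set RM -> \bar R}).
Local Notation scvg := (scvg (@L2odd_dot R) (@embed R)).
Local Notation mesh := (mesh R).
Local Notation node := (@node R).
Variable b : R.
Hypothesis b0 : 0 <= b.

Definition box k : 'rV[C]_k.+1 := sample k (window k b 1 (fun=> 1)).

Lemma scvg_box : scvg box (phi b).
Proof.
have [|||||f f_rep f_cvg] := @scvg_window R b (fun=> 1) (fun=> 1) 1 b0.
- by move=> k; rewrite Normc.normc1.
- exact: ccvg_cst.
- exact: cmeas_cst.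
- by move=> x _; rewrite Normc.normc1.
- by move=> y x _; exact: ccvg_cst.
suff -> : phi b = f by [].
by apply: (rep_inj (rep_phi b)); under eq_fun do rewrite -[_%:C]mulr1.
Qed.

(** Since l (l + 2) = (l + 1)^2 - 1 and mesh^2 = 1 / (2 r), the diagonal entry is the chirp at the
    node times exp (pi i mesh^2), a phase that tends to 1. *)
Lemma box_theta k : box k *m theta_mx R k =
  sample k (window k b (expi (pi * mesh k ^+ 2)) (fun x => expi (- (pi * x ^+ 2)))).
Proof.
apply/rowP => l; rewrite !mxE (bigD1 l)//= big1 ?addr0; last first.
  by move=> m /negbTE m_l; rewrite !mxE m_l mulr0n mulr0.
rewrite !mxE eqxx mulr1n /window; case: ifP => _; last by rewrite !mulr0 mul0r.
rewrite !mulr1 -expiD; congr (_ * expi _). rewrite (exprMn 2 _ (mesh k)) !sqr_mesh.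
have k2 : (k.+2%:R : R) != 0 by rewrite pnatr_eq0.
have -> : l.+2%:R = l%:R + 2 :> R by rewrite -[l.+2]addn2 natrD.
have -> : l.+1%:R = l%:R + 1 :> R by rewrite natr1.
by move: k.+2%:R k2 => q q0; field.
Qed.

Lemma ccvg_expi (y : nat -> R) (x : R) : y @ \oo --> x ->
  ccvg (fun k => expi (y k)) (expi x).
Proof.
move=> yx.
have c : (fun k => cos (y k)) @ \oo --> cos x.
  exact: (cvg_comp _ _ yx (@continuous_cos R x)).
have s : (fun k => sin (y k)) @ \oo --> sin x.
  exact: (cvg_comp _ _ yx (@continuous_sin R x)).
move: c s => /cvg_distP c /cvg_distP s.
by apply: le_cvg0 (cvg0D c s) => k; apply/andP; split; [exact: normc_ge0|exact: normc_le_ReIm].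
Qed.

Lemma scvg_box_theta : exists2 f,
  rep f (fun x => (odd_step b x)%:C * expi (- (pi * x ^+ 2))) &
  scvg (fun k => box k *m theta_mx R k) f.
Proof.
have [|||||f f_rep f_cvg] := @scvg_window R b (fun k => expi (pi * mesh k ^+ 2))
    (fun x => expi (- (pi * x ^+ 2))) 1 b0.
- by move=> k; rewrite normc_expi.
- rewrite -expi0; apply: ccvg_expi.
  apply: cvg0Z; rewrite -[X in _ --> X](mul0r (0:R)).
  by apply: cvgM; exact: mesh_cvg0.
- have mx : measurable_fun setT (fun x : RM => - (pi * x ^+ 2) : RM).
    by apply: measurable_funN; apply: measurable_funM => //; exact: measurable_funX.
  split; apply: (measurableT_comp _ mx); apply: continuous_measurable_fun.
    exact: continuous_cos.
  exact: continuous_sin.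
- by move=> x _; rewrite normc_expi.
- move=> y x yx; apply: ccvg_expi; apply: cvgN; apply: cvgZr; exact: (cvgM yx yx).
exists f.
  by move: f_rep; congr rep; apply/funext => x; rewrite real_normK// num_real.
by apply: le_cvg0 f_cvg => k; rewrite box_theta hnorm_ge0 lexx.
Qed.

(** The Riemann sum of 2 sin (2 pi x y) over 0 < y <= b at x = n mesh, with the nodes (j + 1) mesh;
    the minimum is there because only k + 1 nodes exist. *)
Definition sine_sum k (n : nat) : R := 2 * mesh k *
  \sum_(j < minn (node k b) k.+1) sin (j.+1%:R * (2 * pi * n%:R * mesh k ^+ 2)).

Lemma box_sine k : box k *m sine_mx R k = sample k (fun n => (sine_sum k n)%:C).
Proof.
have m0 := mesh_gt0 R k.
have h2 : Num.sqrt (2 / k.+2%:R) = 2 * mesh k by rewrite /mesh; field.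
apply/rowP => l; rewrite !mxE /sine_sum rmorphM mulrA [RHS]mulrC rmorph_sum /= mulr_suml.
rewrite (big_ord_widen k.+1 (fun j => (sin (j.+1%:R * (2 * pi * l.+1%:R * mesh k ^+ 2)))%:C *
  _)) ?geq_minr//= [RHS]big_mkcond. apply: eq_bigr => j _.
rewrite !mxE /window h2.
have -> : (j.+1%:R * mesh k <= b) = (j < minn (node k b) k.+1)%N.
  rewrite leq_min ltn_ord andbT /node ger0_norm// truncn_ge_nat ?divr_ge0 ?(ltW m0)//.
  by rewrite ler_pdivlMr.
case: ifP => _; last by rewrite mulr0 mul0r.
rewrite !mulr1 [RHS]mulrC -[RHS]mulrA; congr (_ * _); rewrite -[RHS]rmorphM; congr (_%:C); congr (_ * sin _).
rewrite sqr_mesh; have k2 : (k.+2%:R : R) != 0 by rewrite pnatr_eq0.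
by move: k.+2%:R k2 => q q0; field.
Qed.

Lemma sine_sum_le k n : `|sine_sum k n| <= 2 * b.
Proof.
have m0 := mesh_gt0 R k.
rewrite /sine_sum normrM ger0_norm ?mulr_ge0 ?(ltW m0)// -[X in X <= _]mulrA ler_pM2l//.
apply: le_trans (_ : mesh k * (node k b)%:R <= b); last first.
  by rewrite mulrC; have /andP[] := node_le k b; rewrite ger0_norm.
rewrite ler_pM2l//; apply: le_trans (ler_norm_sum _ _ _) _.
apply: le_trans (_ : \sum_(j < minn (node k b) k.+1) 1 <= _).
  by apply: ler_sum => j _; rewrite ler_norml sin_geN1 sin_le1.
by rewrite sumr_const card_ord ler_nat geq_minl.
Qed.

(** The closed form bounds sin (t/2) |S| by 1, where t = 2 pi n mesh^2 and S is the sum of sines. As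
    n mesh^2 <= 1/2, the angle t/2 stays in [0, pi/2], where sin (t/2) >= t/4. The resulting decay
    like 1 / x is what provides a square-integrable majorant uniform in k. *)
Lemma sine_sum_decay k n : (0 < n <= k.+1)%N -> `|sine_sum k n| * (n%:R * mesh k) <= 4.
Proof.
move=> /andP[n0 nk]; have m0 := mesh_gt0 R k; have pi0 := pi_gt0 R; have pi2 := pi_ge2 R.
rewrite /sine_sum; set t := 2 * pi * n%:R * mesh k ^+ 2; set S := \sum_(_ < _) _.
have nR : 0 < n%:R :> R by rewrite ltr0n.
have nm : n%:R * mesh k ^+ 2 <= 2^-1.
  rewrite sqr_mesh ler_pdivrMr ?mulr_gt0//.
  have : n%:R <= k.+2%:R :> R by rewrite ler_nat; lia.
  by move: (n%:R : R) (k.+2%:R : R) => u v uv; lra.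
have t0 : 0 < t by rewrite /t !mulr_gt0// exprn_gt0.
have t2 : t / 2 <= pi / 2.
  have : pi * (n%:R * mesh k ^+ 2) <= pi * 2^-1 by rewrite ler_wpM2l// ltW.
  by rewrite /t; lra.
have st : t / 2 / 2 <= sin (t / 2) by apply: sin_ge_half => //; lra.
have D : `|2 * sin (t / 2) * S| <= 2.
  rewrite sine_sum_closed; apply: le_trans (ler_normB _ _) _.
  by rewrite -[X in _ <= X]/(1 + 1) lerD// ler_norml cos_geN1 cos_le1.
have s0 : 0 < sin (t / 2) by lra.
have two0 : `|2| = 2 :> R by rewrite ger0_norm.
rewrite !normrM (gtr0_norm s0) two0 in D; rewrite (normrM (2 * mesh k)) (normrM 2) (gtr0_norm m0) two0.
have S0 := normr_ge0 S; move: D st; rewrite /t; move: (sin _) (`|S|) S0 s0 => s a a0 s0 D st.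
have : pi * n%:R * mesh k ^+ 2 / 2 * a <= s * a by apply: ler_wpM2r => //; lra.
have : 2 * (n%:R * mesh k ^+ 2 * a) <= pi * (n%:R * mesh k ^+ 2 * a).
  by apply: ler_wpM2r => //; rewrite !mulr_ge0// ?exprn_ge0 ?ltW.
by rewrite expr2; lra.
Qed.

(** With p and q the nodes below |x| and b, and z = pi mesh p, the closed form reads (z / sin z)
    (cos z - cos (2 pi p (q + mesh / 2))) / (pi p), and z tends to 0. *)
Lemma sine_sum_cvg x : x != 0 ->
  (fun k => sine_sum k (node k x)) @ \oo --> (1 - cos (2 * pi * b * `|x|)) / (pi * `|x|).
Proof.
move=> x0; have ax : 0 < `|x| by rewrite normr_gt0.
have pi0 := pi_gt0 R.
pose p k := (node k x)%:R * mesh k; pose z k := pi * (mesh k * p k).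
pose q k := (node k b)%:R * mesh k.
have pc : p @ \oo --> `|x| by exact: node_cvg.
have qc : q @ \oo --> b by rewrite -[X in _ --> X](ger0_norm b0); exact: node_cvg.
have zc : z @ \oo --> (0 : R).
  apply: cvg0Z; rewrite -[X in _ --> X](mul0r `|x|); apply: cvgM pc; exact: mesh_cvg0.
have z0 k : 0 <= z k by rewrite !mulr_ge0// ltW// mesh_gt0.
have range := node_range x0.
have zpos : \forall k \near \oo, 0 < z k.
  apply: (nearS _ range) => k /andP[n0 _].
  by rewrite /z /p !mulr_gt0// ?mesh_gt0// ltr0n.
have sc := sinc_cvg z0 zpos zc.
have Dc : (fun k => cos (z k) - cos (2 * pi * (p k * (q k + mesh k / 2)))) @ \oo -->
    (1 - cos (2 * pi * b * `|x|)).
  apply: cvgB; first by rewrite -cos0; exact: (cvg_comp _ _ zc (@continuous_cos R 0)).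
  apply: (cvg_comp _ cos _ (@continuous_cos R _)).
  have -> : 2 * pi * b * `|x| = 2 * pi * (`|x| * (b + 0 / 2)) by ring.
  apply: cvgZr; apply: cvgM => //; apply: cvgD => //.
  by apply: cvgM; [exact: mesh_cvg0|exact: cvg_cst].
have piax : pi * `|x| != 0 by rewrite mulf_neq0// gt_eqF.
have Pc : (fun k => (pi * p k)^-1) @ \oo --> (pi * `|x|)^-1 by apply: cvgV => //; exact: cvgZr.
have := cvgM (cvgM sc Dc) Pc; rewrite mul1r => lim.
pose v k := z k / sin (z k) * (cos (z k) - cos (2 * pi * (p k * (q k + mesh k / 2)))) *
  (pi * p k)^-1.
apply: (@cvg_near_eq _ _ v); last exact: lim.
have mb := mesh_range b; have near1 := nearI range mb.
apply: (nearS2 _ near1 (nearI zpos (cvg0_lt zc pi0))) => k [/andP[n0 nk] bk] [zk zpi].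
have m0 := mesh_gt0 R k.
have Mk : minn (node k b) k.+1 = node k b.
  apply/minn_idPl/ltnW; rewrite -(ltr_nat R) -(ltr_pM2r m0).
  by apply: le_lt_trans bk; have /andP[] := node_le k b; rewrite ger0_norm.
have sz : 0 < sin (z k) by apply: sin_gt0_pi; rewrite zk.
have p0 : 0 < p k by rewrite /p mulr_gt0// ltr0n.
rewrite /sine_sum Mk.
have := sine_sum_closed (2 * pi * (node k x)%:R * mesh k ^+ 2) (node k b).
set S := \sum_(_ < _) _.
have -> : 2 * pi * (node k x)%:R * mesh k ^+ 2 / 2 = z k by rewrite /z /p; field.
have -> : ((node k b)%:R + 2^-1) * (2 * pi * (node k x)%:R * mesh k ^+ 2) =
    2 * pi * (p k * (q k + mesh k / 2)) by rewrite /p /q; field.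
rewrite /v => <-; rewrite {1}/z; have zn := lt0r_neq0 sz; have pn := lt0r_neq0 p0.
have alg (a m c s T : R) : a != 0 -> c != 0 -> s != 0 ->
    2 * m * T = a * (m * c) / s * (2 * s * T) * (a * c)^-1.
  by move=> an cn sn; field; rewrite sn cn an.
exact: alg (lt0r_neq0 pi0) pn zn.
Qed.

(** The sine transform of [odd_step b]. At x = 0 division by zero yields 0, which is the correct
    value. *)
Definition sine_tf x : R := (1 - cos (2 * pi * b * x)) / (pi * x).

Lemma sine_tf_abs x : sine_tf x = Num.sg x * ((1 - cos (2 * pi * b * `|x|)) / (pi * `|x|)).
Proof.
rewrite /sine_tf; case: (sgrP x) => [->|x0|x0].
- by rewrite [pi * 0]mulr0 invr0 mulr0 mul0r.
- by rewrite mul1r.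
- by rewrite !mulrN cosN invrN !mulrN mulN1r opprK.
Qed.

Lemma scvg_box_sine : exists2 f, rep f (fun x => (sine_tf x)%:C) &
  scvg (fun k => box k *m sine_mx R k) f.
Proof.
(* Here 4 b^2 bounds s^2 by [sine_sum_le], and 64 = 8^2 bounds s^2 x^2: on the n-th cell |x| <= 2 n
   mesh, and [sine_sum_decay] gives 4. Together s^2 (1 + x^2) <= K. *)
pose K : R := 4 * b ^+ 2 + 64.
have lim x : ccvg (fun k => step_interp k (fun n => (sine_sum k n)%:C) x) (sine_tf x)%:C.
  rewrite sine_tf_abs; have [->|x0] := eqVneq x 0.
    rewrite sgr0 mul0r; apply: (@ccvg_near _ _ (fun=> 0)); last exact: ccvg_cst.
    by apply: nearW => k; rewrite /step_interp sgr0 mul0r; case: ifP.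
  pose w k : C := (Num.sg x)%:C * (sine_sum k (node k x))%:C.
  apply: (@ccvg_near _ _ w).
    by apply: (nearS _ (node_range x0)) => k nk; rewrite /step_interp -/(node k x) nk.
  rewrite rmorphM; apply: ccvgM; first exact: ccvg_cst.
  have /cvg_distP h := sine_sum_cvg x0; apply: le_cvg0 h => k.
  apply/andP; split; first exact: normc_ge0.
  by rewrite -rmorphB /= expr0n addr0 sqrtr_sqr.
have [||||||f f_rep f_cvg] := @scvg_sample R (fun k n => (sine_sum k n)%:C)
    (fun x => (sine_tf x)%:C) (fun x => K * (1 + x ^+ 2)^-1).
- apply: cmeas_limit lim => k.
  have [/sqintP[h _] _] := rep_embed (sample k (fun n => (sine_sum k n)%:C)).
  by move: h; congr cmeas; apply/funext => x; exact: embed_fun_sample.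
- by move=> x; rewrite /sine_tf !mulrN cosN invrN mulrN rmorphN.
- apply: measurable_funM => //; apply: continuous_measurable_fun; exact: continuous_oneDsqrV.
- under eq_integral do rewrite EFinM.
  rewrite ge0_integralZl//; first last.
  + by rewrite lee_fin addr_ge0// mulr_ge0// sqr_ge0.
  + by move=> x _; rewrite lee_fin invr_ge0 addr_ge0// sqr_ge0.
  + by apply/measurable_EFinP; apply: continuous_measurable_fun; exact: continuous_oneDsqrV.
  by rewrite lte_mul_pinfty ?integral_oneDsqr_fin// lee_fin addr_ge0// mulr_ge0// sqr_ge0.
- move=> k x; have d0 : 0 < 1 + x ^+ 2 by rewrite ltr_wpDr// sqr_ge0.
  rewrite ler_pdivlMr// /step_interp -/(node k x).
  have K0 : 0 <= K by rewrite addr_ge0// mulr_ge0// sqr_ge0.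
  case: ifP => nk; last by rewrite Normc.normc0 expr0n mul0r.
  rewrite -rmorphM /= expr0n addr0 sqrtr_sqr real_normK ?num_real// exprMn.
  have h1 := sine_sum_le k (node k x); have h2 := sine_sum_decay nk.
  have /andP[_ h3] := node_le k x; have m0 := mesh_gt0 R k.
  have h4 : `|x| <= 2 * ((node k x)%:R * mesh k).
    apply: le_trans (ltW h3) _; rewrite -natr1 mulrDl mul1r mulr2n mulrDl mul1r lerD2l.
    by rewrite ler_peMl ?(ltW m0)// ler1n; case/andP: nk.
  have sg1 : Num.sg x ^+ 2 <= 1 by rewrite sqr_sg; case: (_ != _).
  have s2 : sine_sum k (node k x) ^+ 2 = `|sine_sum k (node k x)| ^+ 2.
    by rewrite real_normK// num_real.
  have x2 : x ^+ 2 = `|x| ^+ 2 by rewrite real_normK// num_real.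
  apply: le_trans (_ : sine_sum k (node k x) ^+ 2 * (1 + x ^+ 2) <= _).
    by rewrite ler_wpM2r ?(ltW d0)// ler_piMl ?sqr_ge0.
  rewrite s2 x2 mulrDr mulr1 -exprMn; apply: lerD.
    have -> : 4 * b ^+ 2 = (2 * b) ^+ 2 by ring.
    by rewrite ler_pXn2r ?nnegrE ?mulr_ge0.
  have -> : 64 = 8 ^+ 2 :> R by ring.
  rewrite ler_pXn2r ?nnegrE ?mulr_ge0//.
  have := ler_wpM2l (normr_ge0 (sine_sum k (node k x))) h4; lra.
- by apply: aeW => x; exact: lim.
exists f; first exact: f_rep.
by apply: le_cvg0 f_cvg => k; rewrite box_sine hnorm_ge0 lexx.
Qed.

End SineLimit.

(** * Density of the odd steps *)

Section Density.
Variable R : realType.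
Local Notation C := R[i].
Local Notation RM := (measurableTypeR R).
Local Notation mu := (@lebesgue_measure R : {measure set RM -> \bar R}).
Local Notation N := (hnorm (@L2odd_dot R)).

Let ae_filter : Filter (almost_everywhere mu) := ae_filter_ringOfSetsType mu.

Section Clip.
Variable M : R.
Hypothesis M0 : 0 <= M.

(** The nearest point to y in [-M, M]; the formula with absolute values makes continuity and oddness
    immediate. *)
Definition clip (y : R) : R := (`|y + M| - `|y - M|) / 2.

Lemma clip_bound y : `|clip y| <= M.
Proof.
by rewrite /clip ler_norml; case: (ger0P (y + M)); case: (ger0P (y - M)) => h1 h2;
  apply/andP; split; move: M0; lra.
Qed.

Lemma clip_lipschitz u y : `|u| <= M -> `|u - clip y| <= `|u - y|.
Proof.
rewrite /clip ler_norml => /andP[u1 u2].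
have h1 := ler_norm (u - y); have h2 := ler_norm (y - u); rewrite distrC in h2.
by rewrite ler_norml; case: (ger0P (y + M)); case: (ger0P (y - M)) => h3 h4;
  apply/andP; split; move: M0; lra.
Qed.

Lemma clip_le y : `|clip y| <= `|y|.
Proof.
have h1 := ler_norm y; have h2 := ler_norm (- y); rewrite normrN in h2.
by rewrite /clip ler_norml; case: (ger0P (y + M)); case: (ger0P (y - M)) => h3 h4;
  apply/andP; split; move: M0; lra.
Qed.

Lemma clip_id y : `|y| <= M -> clip y = y.
Proof.
rewrite ler_norml => /andP[h1 h2]; rewrite /clip ger0_norm; last by lra.
by rewrite ler0_norm; [field|lra].
Qed.

Lemma clipN y : clip (- y) = - clip y.
Proof. by rewrite /clip -(normrN (- y + M)) -(normrN (- y - M)) !opprD !opprK; field. Qed.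

Lemma continuous_clip : continuous clip.
Proof.
move=> x; apply: cvgM; last exact: cvg_cst.
by apply: cvgB; apply: cvg_norm; [apply: cvgD|apply: cvgB] => //; exact: cvg_cst.
Qed.
End Clip.

Variable P : L2odd R -> Prop.
Hypothesis Plin : forall a u v, P u -> P v -> P (a *: u + v).
Hypothesis Pphi : forall b : R, 0 <= b -> P (phi b).

Let P0 : P 0.
Proof. by have := Plin (-1) (Pphi (lexx 0)) (Pphi (lexx 0)); rewrite scaleN1r addNr. Qed.

Let Pembed k v : P (@embed R k v).
Proof.
rewrite /embed; elim: (index_enum _) => [|l s IH]; rewrite ?big_nil ?big_cons//.
have m0 := mesh_gt0 R k.
have Pcell : P (cell R l).
  rewrite /cell addrC -scaleN1r.
  by apply: Plin; apply: Pphi; rewrite mulr_ge0// ltW.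
exact: Plin.
Qed.

(** The closure of P. With P an arbitrary linear condition that holds on the odd steps, the same
    density argument serves for the existence of convergent sequences and for both identifications
    of the limit operators. *)
Definition approx (f : L2odd R) := forall e : R, 0 < e -> exists2 psi, P psi & N (f - psi) < e.

Lemma approx_limit (f : L2odd R) : (forall e : R, 0 < e -> exists2 g, approx g & N (f - g) < e) ->
  approx f.
Proof.
move=> h e e0; have e2 : 0 < e / 2 by rewrite divr_gt0.
have [g gP fg] := h _ e2; have [psi psiP gpsi] := gP _ e2; exists psi => //.
apply: le_lt_trans (hnorm_triangle _ g _ _) _; rewrite (splitr e).
exact: ltrD.
Qed.

Lemma approx_lin (a : C) f g : approx f -> approx g -> approx (a *: f + g).
Proof.
move=> fP gP e e0.
pose d := e / (2 * (normc a + 1)).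
have a1 : 0 < normc a + 1 by rewrite ltr_wpDl ?normc_ge0.
have d0 : 0 < d by rewrite divr_gt0 ?mulr_gt0.
have e2 : 0 < e / 2 by rewrite divr_gt0.
have [p pP fp] := fP _ d0; have [q qP gq] := gP _ e2.
exists (a *: p + q); first exact: Plin.
rewrite opprD addrACA -scalerBr.
have hz : N (a *: (f - p)) = normc a * N (f - p) := hnormZ (@L2odd_dot R) a (f - p).
apply: le_lt_trans (hnorm_leD _ _ _) _; rewrite hz (splitr e); apply: ler_ltD gq.
have <- : (normc a + 1) * d = e / 2 by rewrite /d; field; rewrite gt_eqF.
apply: le_trans (_ : normc a * d <= _); first by rewrite ler_wpM2l ?normc_ge0// ltW.
by rewrite ler_wpM2r ?(ltW d0)// lerDl.
Qed.

Lemma approx_scvg v f : scvg (@L2odd_dot R) (@embed R) v f -> approx f.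
Proof.
move=> vf e e0; have [k _ /(_ k (leqnn k)) /= h] := cvg0_lt vf e0.
by exists (embed (v k)) => //; rewrite hnormBC.
Qed.

Lemma approx_nint f F (G_ : nat -> R -> C) : rep f F ->
  (forall n, exists2 g, rep g (G_ n) & approx g) ->
  (fun n => nint (fun x => G_ n x - F x)) @ \oo --> 0%E -> approx f.
Proof.
move=> fF Gg GF; apply: approx_limit => e e0.
have [g_ gP] := choice (fun n => let: ex_intro2 g h1 h2 := Gg n in ex_intro _ g (conj h1 h2)).
have h : (fun n => N (g_ n - f)) @ \oo --> (0 : R).
  apply: sqr_EFin_cvg0 => [k|]; first exact: hnorm_ge0.
  apply: cvg_trans GF; apply: near_eq_cvg; apply: nearW => k /=.
  by rewrite (rep_hnormB (gP k).1 fF).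
have [k _ /(_ k (leqnn k)) /= hk] := cvg0_lt h e0.
by exists (g_ k); [exact: (gP k).2|rewrite hnormBC].
Qed.

(* An approximation of u in L^1 by continuous functions that are odd and
   bounded by M is one in L^2, because |v - u|^2 <= 2 M |v - u|. *)
Lemma approx_bounded (u : RM -> R) (M b : R) f : 0 <= M -> 0 <= b ->
  measurable_fun setT u -> (forall x, u (- x) = - u x) ->
  (forall x, `|u x| <= M) -> (forall x, b <= `|x| -> u x = 0) ->
  rep f (fun x => (u x)%:C) -> approx f.
Proof.
move=> M0 b0 mu_ uN uM ub fu; have FF := ae_filter.
pose E : set RM := `[- b, b]%classic.
have mE : measurable E by exact: measurable_itv.
have muE : (mu E < +oo)%E.
  by rewrite /= lebesgue_measure_itv /=; case: ifP => _; rewrite -?EFinB ltry.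
have ui : mu.-integrable E (EFin \o u).
  apply: measurable_bounded_integrable => //; first exact: measurable_funTS.
  by exists M; split; rewrite ?num_real// => y My x _; apply: le_trans (uM x) (ltW My).
have [g [gc gi gu]] := approximation_continuous_integrable mE muE ui.
(* Clipping and antisymmetrisation restore the bound and the oddness of u. The new error at x is at
   most the mean of the old errors at x and -x. *)
pose go n x := (clip M (g n x) - clip M (g n (- x))) / 2.
pose dif n x := `|u x - g n x| * \1_E x.
have mg n : measurable_fun setT (g n : RM -> RM) by apply: continuous_measurable_fun.
have mdif n : measurable_fun setT (dif n : RM -> RM).
  apply: measurable_funM; last exact: measurable_indic.
  exact: (measurableT_comp (@normr_measurable R setT) (measurable_funB mu_ (mg n))).
have difE n : (\int[mu]_x (dif n x)%:E = \int[mu]_(z in E) `|(u z - g n z)%:E|)%E.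
  rewrite [RHS]integral_mkcond; apply: eq_integral => x _.
  rewrite patchE /dif indicE; by case: ifP => _ /=; rewrite ?mulr1 ?mulr0.
have clipc : continuous (clip M) := @continuous_clip M.
have goc n : continuous (go n).
  move=> x.
  have c1 : (fun y => clip M (g n y)) @ x --> clip M (g n x).
    exact: (continuous_comp (gc n x) (clipc (g n x))).
  have cN : (fun y : R => g n (- y)) @ x --> g n (- x).
    by apply: (@continuous_comp _ _ _ (fun y : R => - y) (g n)); [exact: continuousN|exact: gc].
  have c2 : (fun y => clip M (g n (- y))) @ x --> clip M (g n (- x)).
    exact: (@continuous_comp _ _ _ (fun y : R => g n (- y)) (clip M) x cN (clipc (g n (- x)))).
  by apply: cvgM; [exact: cvgB c1 c2|exact: cvg_cst].
have gob n x : `|go n x| <= M.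
  rewrite /go normrM [`|2^-1|]ger0_norm ?invr_ge0// ler_pdivrMr//.
  apply: le_trans (ler_normB _ _) _.
  have b1 := clip_bound M0 (g n x); have b2 := clip_bound M0 (g n (- x)).
  by rewrite mulr_natr mulr2n; exact: lerD.
have goN n x : go n (- x) = - go n x by rewrite /go opprK; field.
(* This is the form that [scvg_window] treats: the odd step supplies both the sign and the cutoff at
   b, and inside the cutoff G agrees with the odd function go. *)
pose G n x : C := (odd_step b x)%:C * (go n `|x|)%:C.
apply: (@approx_nint _ _ G fu).
  move=> n.
  have [|||||h h_rep h_cvg] := @scvg_window R b (fun=> 1) (fun x => (go n x)%:C) M b0.
  - by move=> k; rewrite Normc.normc1.
  - exact: ccvg_cst.
  - by apply: cmeas_real; exact: continuous_measurable_fun.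
  - by move=> x _; rewrite /= expr0n addr0 sqrtr_sqr.
  - move=> y x yx; have /cvg_distP h : (fun k => go n (y k)) @ \oo --> go n x.
      exact: (cvg_comp _ _ yx (goc n x)).
    apply: le_cvg0 h => k; apply/andP; split; first exact: normc_ge0.
    by rewrite -rmorphB /= expr0n addr0 sqrtr_sqr.
  - by exists h => //; exact: approx_scvg h_cvg.
have Gm n : cmeas (G n).
  apply: cmeasM; apply: cmeas_real; first exact: measurable_odd_step.
  apply: (measurableT_comp (f := go n : RM -> RM)); first exact: continuous_measurable_fun.
  exact: normr_measurable.
have um : cmeas (fun x => (u x)%:C) by exact: cmeas_real.
have bound n x : normc (G n x - (u x)%:C) ^+ 2 <= M * (dif n x + dif n (- x)).
  have dif0 y : 0 <= dif n y by rewrite mulr_ge0.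
  have rhs0 : 0 <= M * (dif n x + dif n (- x)) by rewrite mulr_ge0// addr_ge0.
  rewrite /G -rmorphM -rmorphB /= expr0n addr0 sqrtr_sqr real_normK ?num_real//.
  have [bx|xb] := leP b `|x|.
    by rewrite ub// subr0 /odd_step ltNge bx mulr0 mul0r expr0n.
  have -> : odd_step b x * go n `|x| = go n x.
    rewrite /odd_step xb mulr1; case: (sgrP x) => [->|x0|x0].
    - by rewrite mul0r /go oppr0 subrr mul0r.
    - by rewrite mul1r.
    - by rewrite goN mulN1r opprK.
  have xE : x \in E by rewrite inE /E /= in_itv /= -ler_norml ltW.
  have xNE : - x \in E by rewrite inE /E /= in_itv /= -ler_norml normrN ltW.
  have h1 := @clip_lipschitz M M0 (u x) (g n x) (uM x).
  have h2 := @clip_lipschitz M M0 (u (- x)) (g n (- x)) (uM (- x)).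
  rewrite /dif !indicE xE xNE !mulr1.
  have d1 : `|go n x - u x| <= (`|u x - g n x| + `|u (- x) - g n (- x)|) / 2.
    have -> : go n x - u x = - ((u x - clip M (g n x)) - (u (- x) - clip M (g n (- x)))) / 2.
      by rewrite uN /go; field.
    rewrite normrM normrN [`|2^-1|]ger0_norm ?invr_ge0// ler_wpM2r ?invr_ge0//.
    by apply: le_trans (ler_normB _ _) _; exact: lerD.
  have d2 : `|go n x - u x| <= 2 * M.
    by apply: le_trans (ler_normB _ _) _; rewrite mulr2n mulrDl mul1r; exact: lerD.
  rewrite -[X in X <= _]real_normK ?num_real//.
  have := normr_ge0 (go n x - u x); move: `|go n x - u x| d1 d2 => a d1 d2 a0.
  move: (`|u x - g n x| + `|u (- x) - g n (- x)|) d1 => c d1.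
  have : a * a <= 2 * M * (c / 2) by exact: ler_pM.
  by rewrite expr2; lra.
have dif0 n y : 0 <= dif n y by rewrite mulr_ge0.
have upper n : (nint (fun x => G n x - (u x)%:C)%R <= (2 * M)%:E * \int[mu]_x (dif n x)%:E)%E.
  have mr : measurable_fun setT (fun x : RM => dif n (- x) : RM).
    exact: (measurableT_comp (mdif n)).
  apply: le_trans (nint_le (cmeasB (Gm n) um) _ (bound n)) _.
    by apply: measurable_funM => //; exact: (measurable_funD (mdif n) mr).
  have e1 : measurable_fun setT (fun x : RM => (dif n x)%:E).
    by apply/measurable_EFinP; exact: mdif.
  have e2 : measurable_fun setT (fun x : RM => (dif n (- x))%:E) by exact/measurable_EFinP.
  under eq_integral do rewrite EFinM EFinD.
  rewrite ge0_integralZl//; first last.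
  - by move=> x _; rewrite -EFinD lee_fin addr_ge0.
  - exact: emeasurable_funD.
  rewrite ge0_integralD//; first last.
  - by move=> x _; rewrite lee_fin.
  - by move=> x _; rewrite lee_fin.
  rewrite (@ge0_integralN _ (fun x => (dif n x)%:E))//.
  - by rewrite EFinM [(2%:E * _)%E]muleC -muleA mule_natl mule2n.
  - by move=> x; rewrite lee_fin.
have lim0 : (fun n => (2 * M)%:E * \int[mu]_x (dif n x)%:E)%E @ \oo --> 0%E.
  rewrite -[X in _ --> X](mule0 (2 * M)%:E); apply: cvgeZl => //.
  by under eq_fun do rewrite difE.
apply: (squeeze_cvge _ _ lim0); last exact: cvg_cst.
by apply: nearW => n; rewrite nint_ge0 upper.
Qed.

(** Truncation at height n and to |x| < n keeps u odd and is dominated by u, which reduces the claim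
    to bounded functions with bounded support. *)
Lemma approx_real (u : RM -> R) f : (forall x, u (- x) = - u x) ->
  rep f (fun x => (u x)%:C) -> approx f.
Proof.
move=> uN fu; have [/sqintP[[mu_ _] ui] _] := fu.
have {}mu_ : measurable_fun setT u by exact: mu_.
pose Un n x := clip n%:R (u x) * (`|x| < n%:R)%R%:R.
have n0 n : 0 <= n%:R :> R by [].
have mUn n : measurable_fun setT (Un n : RM -> RM).
  apply: measurable_funM.
    apply: (measurableT_comp (f := clip n%:R : RM -> RM)) => //.
    by apply: continuous_measurable_fun; exact: continuous_clip.
  have -> : (fun x : RM => (`|x| < n%:R)%R%:R : R) = \1_(`]- n%:R, n%:R[%classic : set R).
    by apply/funext => x; rewrite indicE; congr (_%:R); congr nat_of_bool;
      apply/idP/idP; rewrite inE /= in_itv /= ltr_norml.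
  exact: measurable_indic.
have UnN n x : Un n (- x) = - Un n x by rewrite /Un uN clipN normrN mulNr.
have Unb n x : `|Un n x| <= n%:R.
  rewrite /Un normrM; have h := clip_bound (n0 n) (u x).
  by case: (_ < _); rewrite ?normr1 ?normr0 ?mulr1 ?mulr0.
have Unu n x : `|Un n x| <= `|u x|.
  rewrite /Un normrM; have h := clip_le (n0 n) (u x).
  by case: (_ < _); rewrite ?normr1 ?normr0 ?mulr1 ?mulr0.
have normC (a : R) : normc a%:C ^+ 2 = a ^+ 2 by rewrite normc2E /= expr0n addr0.
have cu := cmeas_real mu_.
have lim x : ccvg (fun n => (Un n x)%:C) (u x)%:C.
  apply: (@ccvg_near _ _ (fun=> (u x)%:C)); last exact: ccvg_cst.
  have [n hn] : exists n : nat, Num.max `|u x| (`|x| + 1) <= n%:R.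
    by exists (Num.truncn (Num.max `|u x| (`|x| + 1))).+1; exact/ltW/truncnS_gt.
  move: hn; rewrite ge_max => /andP[h1 h2].
  exists n => // m /= nm; have nmR : n%:R <= m%:R :> R by rewrite ler_nat.
  rewrite /Un clip_id; last exact: le_trans nmR.
  by rewrite (_ : `|x| < m%:R) ?mulr1//; lra.
have sqle n x : normc (Un n x)%:C ^+ 2 <= u x ^+ 2.
  by rewrite normC -(real_normK (num_real (Un n x))) -(real_normK (num_real (u x))) ler_pXn2r.
have ui2 : (\int[mu]_x (u x ^+ 2)%:E < +oo)%E.
  by move: ui; rewrite /nint; under eq_integral do rewrite normC.
have [_ cvgU] := nint_dominated (fun n => cmeas_real (mUn n)) cu
  (measurable_funX 2 mu_) ui2 sqle (aeW _ lim).
apply: (approx_nint fu) cvgU => n.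
have U2 : (fun x => (Un n x)%:C) \in @sqint R.
  apply/sqintP; split; first exact: (cmeas_real (mUn n)).
  apply: le_lt_trans ui2; apply: nint_le (sqle n); first exact: (cmeas_real (mUn n)).
  exact: measurable_funX.
have [|g gU] := rep_exists U2; first by move=> x; rewrite UnN rmorphN.
exists g => //; apply: (approx_bounded (n0 n) (n0 n) (mUn n)) gU => // x nx.
by rewrite /Un ltNge nx mulr0.
Qed.

Lemma approx_all f : approx f.
Proof.
have [F fF oddF] := rep_odd f; have [/sqintP[[m1 m2] Fi] _] := fF.
have part (u : RM -> R) : measurable_fun setT u -> (forall x, u (- x) = - u x) ->
    (forall x, u x ^+ 2 <= normc (F x) ^+ 2) -> exists2 g, rep g (fun x => (u x)%:C) & approx g.
  move=> mu_ uN uF; have U2 : (fun x => (u x)%:C) \in @sqint R.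
    apply/sqintP; split; first exact: cmeas_real.
    apply: le_lt_trans Fi; apply: nint_le; first exact: cmeas_real.
      exact: cmeas_normc2.
    by move=> x; rewrite normc2E /= expr0n addr0.
  have [|g gU] := rep_exists U2; first by move=> x; rewrite uN rmorphN.
  by exists g => //; exact: approx_real gU.
have ImN (z : C) : Im (- z) = - Im z by case: z.
have ReN (z : C) : Re (- z) = - Re z by case: z.
have [||g1 g1F g1a] := part (fun x => Re (F x)) m1.
- by move=> x; rewrite oddF ReN.
- by move=> x; rewrite normc2E lerDl sqr_ge0.
have [||g2 g2F g2a] := part (fun x => Im (F x)) m2.
- by move=> x; rewrite oddF ImN.
- by move=> x; rewrite normc2E lerDr sqr_ge0.
have -> : f = 'i%C *: g2 + g1.
  apply: (rep_inj fF); have := rep_lin 'i%C g2F g1F; congr rep; apply/funext => x.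
  by rewrite addrC -complexE.
exact: approx_lin.
Qed.

End Density.

(** * The limit representation *)

Section LimitOperators.
Variable R : realType.
Local Notation C := R[i].
Local Notation N := (hnorm (@L2odd_dot R)).
Local Notation dotE := (fun k => @dotmx C k.+1 : {dot 'rV[C]_k.+1 for Num.conj}).
Local Notation scvg := (scvg (@L2odd_dot R) (@embed R)).

Let dotJ k (u v : 'rV[C]_k.+1) : L2odd_dot (embed u) (embed v) = dotE k u v.
Proof. exact: dot_embed. Qed.

Section OneOperator.
Variable A : forall k, 'M[C]_k.+1.
Hypothesis isoA : forall k (u v : 'rV[C]_k.+1), dotmx (u *m A k) (v *m A k) = dotmx u v.
Hypothesis boxA : forall b : R, 0 <= b -> exists f, scvg (fun k => box b k *m A k) f.

(** The vectors that admit a sequence along which the matrices converge form a subspace, and [boxA]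
    puts the odd steps into it. *)
Let dense f (e : R) : 0 < e -> exists2 psi,
  (exists u g, scvg u psi /\ scvg (fun k => mulmxr (A k) (u k)) g) & N (f - psi) < e.
Proof.
pose P psi := exists u g, scvg u psi /\ scvg (fun k => mulmxr (A k) (u k)) g.
apply: (@approx_all R P) => [a u v [u1 [gu [uu ugu]]] [v1 [gv [vv vgv]]]|b b0].
  exists (fun k => a *: u1 k + v1 k), (a *: gu + gv); split; first exact: scvg_lin.
  apply: le_cvg0 (scvg_lin a ugu vgv) => k.
  by rewrite hnorm_ge0 /= mulmxDl scalemxAl lexx.
have [h bh] := boxA b0.
by exists (box b), h; split=> //; exact: scvg_box.
Qed.

Lemma mx_limit_operator : exists A0 : {linear L2odd R -> L2odd R},
  (forall f g, L2odd_dot (A0 f) (A0 g) = L2odd_dot f g) /\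
  (forall v f, scvg v f -> scvg (fun k => v k *m A k) (A0 f)).
Proof.
exact: (@limit_operator R _ _ _ _ _ dotJ (@L2odd_complete R)
  (fun k => mulmxr (A k) : {linear 'rV[C]_k.+1 -> 'rV[C]_k.+1}) isoA dense).
Qed.

Lemma mx_scvg_exists f : exists v, scvg v f.
Proof.
exact: (@scvg_dense_exists R _ _ _ _ (fun k => mulmxr (A k) : {linear _ -> _}) dense f).
Qed.

End OneOperator.

(** The case of identity matrices, for which convergence on the sampled odd steps is [scvg_box]. *)
Lemma scvg_total f : exists v, scvg v f.
Proof.
apply: (mx_scvg_exists (A := fun=> 1%:M)) => b b0; exists (phi b).
by apply: le_cvg0 (scvg_box b0) => k; rewrite mulmx1 hnorm_ge0 lexx.
Qed.

Lemma phi_neq0 : phi 1 != 0 :> L2odd R.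
Proof.
apply/eqP => p0; have := @dot_phi R 1 1 ler01 ler01; rewrite p0 minxx.
rewrite (linear0l (@L2odd_dot R)) => /(congr1 (@complex.Re R))/eqP.
by rewrite /= mulr1 eq_sym pnatr_eq0.
Qed.

Definition st_word : seq bool := [:: true; false; true; false; true; false].

(** The word is a scalar and also an isometry; comparing norms of one nonzero vector gives the
    modulus. *)
Lemma st_cube k : exists c : C, normc c = 1 /\ forall v : 'rV[C]_k.+1,
  eval_word (mulmxr (sine_mx R k)) (mulmxr (theta_mx R k)) st_word v = c *: v.
Proof.
have [c cE] := @theta_sine_cube R k; exists c.
have cv (v : 'rV[C]_k.+1) :
    eval_word (mulmxr (sine_mx R k)) (mulmxr (theta_mx R k)) st_word v = c *: v.
  by rewrite /= -mul_mx_scalar -cE !mulmxA.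
split=> //; pose v : 'rV[C]_k.+1 := delta_mx 0 0.
have v1 : dotmx v v != 0.
  rewrite dnorm_eq0; apply/eqP => /matrixP /(_ 0 0) /eqP.
  by rewrite !mxE !eqxx oner_eq0.
have := @eval_word_isometry R _ (@dotmx C k.+1) (mulmxr (sine_mx R k))
  (mulmxr (theta_mx R k)) st_word (@sine_mx_isometry R k) (@theta_mx_isometry R k) v v.
rewrite cv dnormZ => /eqP; rewrite -subr_eq0 -[X in _ - X]mul1r -mulrBl mulf_eq0 (negbTE v1) orbF.
rewrite subr_eq0 normrcE -rmorphXn -[1](rmorph1 (real_complex R)) (inj_eq (@complexI R)).
by rewrite sqrf_eq1 => /orP[/eqP//|/eqP c1]; have := normc_ge0 c; rewrite c1 lerNr oppr0 ler10.
Qed.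

Lemma limit_operators : exists (s t : {linear L2odd R -> L2odd R}) (c : nat -> C) (c0 : C),
  [/\ forall f g, L2odd_dot (s f) (s g) = L2odd_dot f g,
      forall f g, L2odd_dot (t f) (t g) = L2odd_dot f g,
      forall v f, scvg v f -> scvg (fun k => v k *m sine_mx R k) (s f),
      forall v f, scvg v f -> scvg (fun k => v k *m theta_mx R k) (t f) &
      forall f, s (s f) = f] /\
  [/\ forall k, normc (c k) = 1,
      forall k (v : 'rV[C]_k.+1),
        eval_word (mulmxr (sine_mx R k)) (mulmxr (theta_mx R k)) st_word v = c k *: v,
      (fun k => normc (c k - c0)) @ \oo --> (0 : R) &
      forall f, eval_word s t st_word f = c0 *: f].
Proof.
have [||s [siso scv]] := @mx_limit_operator (sine_mx R).
- exact: sine_mx_isometry.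
- by move=> b /scvg_box_sine[f _ h]; exists f.
have [||t [tiso tcv]] := @mx_limit_operator (theta_mx R).
- exact: theta_mx_isometry.
- by move=> b /scvg_box_theta[f _ h]; exists f.
have [c cP] := choice (@st_cube).
have [c0 [cc0 c0E]] := @scalar_limit R _ _ _ _ _ dotJ
  (fun k => eval_word (mulmxr (sine_mx R k)) (mulmxr (theta_mx R k)) st_word)
  (eval_word s t st_word) c (phi 1) (fun k => (cP k).1) (fun k => (cP k).2)
  (fun v f vf => @scvg_eval_word R _ _ _ _ (fun k => mulmxr (sine_mx R k))
    (fun k => mulmxr (theta_mx R k)) s t st_word scv tcv v f vf) scvg_total phi_neq0.
exists s, t, c, c0; split; split=> //; first last.
- by move=> k; exact: (cP k).2.
- by move=> k; exact: (cP k).1.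
move=> f; have [v vf] := scvg_total f.
apply: (scvg_unique (scv _ _ (scv _ _ vf))); apply: le_cvg0 vf => k.
by rewrite -mulmxA sine_mx_sqr mulmx1 hnorm_ge0 lexx.
Qed.

End LimitOperators.

(** * A convergent choice of cube roots *)

Section CubeRoots.
Variable R : realType.
Local Notation C := R[i].

(** Factor X^3 - k over its roots and evaluate at z: the product of the three distances from z to
    the roots is |w - k|, so the cube of the smallest distance is at most that. *)
Lemma cube_root_near (w k z : C) : z ^+ 3 = w ->
  exists2 y, y ^+ 3 = k & normc (y - z) ^+ 3 <= normc (k - w).
Proof.
move=> zw; pose p : {poly C} := 'X^3 - k%:P.
have [r] := closed_field_poly_normal p.
rewrite (monicP (monicXnsubC k (ltn0Sn 2))) scale1r => pE.
have rsize : size r = 3%N.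
  by apply/eqP; rewrite -eqSS -(size_prod_XsubC r id) -pE size_XnsubC.
have root y : y \in r -> y ^+ 3 = k.
  rewrite -root_prod_XsubC -pE /root !hornerE => /eqP/eqP.
  by rewrite subr_eq0 => /eqP.
have wk : normc (k - w) = \prod_(y <- r) normc (y - z).
  rewrite normcBC -zw -[z ^+ 3 - k](_ : p.[z] = _); last by rewrite !hornerE.
  rewrite pE horner_prod.
  elim: (r) => [|y s IH]; first by rewrite !big_nil Normc.normc1.
  by rewrite !big_cons Normc.normcM IH !hornerE (normcBC z).
have [y yr ymin] : exists2 y, y \in r & forall x, x \in r -> normc (y - z) <= normc (x - z).
  case: r rsize {pE root wk} => // x s _; elim: s x => [|x' s IH] x.
    by exists x => [|u]; rewrite inE // => /eqP->.
  have [y ys ymin] := IH x'; have [h|h] := leP (normc (y - z)) (normc (x - z)).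
    exists y => [|u]; first by rewrite inE ys orbT.
    by rewrite inE => /predU1P[->//|/ymin].
  exists x => [|u]; first by rewrite inE eqxx.
  by rewrite inE => /predU1P[->//|/ymin]; apply: le_trans (ltW h).
exists y; first exact: root.
rewrite wk -rsize; elim: r ymin {pE root wk yr rsize} => [|x s IH]; first by rewrite big_nil.
move=> h; have h1 := h x (mem_head x s).
have h2 := IH (fun u us => h u (mem_behead (s := x :: s) us)).
rewrite big_cons exprS; apply: ler_pM => //.
- exact: normc_ge0.
- by rewrite exprn_ge0// normc_ge0.
Qed.

(** Inversion preserves distances on the unit circle, so a cube root of 1 / c_k nearest to b0
    satisfies |b_k - b0|^3 <= |c_k - c0|. *)
Lemma cube_root_limit (c : nat -> C) (c0 : C) : (forall k, normc (c k) = 1) ->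
  (fun k => normc (c k - c0)) @ \oo --> (0 : R) ->
  exists (b : nat -> C) (b0 : C),
    [/\ forall k, normc (b k) = 1, normc b0 = 1,
        forall k, b k ^+ 3 * c k = 1, b0 ^+ 3 * c0 = 1 &
        (fun k => normc (b k - b0)) @ \oo --> (0 : R)].
Proof.
move=> c1 cc0.
have c01 : normc c0 = 1.
  apply/eqP; rewrite -subr_eq0 -normr_eq0; apply/eqP/cvg0_cst; first exact: normr_ge0.
  apply: le_cvg0 cc0 => k; rewrite normr_ge0 /= -(c1 k) ler_norml.
  have := normcD (c k - c0) c0; have := normcD (c0 - c k) (c k).
  by rewrite !subrK (normcBC c0); lra.
have nz (x : C) : normc x = 1 -> x != 0.
  by apply: contra_eq_neq => ->; rewrite Normc.normc0 eq_sym oner_eq0.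
(* This use only produces some cube root of 1 / c0; the base point 0 is arbitrary and the distance
   bound is dropped. *)
have [b0 b0c _] := cube_root_near c0^-1 (erefl (0 ^+ 3 : C)).
have /choice[b bP] k : exists y, y ^+ 3 = (c k)^-1 /\ normc (y - b0) ^+ 3 <= normc (c k - c0).
  have [y y3 yb] := cube_root_near (c k)^-1 b0c; exists y; split=> //.
  have e : (c k)^-1 - c0^-1 = (c0 - c k) * ((c k)^-1 * c0^-1).
    by field; rewrite !nz.
  move: yb; rewrite e !Normc.normcM !Normc.normcV c1 c01 invr1 !mulr1.
  by rewrite (normcBC c0).
have norm1 (x y : C) : normc y = 1 -> x ^+ 3 = y^-1 -> normc x = 1.
  move=> y1 /(congr1 (@Normc.normc R)); rewrite Normc.normcV y1 invr1 !exprS expr0 mulr1 !Normc.normcM.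
  rewrite -expr2 -exprS => /eqP; rewrite pexpr_eq1// ?normc_ge0// => /eqP.
  by [].
exists b, b0; split.
- by move=> k; exact: norm1 (c1 k) (bP k).1.
- exact: norm1 c01 b0c.
- by move=> k; rewrite (bP k).1 mulVf// nz.
- by rewrite b0c mulVf// nz.
apply: cvg0P => [k|e e0]; first exact: normc_ge0.
apply: (nearS _ (cvg0_lt cc0 (exprn_gt0 3 e0))) => k h.
have := le_lt_trans (bP k).2 h.
by rewrite ltr_pXn2r// nnegrE ?normc_ge0// ltW.
Qed.

Lemma cvgn_normc (b : nat -> (C : numFieldType)) (b0 : C) :
  (fun k => normc (b k - b0)) @ \oo --> (0 : R) -> cvgn b.
Proof.
move=> h; apply/cvg_ex; exists (b0 : C : numFieldType); apply/cvgrPdist_lt => e.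
rewrite ltcE => /andP[/eqP /= e1 e0].
apply: (nearS _ (cvg0_lt h e0)) => k hk.
by rewrite normrcE ltcE /= e1 eqxx normcBC.
Qed.

End CubeRoots.

Section SL2Zrep.
Variable R : realType.
Local Notation C := R[i].
Variables (V : lmodType C) (dot : {dot V for Num.conj}) (s t : {linear V -> V}).
Hypothesis siso : forall u v, dot (s u) (s v) = dot u v.
Hypothesis tiso : forall u v, dot (t u) (t v) = dot u v.
Hypothesis ss : forall v, s (s v) = v.

Definition SL2Z_rep (b : C) (g : SL2Z) : {linear V -> V} :=
  lin_word s (b \*: t) (SL2Z_word g).

(** Scaling T by b multiplies the scalar (s t)^3 = c by b^3, so the second modular relation holds
    exactly when b^3 c = 1. *)
Lemma SL2Z_repP (b c : C) : normc b = 1 -> b ^+ 3 * c = 1 ->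
  (forall v, eval_word s t st_word v = c *: v) ->
  [/\ unitary_rep dot (SL2Z_rep b), forall v, SL2Z_rep b SL2Z_S v = s v &
      forall v, SL2Z_rep b SL2Z_T v = b *: t v].
Proof.
move=> b1 bc stc.
have repE g v : SL2Z_rep b g v = SL2Z_act s (b \*: t) g v by exact: lin_wordE.
have stK v : s ((b \*: t) (s ((b \*: t) (s ((b \*: t) v))))) = v.
  rewrite /= !linearZ /= !linearZ /= !linearZ /= !scalerA.
  have := stc v; rewrite /= => ->.
  rewrite scalerA -[RHS]scale1r; congr (_ *: _).
  by rewrite -bc !exprS expr0 mulr1 !mulrA.
split.
- split=> [v|g h v|g u v].
  + by rewrite repE SL2Z_act1.
  + by rewrite !repE SL2Z_actM.
  + rewrite !repE; apply: eval_word_isometry => // x y /=.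
    rewrite linearZl linearZr /= tiso mulrA -normCK.
    by rewrite normrcE b1 expr1n mul1r.
- by move=> v; rewrite repE SL2Z_act_S.
- by move=> v; rewrite repE SL2Z_act_T.
Qed.

End SL2Zrep.

(** * Identification of the limit *)

Section SineIntegral.
Variable R : realType.
Local Notation RM := (measurableTypeR R).
Local Notation mu := (@lebesgue_measure R : {measure set RM -> \bar R}).

Let cont_sin (w : R) : continuous (fun y : R => sin (w * y)).
Proof.
move=> y; apply: (@continuous_comp _ _ _ ( *%R w) sin); last exact: continuous_sin.
exact: mulrl_continuous.
Qed.

Let cont_cos (w : R) : continuous (fun y : R => cos (w * y)).
Proof.
move=> y; apply: (@continuous_comp _ _ _ ( *%R w) cos); last exact: continuous_cos.
exact: mulrl_continuous.
Qed.

Lemma integral_sin (w a b : R) : w != 0 -> a < b ->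
  \int[mu]_(y in `[a, b]) sin (w * y) = (cos (w * a) - cos (w * b)) / w.
Proof.
move=> w0 ab; pose F (y : R) := - w^-1 * cos (w * y).
have dF (y : R) : is_derive y (1 : R) F (sin (w * y)).
  rewrite /F; apply: is_derive_eq; rewrite /GRing.scale /=; field.
  by rewrite w0.
have cF : continuous F by move=> y; apply: cvgM; [exact: cvg_cst|exact: cont_cos].
rewrite /Rintegral (continuous_FTC2 (F := F) ab).
- by rewrite /= /F; field; rewrite w0.
- by apply: continuous_subspaceT; exact: cont_sin.
- split=> [y _||]; first exact: ex_derive.
    by apply: cvg_at_right_filter; exact: cF.
  by apply: cvg_at_left_filter; exact: cF.
- by move=> y _; rewrite derive1E derive_val.
Qed.

Lemma integral_sin_abs (w m : R) : w != 0 -> 0 <= m ->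
  \int[mu]_(y in `[- m, m]) sin (w * `|y|) = 2 * (1 - cos (w * m)) / w.
Proof.
move=> w0; rewrite le_eqVlt => /predU1P[<-|m0].
  by rewrite oppr0 set_itv1 Rintegral_set1 mulr0 cos0 subrr mulr0 mul0r.
have cf : continuous (fun y : R => sin (w * `|y|)).
  move=> y; apply: (@continuous_comp _ _ _ (fun y : R => `|y|) (fun z => sin (w * z))).
    exact: norm_continuous.
  exact: cont_sin.
have fi a b : mu.-integrable `[a, b] (EFin \o (fun y : R => sin (w * `|y|))).
  by apply: continuous_compact_integrable;
    [exact: segment_compact|exact: continuous_subspaceT].
have h := @Rintegral_itvB _ (fun y : R => sin (w * `|y|)) (BLeft (- m)) (BRight m) 0 (fi _ _).
rewrite -(subrK (\int[mu]_(y in `[- m, 0]) sin (w * `|y|)) (\int[mu]_(y in _) _)).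
rewrite h ?bnd_simp ?oppr_le0 ?ltW// Rintegral_itv_obnd_cbnd; last first.
  apply: integrableS (fi 0 m) => //; exact: subset_itv_oc_cc.
have -> : \int[mu]_(y in `[0, m]) sin (w * `|y|) = \int[mu]_(y in `[0, m]) sin (w * y).
  by apply: eq_Rintegral => y; rewrite inE /= in_itv /= => /andP[y0 _]; rewrite ger0_norm.
have -> : \int[mu]_(y in `[- m, 0]) sin (w * `|y|) =
    \int[mu]_(y in `[- m, 0]) sin (- w * y).
  apply: eq_Rintegral => y; rewrite inE /= in_itv /= => /andP[_ y0].
  by rewrite ler0_norm// mulrN mulNr.
rewrite !integral_sin ?oppr_eq0 ?oppr_lt0// !mulr0 cos0 mulrNN.
by field.
Qed.

(** For |y| < b the integrand is sin (w |y|) with w = 2 pi x, and the end points form a null set. *)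
Lemma integral_odd_step_sin (b x : R) : 0 <= b ->
  \int[mu]_y (odd_step b y * sin (2 * pi * x * y)) = sine_tf b x.
Proof.
move=> b0; have [->|x0] := eqVneq x 0.
  rewrite /sine_tf; under eq_Rintegral do rewrite mulr0 mul0r sin0 mulr0.
  by rewrite Rintegral_cst// mul0r [pi * 0]mulr0 invr0 mulr0.
pose w := 2 * pi * x; have pi0 := pi_gt0 R.
have w0 : w != 0 by rewrite mulf_neq0// gt_eqF// mulr_gt0.
have -> : sine_tf b x = 2 * (1 - cos (w * b)) / w.
  rewrite /sine_tf /w (mulrAC _ b x); move: (@pi R) pi0 => p p0.
  by field; rewrite x0 gt_eqF.
rewrite -integral_sin_abs// [RHS]Rintegral_mkcond /Rintegral; congr fine.
have FF : Filter (almost_everywhere mu) := ae_filter_ringOfSetsType mu.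
have mh : measurable_fun setT (fun y : RM => sin (w * `|y|)).
  apply: continuous_measurable_fun => y.
  apply: (@continuous_comp _ _ _ (fun y : R => `|y|) (fun z => sin (w * z))).
    exact: norm_continuous.
  exact: cont_sin.
apply: ae_eq_integral => //.
- apply/measurable_EFinP; apply: measurable_funM; first exact: measurable_odd_step.
  by apply: continuous_measurable_fun; exact: cont_sin.
- apply/measurable_EFinP/(measurable_restrictT _ _).1 => //.
  exact: measurable_funTS.
- have h : {ae mu, forall y : RM, `|y| != b}.
    exists [set b; - b]; split.
    + by apply: measurableU; exact: measurable_set1.
    + exact: countable_lebesgue_measure0 (finite_set_countable (finite_set2 _ _)).
    + move=> y /=; apply: contra_notP => h; apply/eqP => yb; apply: h.
      move: yb; case: (ger0P y) => _; [by left|].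
      by move=> /(congr1 -%R); rewrite opprK; right.
  move: h; apply: filterS => y /= yb _; congr EFin.
  rewrite patchE /odd_step.
  have -> : (y \in (`[- b, b]%classic : set R)) = (`|y| < b).
    by rewrite lt_neqAle yb; apply/idP/idP; rewrite inE /= in_itv /= ler_norml.
  case: (_ < b); last by rewrite mulr0 mul0r.
  rewrite mulr1; case: (sgrP y) => [->|y0|y0].
  + by rewrite mul0r mulr0 sin0.
  + by rewrite mul1r.
  + by rewrite mulN1r -sinN -mulrN.
Qed.

End SineIntegral.

Section Identification.
Variable R : realType.
Local Notation C := R[i].
Local Notation RM := (measurableTypeR R).
Local Notation mu := (@lebesgue_measure R : {measure set RM -> \bar R}).
Local Notation N := (hnorm (@L2odd_dot R)).
Local Notation scvg := (scvg (@L2odd_dot R) (@embed R)).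

Let ae_filter : Filter (almost_everywhere mu) := ae_filter_ringOfSetsType mu.

Lemma rep_val (u : L2odd R) F (uF : rep u F) : L2odd_val u = L2_class (MkL2fun uF.1).
Proof.
have FF := ae_filter.
rewrite -[LHS]L2_to_funK; apply/L2_classP/ae_nullP.
by have := uF.2; apply: filterS => x /= ux; rewrite !fctE /= ux subrr.
Qed.

Lemma rep_dot (u v : L2odd R) F G : rep u F -> rep v G ->
  L2odd_dot u v = Cintegral setT (fun x => F x * (G x)^*%R).
Proof.
by move=> uF vG; rewrite /L2odd_dot (rep_val uF) (rep_val vG) [LHS]L2_dot_class.
Qed.

Lemma L2odd_eq (u v : L2odd R) : (forall e : R, 0 < e -> N (u - v) <= e) -> u = v.
Proof.
move=> h; apply/eqP; rewrite -subr_eq0 -(hnorm_eq0 (@L2odd_dot R)) eq_le hnorm_ge0 andbT.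
by apply/ler_addgt0Pl => e /h; rewrite addr0.
Qed.

Section Multiplier.
Variable m : R -> C.
Hypothesis m_meas : cmeas m.
Hypothesis m_le1 : forall x, normc (m x) <= 1.
Hypothesis m_even : forall x, m (- x) = m x.

Let mul_le (F : R -> C) x : normc (m x * F x) ^+ 2 <= normc (F x) ^+ 2.
Proof.
rewrite Normc.normcM ler_pXn2r ?nnegrE ?mulr_ge0 ?normc_ge0//.
by rewrite ler_piMl ?normc_ge0.
Qed.

(** An even multiplier preserves oddness and a bounded one preserves square-integrability. It is
    applied to the chirp and to the cutoffs to |x| < n. *)
Lemma multiplier : exists M : {linear L2odd R -> L2odd R},
  (forall u F, rep u F -> rep (M u) (fun x => m x * F x)) /\ (forall u, N (M u) <= N u).
Proof.
have FF := ae_filter.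
have mul_sq F : F \in @sqint R -> (fun x => m x * F x) \in @sqint R.
  move=> /sqintP[mF Fi]; have mmF := cmeasM m_meas mF; apply/sqintP; split=> //.
  by apply: le_lt_trans Fi; apply: nint_le (mul_le F) => //; exact: cmeas_normc2.
have /choice[M MP] (u : L2odd R) : exists v, forall F, rep u F -> rep v (fun x => m x * F x).
  have [F0 [F02 uF0] F0N] := rep_odd u.
  have [|v [_ vF0]] := rep_exists (mul_sq _ F02); first by move=> x; rewrite m_even F0N mulrN.
  exists v => F [F2 uF]; split; first exact: mul_sq.
  by move: uF0 uF vF0; apply: filterS3 => x /= <- <- ->.
have lin : linear M.
  move=> a u v; have h1 := rep_self u; have h2 := rep_self v.
  apply: rep_inj (MP _ _ (rep_lin a h1 h2)) _.
  have := rep_lin a (MP _ _ h1) (MP _ _ h2); congr (rep _ _).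
  by apply/funext => x; rewrite mulrDr mulrCA.
pose L := GRing.isLinear.Build C (L2odd R) (L2odd R) *:%R M lin.
pose ML : {linear L2odd R -> L2odd R} := HB.pack M L.
exists ML; split=> // u; have h := rep_self u; have [/sqintP[mu_ _] _] := h.
rewrite -(@ler_pXn2r _ 2)// ?nnegrE ?hnorm_ge0// -lee_fin.
rewrite (rep_hnorm (MP _ _ h)) (rep_hnorm h).
by apply: nint_le (mul_le u); [exact: cmeasM|exact: cmeas_normc2].
Qed.

End Multiplier.

(** Both [t] and multiplication by the chirp do not increase norms, and they agree on the odd steps
    by [scvg_box_theta]; density does the rest. *)
Lemma metaplectic_T_limit (t : {linear L2odd R -> L2odd R}) :
  (forall f g, L2odd_dot (t f) (t g) = L2odd_dot f g) ->
  (forall v f, scvg v f -> scvg (fun k => v k *m theta_mx R k) (t f)) ->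
  forall f : L2odd R, metaplectic_T f (t f).
Proof.
move=> tiso tcv f.
have [|||M [Mrep Mle]] := @multiplier (fun x => expi (- (pi * x ^+ 2))).
- split; apply: continuous_measurable_fun => x.
    apply: (@continuous_comp _ _ _ (fun x : R => - (pi * x ^+ 2)) cos); last exact: continuous_cos.
    by apply: cvgN; apply: cvgM; [exact: cvg_cst|exact: exprn_continuous].
  apply: (@continuous_comp _ _ _ (fun x : R => - (pi * x ^+ 2)) sin); last exact: continuous_sin.
  by apply: cvgN; apply: cvgM; [exact: cvg_cst|exact: exprn_continuous].
- by move=> x; rewrite normc_expi.
- by move=> x; rewrite sqrrN.
suff -> : t f = M f by exact: (Mrep _ _ (rep_self f)).2.
have tN (u : L2odd R) : N (t u) = N u by congr (Num.sqrt (Re _)); exact: tiso.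
apply: L2odd_eq => e e0; have e2 : 0 < e / 2 by rewrite divr_gt0.
have [||psi tM fpsi] := @approx_all R (fun u => t u = M u) _ _ f _ e2.
- by move=> a u v tu tv; rewrite !linearP tu tv.
- move=> b b0; have [g g_rep bg] := scvg_box_theta b0.
  rewrite (scvg_unique (tcv _ _ (scvg_box b0)) bg).
  apply: rep_inj g_rep _; have := Mrep _ _ (rep_phi b); congr (rep _ _).
  by apply/funext => x; rewrite mulrC.
have := hnorm_triangle (@L2odd_dot R) (t psi) (t f) (M f).
rewrite [in X in _ <= _ + X]tM -!raddfB tN => /le_trans; apply.
rewrite (splitr e); apply: lerD; first exact: ltW.
by apply: le_trans (Mle _) _; rewrite hnormBC ltW.
Qed.

Section OddSine.
Variable n : R.

Lemma sine_kernel_exists x : exists u : L2odd R,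
  rep u (fun y => (sin (2 * pi * x * y) * (`|y| < n)%R%:R)%:C).
Proof.
have win (y : RM) : (`|y| < n)%R%:R = \1_(`]- n, n[%classic : set R) y :> R.
  by rewrite indicE; congr (_%:R); congr nat_of_bool;
    apply/idP/idP; rewrite inE /= in_itv /= ltr_norml.
apply: rep_exists; last by move=> y; rewrite normrN mulrN sinN mulNr rmorphN.
have m1 : measurable_fun setT (fun y : RM => sin (2 * pi * x * y) : R).
  apply: continuous_measurable_fun => y.
  apply: (@continuous_comp _ _ _ ( *%R (2 * pi * x)) sin); last exact: continuous_sin.
  exact: mulrl_continuous.
have m2 : measurable_fun setT (fun y : RM => (`|y| < n)%R%:R : R).
  by under eq_fun do rewrite win; exact: measurable_indic.
have m : cmeas (fun y => (sin (2 * pi * x * y) * (`|y| < n)%R%:R)%:C).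
  by apply: cmeas_real; exact: measurable_funM.
apply/sqintP; split=> //.
apply: le_lt_trans (nint_le m (g := \1_(`]- n, n[%classic : set R)) _ _) _.
- exact: measurable_indic.
- move=> y; rewrite normc2E [complex.Re _]/= [complex.Im _]/= expr0n addr0 -win exprMn.
  have : sin (2 * pi * x * y) ^+ 2 <= 1 by rewrite sin2cos2 gerBl sqr_ge0.
  by case: (_ < n); rewrite ?expr1n ?expr0n ?mulr1 ?mulr0.
- rewrite integral_indic// setIT /= lebesgue_measure_itv /=; case: ifP => // _.
  by rewrite -EFinB ltry.
Qed.

(** The truncated kernel as a vector. Pairing with it is the truncated sine transform at the point
    x, which is therefore controlled by Cauchy-Schwarz. *)
Definition sine_kernel x : L2odd R := projT1 (cid (sine_kernel_exists x)).

Lemma rep_sine_kernel x : rep (sine_kernel x) (fun y => (sin (2 * pi * x * y) * (`|y| < n)%R%:R)%:C).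
Proof. exact: projT2 (cid (sine_kernel_exists x)). Qed.

Lemma Rintegral_window (h : RM -> R) : measurable_fun setT h ->
  \int[mu]_y (h y * (`|y| < n)%R%:R) = \int[mu]_(y in `[- n, n]) h y.
Proof.
move=> mh; rewrite /Rintegral; congr fine.
rewrite (integral_itv_bndoo (x := - n) (y := n) true false); last first.
  by apply/measurable_EFinP; exact: measurable_funTS.
rewrite [RHS]integral_mkcond; apply: eq_integral => y _; rewrite patchE.
have -> : (y \in (`]- n, n[%classic : set R)) = (`|y| < n).
  by apply/idP/idP; rewrite inE /= in_itv /= ltr_norml.
by case: (_ < n); rewrite ?mulr1 ?mulr0.
Qed.

Lemma dot_sine_kernel (f : L2odd R) x : L2odd_dot f (sine_kernel x) =
  Cintegral `[- n, n] (fun y => (sin (2 * pi * x * y))%:C * f y).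
Proof.
have m1 : measurable_fun setT (fun y : RM => sin (2 * pi * x * y) : R).
  apply: continuous_measurable_fun => y.
  apply: (@continuous_comp _ _ _ ( *%R (2 * pi * x)) sin); last exact: continuous_sin.
  exact: mulrl_continuous.
have fR := rep_self f; have [/sqintP[mf _] _] := fR.
have [h1 h2] := cmeasM (cmeas_real m1) mf.
rewrite (rep_dot fR (rep_sine_kernel x)) /Cintegral -!Rintegral_window//.
by congr (_ +i* _); apply: eq_Rintegral => y _;
  move: (sin _) (_ < n) (_ y) => s w [a b] /=; ring.
Qed.

Lemma dot_phi_sine_kernel b x : 0 <= b ->
  0 <= n -> L2odd_dot (phi b) (sine_kernel x) = (sine_tf (Num.min b n) x)%:C.
Proof.
move=> b0 n0; rewrite (rep_dot (rep_phi b) (rep_sine_kernel x)).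
rewrite -integral_odd_step_sin ?le_min ?b0// /Cintegral; congr (_ +i* _).
  apply: eq_Rintegral => y _; rewrite /odd_step lt_min.
  move: (sin _) (Num.sg y) (`|y| < b) (`|y| < n) => s g [] [] /=; ring.
under eq_Rintegral do rewrite /= oppr0 mulr0 mul0r addr0.
by rewrite Rintegral_cst// mul0r.
Qed.

End OddSine.

End Identification.

(** * The limit of the sine matrices is the sine transform *)

Section SineOperator.
Variable R : realType.
Local Notation C := R[i].
Local Notation RM := (measurableTypeR R).
Local Notation mu := (@lebesgue_measure R : {measure set RM -> \bar R}).
Local Notation N := (hnorm (@L2odd_dot R)).
Local Notation scvg := (scvg (@L2odd_dot R) (@embed R)).

Variable s : {linear L2odd R -> L2odd R}.
Hypothesis siso : forall f g, L2odd_dot (s f) (s g) = L2odd_dot f g.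
Hypothesis scv : forall v f, scvg v f -> scvg (fun k => v k *m sine_mx R k) (s f).

Let window (n : nat) (x : R) : C := ((`|x| < n%:R)%R%:R : R)%:C.

Let cmeas_window n : cmeas (window n).
Proof.
apply: cmeas_real.
have -> : (fun x : RM => (`|x| < n%:R)%R%:R : R) = \1_(`]- n%:R, n%:R[%classic : set R).
  by apply/funext => x; rewrite indicE; congr (_%:R); congr nat_of_bool;
    apply/idP/idP; rewrite inE /= in_itv /= ltr_norml.
exact: measurable_indic.
Qed.

Let window_le1 n x : normc (window n x) <= 1.
Proof. by rewrite /window; case: (_ < _); rewrite ?Normc.normc1 ?Normc.normc0. Qed.

Let window_even n x : window n (- x) = window n x.
Proof. by rewrite /window normrN. Qed.

Let sN u : N (s u) = N u.
Proof. by congr (Num.sqrt (Re _)); exact: siso. Qed.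

(* For psi in the span of the odd steps, s maps the truncation M psi of psi to
   [-n, n] to the truncated sine transform of psi; Fatou's lemma passes to f. *)
Lemma sine_operator_bound n (M : {linear L2odd R -> L2odd R}) f (e : R) : 0 < e ->
  (forall u F, rep u F -> rep (M u) (fun x => window n x * F x)) ->
  (forall u, N (M u) <= N u) ->
  (nint (fun x => (s f : R -> C) x - L2odd_dot f (sine_kernel n%:R x))%R
    <= ((N (f - M f) + e) ^+ 2)%:E)%E.
Proof.
move=> e0 Mrep Mle.
pose P psi := rep (s (M psi)) (fun x => L2odd_dot psi (sine_kernel n%:R x)).
have dense (d : R) : 0 < d -> exists2 psi, P psi & N (f - psi) < d.
  apply: (@approx_all R P) => [a u v Pu Pv|b b0].
    rewrite /P !linearP; have := rep_lin a Pu Pv; congr (rep _ _).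
    by apply/funext => x; rewrite (@L2odd_dotl R (sine_kernel n%:R x) a u v).
  have m0 : 0 <= Num.min b n%:R by rewrite le_min b0 ler0n.
  have [g g_rep bg] := scvg_box_sine m0.
  rewrite /P (_ : M (phi b) = phi (Num.min b n%:R)).
    rewrite (scvg_unique (scv (scvg_box m0)) bg); move: g_rep; congr (rep _ _).
    by apply/funext => x; rewrite dot_phi_sine_kernel.
  apply: rep_inj (Mrep _ _ (rep_phi b)) _; have := rep_phi (Num.min b n%:R).
  congr (rep _ _); apply/funext => x; rewrite -rmorphM; congr (_%:C).
  rewrite /odd_step lt_min mulrCA; congr (_ * _).
  by case: (_ < b); case: (_ < _); rewrite ?mulr1 ?mulr0.
have /choice[psi psiP] j : exists psi, P psi /\ N (f - psi) < e / j.+1%:R.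
  by have [|psi h1 h2] := dense (e / j.+1%:R); [rewrite divr_gt0|exists psi].
have [/sqintP[mg _] _] := rep_self (s f).
apply: (@nint_fatou _ (fun j x => (s f : R -> C) x - L2odd_dot (psi j) (sine_kernel n%:R x))).
- by move=> j; have [[/sqintP[mj _] _] _] := psiP j; exact: cmeasB.
- move=> x.
  (* For fixed x the truncated transforms of psi_j converge to that of f by Cauchy-Schwarz against
     the kernel vector; this is the pointwise convergence required by Fatou's lemma. *)
  have h0 : (fun j => N (sine_kernel n%:R x) * (e * (j.+1%:R)^-1)) @ \oo --> (0 : R).
    by apply: cvg0Z; apply: cvg0Z; exact: cvg_harmonic.
  apply: le_cvg0 h0 => j; rewrite normc_ge0 /= opprD addrACA subrr add0r opprK.
  have -> : - L2odd_dot (psi j) (sine_kernel n%:R x) + L2odd_dot f (sine_kernel n%:R x) =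
      L2odd_dot (f - psi j) (sine_kernel n%:R x).
    by rewrite addrC (linearBl (@L2odd_dot R)).
  apply: le_trans (cauchy_schwarz _ _ _) _; rewrite mulrC.
  by apply: ler_wpM2l; [exact: hnorm_ge0|exact: ltW (psiP j).2].
- move=> j; have [Pj hj] := psiP j.
  (* Isometry of s turns the integral into N (f - M psi)^2, and M does not increase the norm of f -
     psi. *)
  rewrite -(rep_hnormB (rep_self (s f)) Pj) lee_fin -raddfB sN.
  have r0 : 0 <= N (f - M f) + e by rewrite addr_ge0 ?hnorm_ge0// ltW.
  rewrite ler_pXn2r ?nnegrE ?hnorm_ge0//.
  apply: le_trans (hnorm_triangle _ (M f) _ _) _; rewrite lerD2l -raddfB.
  apply: le_trans (Mle _) _; apply/ltW/(lt_le_trans hj).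
  by rewrite ler_piMr ?invf_le1 ?ler1n// ltW.
Qed.

(** The truncations M_n f tend to f by dominated convergence. With the error term 1 / (n + 1) in
    [sine_operator_bound], the integrals are squeezed to 0. *)
Lemma metaplectic_S_odd_limit (f : L2odd R) : metaplectic_S_odd f (s f).
Proof.
have /choice[M MP] n := multiplier (cmeas_window n) (@window_le1 n) (@window_even n).
have fR := rep_self f; have [/sqintP[mf fi] _] := fR.
have Mf : (fun n => N (M n f - f)) @ \oo --> (0 : R).
  apply: sqr_EFin_cvg0 => [n|]; first exact: hnorm_ge0.
  have [||||||_ h] := @nint_dominated R (fun n x => window n x * f x) f
     (fun x => normc (f x) ^+ 2).
  - by move=> n; exact: cmeasM.
  - exact: mf.
  - exact: cmeas_normc2.
  - exact: fi.
  - move=> n x; rewrite Normc.normcM ler_pXn2r ?nnegrE ?mulr_ge0 ?normc_ge0//.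
    by rewrite ler_piMl ?normc_ge0.
  - apply: aeW => x; apply: (@ccvg_near _ _ (fun=> f x)); last exact: ccvg_cst.
    exists (Num.truncn `|x|).+1 => // m /= xm.
    by rewrite /window (lt_le_trans (truncnS_gt _)) ?mul1r// ler_nat.
  apply: cvg_trans h; apply: near_eq_cvg; apply: nearW => n /=.
  by rewrite (rep_hnormB ((MP n).1 _ _ fR) fR).
have up : (fun n => ((N (M n f - f) + n.+1%:R^-1) ^+ 2)%:E) @ \oo --> (0 : R)%:E.
  have h : (fun n => N (M n f - f) + n.+1%:R^-1) @ \oo --> (0 : R).
    by apply: cvg0D => //; exact: cvg_harmonic.
  have h2 := cvgM h h; rewrite mulr0 in h2.
  by apply: cvg_EFin; [exact: nearW|exact: h2].
apply: (squeeze_cvge _ _ up); last exact: cvg_cst.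
apply: nearW => n; rewrite nint_ge0 /= (hnormBC _ (M n f)).
have := @sine_operator_bound n (M n) f n.+1%:R^-1 _ (MP n).1 (MP n).2.
rewrite invr_gt0 ltr0n => /(_ isT); apply: le_trans.
rewrite le_eqVlt; apply/orP; left; apply/eqP.
by apply: eq_integral => x _; rewrite dot_sine_kernel.
Qed.

End SineOperator.

(** * Convergence of coefficients *)

Section FellLimit.
Variable R : realType.
Local Notation C := R[i].
Variables (H : lmodType C) (dot : {dot H for Num.conj}).
Variables (E : nat -> lmodType C) (dotE : forall k, {dot E k for Num.conj}).
Variable J : forall k, {linear E k -> H}.
Hypothesis dotJ : forall k u v, dot (J k u) (J k v) = dotE k u v.
Local Notation N := (hnorm dot).
Local Notation scvg := (scvg dot J).

(** Divide by the norm, which tends to 1. For early k the norm may be 0, and the inverse is then 0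
    by convention, so unit length holds only eventually. *)
Lemma scvg_unit v f : scvg v f -> dot f f = 1 -> exists2 w, scvg w f &
  \forall k \near \oo, dotE k (w k) (w k) = 1.
Proof.
move=> vf f1; pose h k := hnorm (dotE k) (v k).
have hJ k : N (J k (v k)) = h k by congr (Num.sqrt (Re _)); exact: dotJ.
have Nf : N f = 1 by rewrite /hnorm f1 sqrtr1.
have h1 : (fun k => `|h k - 1|) @ \oo --> (0 : R).
  by have /cvg_distP := scvg_norm dotJ vf; rewrite Nf.
exists (fun k => ((h k)^-1)%:C *: v k).
  apply: le_cvg0 (cvg0D h1 vf) => k; rewrite hnorm_ge0 /=.
  apply: le_trans (hnorm_triangle _ (J k (v k)) _ _) _; rewrite lerD2r linearZ /=.
  rewrite -[X in _ - X]scale1r -scalerBl hnormZ hJ.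
  have [h0|h0] := eqVneq (h k) 0; first by rewrite h0 mulr0 normr_ge0.
  have -> : ((h k)^-1)%:C - 1 = ((h k)^-1 - 1)%:C :> C by rewrite rmorphB rmorph1.
  rewrite /= expr0n addr0 sqrtr_sqr -[X in _ * X]ger0_norm ?hnorm_ge0// -normrM.
  by rewrite mulrBl mulVf// mul1r distrC.
apply: (nearS _ (cvg0_lt h1 ltr01)) => k hk.
have h0 : h k != 0 by apply: contraTneq hk => ->; rewrite sub0r normrN normr1 ltxx.
rewrite dot_hnorm hnormZ /= expr0n addr0 sqrtr_sqr ger0_norm ?invr_ge0 ?hnorm_ge0//.
by rewrite mulVf// expr1n.
Qed.

(** The same unit vectors w_k serve every g, since inner products pass to strong limits; finiteness
    of F merges the thresholds. *)
Lemma fell_limit (G : groupType) (rho : forall k, G -> {linear E k -> E k})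
    (rho0 : G -> {linear H -> H}) (F : set G) (eps : R) f :
  (forall g v h, scvg v h -> scvg (fun k => rho k g (v k)) (rho0 g h)) ->
  (exists v, scvg v f) -> dot f f = 1 -> finite_set F -> 0 < eps ->
  \forall k \near \oo, fell_basic_nbhd dot rho0 F eps f (dotE k) (rho k).
Proof.
move=> rho_cvg [v vf] f1 /finite_seqP[gs ->] eps0.
have [w wf w1] := scvg_unit vf f1.
have coef (s : seq G) : \forall k \near \oo, forall g, g \in s ->
    normc (dotE k (w k) (rho k g (w k)) - dot f (rho0 g f)) < eps.
  elim: s => [|g s IH]; first by apply: nearW.
  apply: (nearS2 _ (cvg0_lt (scvg_dot dotJ wf (rho_cvg g _ _ wf)) eps0) IH).
  by move=> k gk sk g'; rewrite inE => /predU1P[->|/sk].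
apply: (nearS2 _ w1 (coef gs)) => k wk gk; exists (w k) => // g /gk.
by rewrite normrcE normcBC ltcR.
Qed.

End FellLimit.

Theorem theorem2 (R : realType) :
  exists (a b : nat -> (R[i] : numFieldType)) (a' b' : R[i])
         (rho : forall k : nat,
            SL2Z -> {linear 'rV[R[i]]_k.+1 -> 'rV[R[i]]_k.+1})
         (rho' : SL2Z -> {linear L2odd R -> L2odd R}),
    [/\ forall k : nat, (1 <= k)%N -> quantum_SU2_rep (a k) (b k) (rho k),
        metaplectic_odd_rep a' b' rho',
        cvgn a /\ cvgn b &
        forall (f : L2odd R) (F : set SL2Z) (eps : R),
          L2odd_dot f f = 1 -> finite_set F -> 0 < eps ->
          \forall k \near \oo,
            fell_basic_nbhd (@L2odd_dot R) rho' F eps f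
              (@dotmx R[i] k.+1) (rho k)].
Proof.
have [s [t [c [c0 [[siso tiso scv tcv ss] [c1 ck cc0 st]]]]]] := limit_operators R.
have [b [b0 [b1 b01 bc b0c bb0]]] := cube_root_limit c1 cc0.
pose sk k : {linear 'rV[R[i]]_k.+1 -> 'rV[R[i]]_k.+1} := mulmxr (sine_mx R k).
pose tk k : {linear 'rV[R[i]]_k.+1 -> 'rV[R[i]]_k.+1} := mulmxr (theta_mx R k).
have [rep0 rep0S rep0T] := SL2Z_repP siso tiso ss b01 b0c st.
have repk k : [/\ unitary_rep (@dotmx R[i] k.+1) (SL2Z_rep (sk k) (tk k) (b k)),
    forall v, SL2Z_rep (sk k) (tk k) (b k) SL2Z_S v = sk k v &
    forall v, SL2Z_rep (sk k) (tk k) (b k) SL2Z_T v = b k *: tk k v].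
  have skK v : sk k (sk k v) = v by rewrite /= -mulmxA sine_mx_sqr mulmx1.
  exact: (@SL2Z_repP R _ (@dotmx R[i] k.+1) (sk k) (tk k) (@sine_mx_isometry R k)
    (@theta_mx_isometry R k) skK _ _ (b1 k) (bc k) (ck k)).
(* S takes the phase 1 throughout because the sine matrices already square to 1; the correction is
   carried by T alone. *)
exists (fun=> 1), b, 1, b0, (fun k => SL2Z_rep (sk k) (tk k) (b k)), (SL2Z_rep s t b0).
split.
- move=> k _; have [u uS uT] := repk k; split=> //.
  + by rewrite normr1 normrcE b1.
  + move=> l; rewrite uS scale1r /= -rowE [LHS]row_sum_delta.
    by apply: eq_bigr => m _; rewrite !mxE.
  + by move=> l; rewrite uT /= -rowE row_diag_mx mxE.
- split=> //.
  + by rewrite normr1 normrcE b01.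
  + move=> f; exists (s f); last by rewrite rep0S scale1r.
    exact: metaplectic_S_odd_limit.
  + move=> f; exists (t f); last exact: rep0T.
    exact: metaplectic_T_limit.
- by split; [exact: is_cvg_cst|exact: cvgn_normc bb0].
move=> f F eps f1 Ffin eps0.
apply: (@fell_limit R _ _ _ (fun k => @dotmx R[i] k.+1) (@embed R)) => //.
- by move=> k u v; exact: dot_embed.
- move=> g v h vh; rewrite /SL2Z_rep lin_wordE.
  apply: le_cvg0 (@scvg_eval_word R _ _ _ _ sk (fun k => b k \*: tk k) s (b0 \*: t)
    (SL2Z_word g) scv _ v h vh) => [k|v' h' vh'].
    by rewrite lin_wordE hnorm_ge0 lexx.
  exact: scvg_scale b1 bb0 (tcv _ _ vh').
- exact: scvg_total.
Qed.
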